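(* If $\Lambda\subset SL(2,\mathbb R)$ is a countable lattice (i.e. a discrete subgroup of finite co-volume), then $\Lambda$ is framenable.
   Context: ''Countable'' means countably infinite. Hilbert spaces are complex and separable; $\mathcal U(H)$ is the group of unitary operators on $H$. A countable discrete group $G$ is framenable if there exist a unitary representation $\pi:G\to\mathcal U(H)$ with $1_G\prec\pi$, a countable (infinite) subset $S\subset G$, and a vector $v\in H$ such that $\{\pi_g v\}_{g\in S}$ is a weak frame. Here $1_G\prec\pi$ means that there is a net $(v_i)_{i\in I}$ of unit vectors in $H$ with $\|\pi_g v_i-v_i\|\to0$ for every $g\in G$. A family $\{f_n\}_{n\in S}$ in $H$ indexed by a countable set $S$ is a weak frame if $0<\sum_{n\in S}|\langle v,f_n\rangle|^2<\infty$ for every $v\in H$, $v\ne0$. *)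

(* Defs.v *)
From HB Require Import structures.
From mathcomp Require Import all_boot all_order all_algebra.
From mathcomp Require Import sesquilinear complex.
From mathcomp Require Import all_classical all_reals all_analysis.
Set Implicit Arguments.
Unset Strict Implicit.
Unset Printing Implicit Defensive.
Import Order.TTheory GRing.Theory Num.Theory.
Import numFieldNormedType.Exports.
Local Open Scope classical_set_scope.
Local Open Scope ring_scope.
Local Open Scope complex_scope.

(* The inner product is linear in its first argument. *)
Record hilbert (R : realType) := Hilbert {
  hilbert_sort :> completeNormedModType R[i];
  inner : {dot hilbert_sort for (@Num.conj R[i])};
  hilbert_normE : forall x : hilbert_sort, `|x| ^+ 2 = inner x x;
  hilbert_separable :
    exists2 D : set hilbert_sort, countable D & dense D }.

Definition unitary (R : realType) (H : hilbert R) (U : {linear H -> H}) : Prop :=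
  bijective U /\ forall x y : H, inner H (U x) (U y) = inner H x y.

Record unitary_rep (R : realType) (G : groupType) (H : hilbert R) := UnitaryRep {
  urep :> G -> {linear H -> H};
  urep_unitary : forall g : G, unitary (urep g);
  urepM : forall (g h : G) (x : H), urep (g * h)%g x = urep g (urep h x) }.

Definition directed (I : Type) (le : I -> I -> Prop) : Prop :=
  [/\ inhabited I, forall i, le i i,
      forall i j k, le i j -> le j k -> le i k &
      forall i j, exists2 k, le i k & le j k].

(* A net [v] of almost invariant unit vectors; the norm of [H] takes its (real) values in [R[i]]. *)
Definition weakly_contains_trivial (R : realType) (G : groupType)
    (H : hilbert R) (pi : unitary_rep G H) : Prop :=
  exists (I : Type) (le : I -> I -> Prop) (v : I -> H),
  [/\ directed le, forall i, `|v i| = 1 &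
      forall (g : G) (eps : R), 0 < eps ->
        exists i0 : I, forall i : I, le i0 i -> `|pi g (v i) - v i| < eps%:C].

Definition countably_infinite (T : Type) (S : set T) : Prop :=
  (S #= [set: nat])%card.

Definition weak_frame (R : realType) (H : hilbert R) (T : choiceType)
    (S : set T) (f : T -> H) : Prop :=
  forall v : H, v != 0 ->
    (0 < \esum_(n in S) ((Normc.normc (inner H v (f n))) ^+ 2)%:E < +oo)%E.

Definition framenable (R : realType) (G : groupType) : Prop :=
  exists (H : hilbert R) (pi : unitary_rep G H),
    weakly_contains_trivial pi /\
    exists (S : set G) (v : H),
      countably_infinite S /\ weak_frame S (fun g => pi g v).

Definition SL2 (R : realType) : Type := {A : 'M[R]_2 | \det A == 1}.

Section SL2_group.
Variable R : realType.
Implicit Types A B C : SL2 R.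

HB.instance Definition _ := [isSub of SL2 R for sval].
HB.instance Definition _ := [Choice of SL2 R by <:].

Fact SL2_one_subproof : \det (1%:M : 'M[R]_2) == 1.
Proof. by rewrite det1. Qed.

Fact SL2_mul_subproof A B : \det (val A *m val B) == 1.
Proof. by rewrite det_mulmx (eqP (valP A)) (eqP (valP B)) mulr1. Qed.

Fact SL2_inv_subproof A : \det (invmx (val A)) == 1.
Proof. by rewrite det_inv (eqP (valP A)) invr1. Qed.

Definition SL2_one : SL2 R := Sub 1%:M SL2_one_subproof.
Definition SL2_mul A B : SL2 R := Sub (val A *m val B) (SL2_mul_subproof A B).
Definition SL2_inv A : SL2 R := Sub (invmx (val A)) (SL2_inv_subproof A).

Fact SL2_unitmx A : val A \in unitmx.
Proof. by rewrite unitmxE (eqP (valP A)) unitr1. Qed.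

Fact SL2_mulA : associative SL2_mul.
Proof. by move=> A B C; apply: val_inj; rewrite /= mulmxA. Qed.

Fact SL2_mul1 : left_id SL2_one SL2_mul.
Proof. by move=> A; apply: val_inj; rewrite /= mul1mx. Qed.

Fact SL2_mulr1 : right_id SL2_one SL2_mul.
Proof. by move=> A; apply: val_inj; rewrite /= mulmx1. Qed.

Fact SL2_mulV : left_inverse SL2_one SL2_inv SL2_mul.
Proof. by move=> A; apply: val_inj; rewrite /= mulVmx ?SL2_unitmx. Qed.

Fact SL2_mulrV : right_inverse SL2_one SL2_inv SL2_mul.
Proof. by move=> A; apply: val_inj; rewrite /= mulmxV ?SL2_unitmx. Qed.

HB.instance Definition _ := isGroup.Build (SL2 R)
  SL2_mulA SL2_mul1 SL2_mulr1 SL2_mulV SL2_mulrV.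
HB.instance Definition _ := isPointed.Build (SL2 R) SL2_one.
HB.instance Definition _ :=
  Topological.copy (SL2 R) (initial_topology (val : SL2 R -> 'M[R]_2)).

End SL2_group.

Definition subgroup_type (G : groupType) (L : groupClosed G) : Type :=
  {x : G | x \in L}.

Section subgroup_group.
Variables (G : groupType) (L : groupClosed G).

HB.instance Definition _ := [isSub of subgroup_type L for sval].
HB.instance Definition _ := [Choice of subgroup_type L by <:].

Fact subgroup_closed : group_closed [pred x | x \in L].
Proof.
split=> [|x y xL yL]; first exact: gpred1.
by apply: gpredM => //; apply: gpredVr.
Qed.

HB.instance Definition _ :=
  SubChoice_isSubGroup.Build G _ (subgroup_type L) subgroup_closed.

End subgroup_group.

Notation SL2_borel R := (g_sigma_algebraType (@open (SL2 R))).

(* SL(2, R) is second countable and locally compact, so that regularity is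
   automatic. *)
Definition left_haar (R : realType)
    (mu : {measure set (SL2_borel R) -> \bar R}) : Prop :=
  [/\ (0 < mu [set: SL2_borel R])%E,
      forall K : set (SL2 R), compact K -> (mu K < +oo)%E &
      forall (g : SL2 R) (A : set (SL2_borel R)), measurable A ->
        mu [set (g * x)%g | x in (A : set (SL2 R))] = mu A].

(* A Borel set meeting every coset [L x] exactly once. *)
Definition fundamental_domain (R : realType) (L : groupClosed (SL2 R))
    (F : set (SL2_borel R)) : Prop :=
  measurable F /\
  forall x : SL2 R, exists! l : subgroup_type L, F (val l * x)%g.

(* The co-volume is the Haar measure of a fundamental domain; by left invariance
   of [mu] it does not depend on the domain, and since SL(2, R) is unimodular,
   left and right cosets give the same notion. *)
Definition finite_covolume (R : realType) (L : groupClosed (SL2 R)) : Prop :=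
  exists (mu : {measure set (SL2_borel R) -> \bar R}) (F : set (SL2_borel R)),
    [/\ left_haar mu, fundamental_domain L F & (mu F < +oo)%E].

Definition discrete_subgroup (R : realType) (L : groupClosed (SL2 R)) : Prop :=
  forall x : SL2 R, x \in L -> isolated [set` L] x.

Definition lattice (R : realType) (L : groupClosed (SL2 R)) : Prop :=
  discrete_subgroup L /\ finite_covolume L.

(* Main.v *)
Require Import Defs.
From HB Require Import structures.
From mathcomp Require Import all_boot all_order all_algebra.
From mathcomp Require Import sesquilinear complex finmap.
From mathcomp Require Import all_classical all_reals all_analysis.
From mathcomp Require Import ring lra zify.
Set Implicit Arguments.
Unset Strict Implicit.
Unset Printing Implicit Defensive.
Import Order.TTheory GRing.Theory Num.Theory.
Import numFieldNormedType.Exports.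
Local Open Scope classical_set_scope.
Local Open Scope ring_scope.
Local Open Scope complex_scope.

(** A discrete subgroup [L] of SL(2, R) acts on the hyperbolic plane, and the
    logarithm of the hyperbolic cosine of the displacement of a base point grows like
    a distance while it is conditionally negative definite ([pos_def_log_cosh]).
    This gives a positive definite function on [L] that decays at most quadratically in
    a length function and yet is summable along the powers of a hyperbolic element.
    Any countably infinite group with such a function is framenable
    ([framenable_of_pos_def]).

    The criterion.  Let [phi] be positive definite and nonnegative on [G], at least
    [(1 + l g) ^- 2] for a length [l], and summable on the powers of some [a] of
    infinite order.  Averaging [phi] on both sides by powers of [a], against a summable
    sequence whose Fourier transform is supported in a small arc, preserves these
    properties and makes the sequence [phi (a ^+ n)] band limited
    ([smooth_band_limited]).  The Gelfand-Naimark-Segal construction, made explicit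
    by a Cholesky factorization in the space of square summable sequences
    ([cyclic_representation]), gives a cyclic representation with
    [<pi g v, pi h v> = phi (h^-1 * g)].
    - Almost invariant vectors: let [T] be the sum of [N] translations.  All [N ^ n] terms
      of [<T ^ n v, v>] are at least a multiple of [1 / n ^ 2], so that this sequence
      is not exponentially smaller than [N ^ n].  Some [T ^ n v] is
      thus nearly a maximizing vector for [T], and by uniform convexity it is nearly
      fixed by the [N] translations ([almost_invariant_vector]).
    - Weak frame: as the spectral measure of [a] at [v] lives in the disc
      [|1 - z| < 1], the vectors [(1 - a) ^ K v] tend to 0, and [v] is in the
      closed span of [a ^+ n v], [n >= m], for every [m] ([cspan_tail]).  So every
      translate [pi g v] is approximated by finitely many [pi (g * a ^+ n) v] with [n]
      as large as desired.  Such a block satisfies a Bessel inequality, by summability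
      and Schur's test, and for [n] large it is almost orthogonal to the blocks
      already chosen ([far_block]).  The union of the blocks is total, hence
      separates vectors, and it satisfies a Bessel inequality ([exists_weak_frame]).

    The subgroup.  If [L] contains a hyperbolic element, the criterion applies to
    the kernel above ([framenable_hyperbolic]).  Otherwise all traces are at most 2 in
    absolute value, and the trace of a commutator constrains [L] severely.  If [L]
    contains a parabolic element, up to signs it is contained in the unipotent
    one-parameter group of that element, so that it has a nonzero real character, to
    which the criterion applies as well ([framenable_parabolic]).  If it contains an
    elliptic element, all of [L] fixes the same point and is bounded
    ([elliptic_bounded]); it is bounded too if it contains scalar matrices only.
    Boundedness is excluded, since a bounded discrete subgroup is finite
    ([discrete_bounded_finite]). *)

(** * Positive definite kernels *)

Section PositiveDefiniteKernels.
Variable R : realType.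

Definition quadform (T : Type) (K : T -> T -> R) (s : seq (R * T)) : R :=
  \sum_(p <- s) \sum_(q <- s) p.1 * q.1 * K p.2 q.2.

(** Finite families are lists of weighted points, so that they can be
    concatenated, mapped and multiplied without any side condition. *)
Definition pos_def (T : Type) (K : T -> T -> R) : Prop :=
  (forall x y, K x y = K y x) /\ forall s, 0 <= quadform K s.

Lemma pos_def_ext T (K K' : T -> T -> R) :
  (forall x y, K x y = K' x y) -> pos_def K -> pos_def K'.
Proof.
by move=> E; have -> : K = K' by apply/funext => x; apply/funext => y; exact: E.
Qed.

Lemma quadform_map T I (K : T -> T -> R) (c : I -> R) (x : I -> T) (r : seq I) :
  quadform K [seq (c i, x i) | i <- r] =
  \sum_(i <- r) \sum_(j <- r) c i * c j * K (x i) (x j).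
Proof. by rewrite /quadform big_map; apply: eq_bigr => i _; rewrite big_map. Qed.

Lemma pos_def_comp T T' (f : T' -> T) (K : T -> T -> R) :
  pos_def K -> pos_def (fun x y => K (f x) (f y)).
Proof.
move=> [sK pK]; split=> [x y|s]; first exact: sK.
by have := pK [seq (p.1, f p.2) | p <- s]; rewrite quadform_map.
Qed.

Lemma pos_defD T (K K' : T -> T -> R) :
  pos_def K -> pos_def K' -> pos_def (fun x y => K x y + K' x y).
Proof.
move=> [sK pK] [sK' pK']; split=> [x y|s]; first by rewrite sK sK'.
suff -> : quadform (fun x y => K x y + K' x y) s = quadform K s + quadform K' s.
  by rewrite addr_ge0.
rewrite /quadform -big_split; apply: eq_bigr => p _ /=.
by rewrite -big_split; apply: eq_bigr => q _ /=; rewrite mulrDr.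
Qed.

Lemma pos_def_weight T (f : T -> R) (K : T -> T -> R) :
  pos_def K -> pos_def (fun x y => f x * f y * K x y).
Proof.
move=> [sK pK]; split=> [x y|s]; first by rewrite sK (mulrC (f x)).
suff -> : quadform (fun x y => f x * f y * K x y) s =
    quadform K [seq (p.1 * f p.2, p.2) | p <- s] by [].
rewrite quadform_map; apply: eq_bigr => p _; apply: eq_bigr => q _.
by rewrite mulrA mulrACA.
Qed.

Lemma pos_def_cst T (c : R) : 0 <= c -> pos_def (fun _ _ : T => c).
Proof.
move=> c0; split=> [//|s].
rewrite /quadform; under eq_bigr do rewrite -mulr_suml -mulr_sumr.
by rewrite -!mulr_suml mulr_ge0 // -expr2 sqr_ge0.
Qed.

Lemma pos_def_rank1 T (f : T -> R) : pos_def (fun x y => f x * f y).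
Proof.
apply: pos_def_ext (pos_def_weight f (pos_def_cst T ler01)) => x y.
by rewrite mulr1.
Qed.

Lemma pos_defZ T (c : R) (K : T -> T -> R) :
  0 <= c -> pos_def K -> pos_def (fun x y => c * K x y).
Proof.
move=> c0 pK; apply: pos_def_ext (pos_def_weight (fun=> Num.sqrt c) pK) => x y.
by rewrite -expr2 sqr_sqrtr.
Qed.

Lemma pos_def_sum T n (K : nat -> T -> T -> R) :
  (forall k, pos_def (K k)) -> pos_def (fun x y => \sum_(k < n) K k x y).
Proof.
move=> pK; elim: n => [|n IH].
  by apply: pos_def_ext (pos_def_cst T (lexx 0)) => x y; rewrite big_ord0.
by apply: pos_def_ext (pos_defD IH (pK n)) => x y; rewrite big_ord_recr.
Qed.

Lemma quadform_cons T (K : T -> T -> R) (t : R) z s :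
  (forall x y, K x y = K y x) ->
  quadform K ((t, z) :: s) =
  t ^+ 2 * K z z + t * (\sum_(p <- s) p.1 * K p.2 z) *+ 2 + quadform K s.
Proof.
move=> sK; rewrite /quadform !big_cons /=.
under [X in _ + X = _]eq_bigr do rewrite big_cons /=.
rewrite big_split /= !addrA; congr (_ + _).
rewrite -expr2; congr (_ + _ + _).
  by rewrite mulr_sumr; apply: eq_bigr => p _; rewrite sK mulrA.
by rewrite mulr_sumr; apply: eq_bigr => p _; rewrite mulrA (mulrC t).
Qed.

Lemma quadform_cvg T (Kn : nat -> T -> T -> R) (K : T -> T -> R) s :
  (forall x y, (fun n => Kn n x y) @ \oo --> K x y) ->
  (fun n => quadform (Kn n) s) @ \oo --> quadform K s.
Proof.
move=> KnK; rewrite /quadform.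
apply: cvg_big => [|p _]; first exact: add_continuous.
apply: cvg_big => [|q _]; first exact: add_continuous.
by apply: cvgMr; exact: KnK.
Qed.

Lemma pos_def_cvg T (Kn : nat -> T -> T -> R) (K : T -> T -> R) :
  (forall n, pos_def (Kn n)) -> (forall x y, (fun n => Kn n x y) @ \oo --> K x y) ->
  pos_def K.
Proof.
move=> pK KnK; split=> [x y|s].
  apply: (cvg_unique (@Rhausdorff R) (KnK x y)); have := KnK y x.
  by under eq_cvg do rewrite (pK _).1.
have cq := @quadform_cvg _ _ _ s KnK; rewrite -(cvg_lim (@Rhausdorff R) cq).
by apply: limr_ge; [exact: cvgP cq | apply: nearW => n; exact: (pK n).2].
Qed.

Lemma pos_def_diag T (K : T -> T -> R) x : pos_def K -> 0 <= K x x.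
Proof.
by move=> [_ /(_ [:: (1, x)])]; rewrite /quadform !big_seq1 /= !mul1r.
Qed.

(** One step of Gaussian elimination: the new form is the minimum of the old one over
    the multiples of [z] that can be added to a family.  If [K z z] vanishes, nothing is
    subtracted, because the inverse of 0 is 0. *)
Lemma pos_def_schur T (K : T -> T -> R) z :
  pos_def K -> pos_def (fun x y => K x y - K x z * K z y / K z z).
Proof.
move=> pdK; have [sK pK] := pdK; split=> [x y|s].
  by rewrite sK (sK x z) (sK z y) (mulrC (K z x)).
set b := \sum_(p <- s) p.1 * K p.2 z.
have -> : quadform (fun x y => K x y - K x z * K z y / K z z) s =
          quadform K s - b ^+ 2 / K z z.
  rewrite /quadform expr2 /b mulr_suml mulr_suml -sumrB; apply: eq_bigr => p _.
  rewrite mulr_sumr mulr_suml -sumrB; apply: eq_bigr => q _.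
  by rewrite (sK z); ring.
have [z0|z0] := eqVneq (K z z) 0; first by rewrite z0 invr0 mulr0 subr0.
have := pK ((- (b / K z z), z) :: s); rewrite quadform_cons //.
suff -> : (- (b / K z z)) ^+ 2 * K z z + - (b / K z z) * b *+ 2 =
  - (b ^+ 2 / K z z) by rewrite addrC.
by field.
Qed.

(** Cauchy-Schwarz, which is positivity of the diagonal of the Schur complement. *)
Lemma pos_def_sqr_le T (K : T -> T -> R) x y :
  pos_def K -> K x y ^+ 2 <= K x x * K y y.
Proof.
move=> pdK; have [sK pK] := pdK.
have := pos_def_diag y (pos_def_schur x pdK) => /=; rewrite (sK y x).
have := pos_def_diag x pdK; rewrite le_eqVlt => /orP[/eqP x0 _|x0].
  rewrite -x0 mul0r; have := pos_def_diag y pdK => y0.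
  have H t : 0 <= t * K x y *+ 2 + K y y.
    have := pK [:: (t, x); (1, y)].
    rewrite quadform_cons // -x0 mulr0 add0r !big_seq1 /= mul1r (sK y).
    by rewrite /quadform !big_seq1 /= !mul1r.
  have := H (- (K y y + 1) * K x y).
  set k := K x y; set d := K y y in y0 *; rewrite mulr2n.
  have [-> //|k0] := eqVneq k 0; first by rewrite expr0n.
  have k2 : 0 < k ^+ 2 by rewrite exprn_even_gt0.
  have := H (- ((d + 1) / k)); rewrite -/k -/d mulNr divfK // mulr2n; lra.
by rewrite subr_ge0 -expr2 ler_pdivrMr // mulrC.
Qed.

(** * Cholesky factorization *)

Fixpoint cholesky_rest (K : nat -> nat -> R) m : nat -> nat -> R :=
  if m is m'.+1 then
    fun i j => let L := cholesky_rest K m' in L i j - L i m' * L m' j / L m' m'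
  else K.

(** When the pivot vanishes so does its whole column, and the junk value of the
    inverse makes this factor the zero column, as it should be. *)
Definition cholesky (K : nat -> nat -> R) m i : R :=
  cholesky_rest K m i m / Num.sqrt (cholesky_rest K m m m).

Section Cholesky.
Variable K : nat -> nat -> R.
Hypothesis pdK : pos_def K.

Lemma pos_def_cholesky_rest m : pos_def (cholesky_rest K m).
Proof. by elim: m => //= m; exact: pos_def_schur. Qed.

Lemma cholesky_rest_pivot0 m i :
  cholesky_rest K m m m = 0 -> cholesky_rest K m i m = 0.
Proof.
move=> m0; have := pos_def_sqr_le i m (pos_def_cholesky_rest m).
by rewrite m0 mulr0 => h; apply/eqP; rewrite -sqrf_eq0 eq_le h sqr_ge0.
Qed.

Lemma cholesky_rest_lt m i j : (i < m)%N -> cholesky_rest K m i j = 0.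
Proof.
elim: m i j => //= m IH i j; rewrite ltnS leq_eqVlt => /orP[/eqP ->|im].
  set L := cholesky_rest K m; have [m0|m0] := eqVneq (L m m) 0.
    have := cholesky_rest_pivot0 j m0; rewrite (pos_def_cholesky_rest m).1 => mj.
    by rewrite -/L in mj; rewrite mj mulr0 mul0r subrr.
  by rewrite mulrAC divff // mul1r subrr.
by rewrite IH // (IH _ m) // !mul0r subrr.
Qed.

Lemma cholesky_lt m i : (i < m)%N -> cholesky K m i = 0.
Proof. by move=> im; rewrite /cholesky cholesky_rest_lt // mul0r. Qed.

Lemma cholesky_pivot m : cholesky K m m = Num.sqrt (cholesky_rest K m m m).
Proof.
rewrite /cholesky; have d0 := pos_def_diag m (pos_def_cholesky_rest m).
rewrite -{1}(sqr_sqrtr d0) expr2.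
have [->|s0] := eqVneq (Num.sqrt (cholesky_rest K m m m)) 0; first by rewrite !mul0r.
by rewrite mulfK.
Qed.

Lemma cholesky_pivot0 m i : cholesky K m m = 0 -> cholesky K m i = 0.
Proof. by rewrite cholesky_pivot /cholesky => ->; rewrite invr0 mulr0. Qed.

Lemma cholesky_mul m i j :
  cholesky K m i * cholesky K m j =
  cholesky_rest K m i m * cholesky_rest K m m j / cholesky_rest K m m m.
Proof.
have d0 := pos_def_diag m (pos_def_cholesky_rest m).
rewrite /cholesky mulrACA -invfM -expr2 sqr_sqrtr //.
by rewrite ((pos_def_cholesky_rest m).1 j).
Qed.

Lemma cholesky_restE n i j :
  K i j = cholesky_rest K n i j + \sum_(m < n) cholesky K m i * cholesky K m j.
Proof.
elim: n => [|n IH]; first by rewrite big_ord0 addr0.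
by rewrite big_ord_recr /= IH cholesky_mul addrACA addNr addr0.
Qed.

Lemma choleskyE n i j : (i < n)%N ->
  K i j = \sum_(m < n) cholesky K m i * cholesky K m j.
Proof. by move=> i_n; rewrite (cholesky_restE n) cholesky_rest_lt // add0r. Qed.

End Cholesky.

(** * Products of positive definite kernels *)

(** Schur's product theorem: on a finite family the first kernel is a sum of
    rank one kernels, and multiplying by a rank one kernel only changes weights. *)
Lemma pos_defM T (K K' : T -> T -> R) :
  pos_def K -> pos_def K' -> pos_def (fun x y => K x y * K' x y).
Proof.
move=> pK pK'; split=> [x y|s]; first by rewrite pK.1 pK'.1.
case: s => [|p0 s0]; first by rewrite /quadform big_nil.
set s := p0 :: s0; pose x i := (nth p0 s i).2; pose c i := (nth p0 s i).1.
pose n := size s.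
have pKx : pos_def (fun i j => K (x i) (x j)) := pos_def_comp x pK.
set Kx := (fun _ => _) in pKx.
have Es : s = [seq (c i, x i) | i <- index_iota 0 n].
  rewrite -[LHS](mkseq_nth p0) /mkseq /index_iota subn0.
  by apply: eq_map => i; rewrite /c /x -surjective_pairing.
have -> : quadform (fun x y => K x y * K' x y) s =
  \sum_(m < n) quadform (fun i j => cholesky Kx m i * cholesky Kx m j *
     K' (x i) (x j)) [seq (c i, i) | i <- index_iota 0 n].
  under eq_bigr do rewrite (quadform_map _ _ id).
  rewrite {1}Es quadform_map [RHS]exchange_big !big_mkord; apply: eq_bigr => i _.
  rewrite [RHS]exchange_big !big_mkord; apply: eq_bigr => j _ /=.
  rewrite -mulr_sumr -mulr_suml; congr (_ * (_ * _)).
  exact: (choleskyE pKx j (ltn_ord i)).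
by apply: sumr_ge0 => m _; apply: (pos_def_weight _ (pos_def_comp x pK')).2.
Qed.

Lemma pos_defX T (K : T -> T -> R) n : pos_def K -> pos_def (fun x y => K x y ^+ n).
Proof.
move=> pK; elim: n => [|n IH]; first exact: (pos_def_cst T ler01).
by apply: pos_def_ext (pos_defM pK IH) => x y; rewrite exprS.
Qed.

(** The powers of [K] are positive definite by Schur's theorem, and so is their sum. *)
Lemma pos_def_geometric T (K : T -> T -> R) :
  pos_def K -> (forall x, K x x < 1) -> pos_def (fun x y => (1 - K x y)^-1).
Proof.
move=> pK K1; apply: (@pos_def_cvg _ (fun n x y => \sum_(k < n) K x y ^+ k)).
  by move=> n; apply: (@pos_def_sum _ n (fun k x y => K x y ^+ k)) => k; exact: pos_defX.
move=> x y; have Kxy : `|K x y| < 1.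
  rewrite -(@ltr_pXn2r _ 2) ?nnegrE // expr1n real_normK ?num_real //.
  apply: le_lt_trans (pos_def_sqr_le x y pK) _.
  by rewrite -[ltRHS]mulr1 ltr_pM ?pos_def_diag.
have := cvg_geometric_series (a := 1) Kxy; rewrite mul1r.
apply: cvg_trans; apply: near_eq_cvg; apply: nearW => n /=.
by rewrite /series /= big_mkord; apply: eq_bigr => k _; rewrite /geometric /= mul1r.
Qed.

(** A kernel [A x + A y - K x y] with [K] positive definite is conditionally
    negative definite, so that its inverse should be positive definite.  Writing it as
    a multiple of [(A x + 1) * (A y + 1) - (A x - 1) * (A y - 1) - 2 * K x y] exhibits
    the inverse as a weighted geometric series. *)
Lemma pos_def_inv T (A : T -> R) (K : T -> T -> R) :
  pos_def K -> (forall x, 0 < A x) -> (forall x, K x x < A x + A x) ->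
  pos_def (fun x y => (A x + A y - K x y)^-1).
Proof.
move=> pK A0 KA; pose w x := (A x + 1)^-1; pose r x := (A x - 1) * w x.
have A1 x : A x + 1 != 0 by rewrite gt_eqF // addr_gt0.
pose b x y := r x * r y + 2 * (w x * w y * K x y).
have pb : pos_def b.
  by apply: pos_defD (pos_def_rank1 r) (pos_defZ _ (pos_def_weight w pK)).
have E x y : 1 - b x y = w x * w y * 2 * (A x + A y - K x y).
  by rewrite /b /r /w; field; rewrite !A1.
have b1 x : b x x < 1.
  rewrite -subr_gt0 E mulr_gt0 // ?subr_gt0 // !mulr_gt0 // invr_gt0 addr_gt0 //.
apply: pos_def_ext (pos_defZ (ler0n _ 2) (pos_def_weight w (pos_def_geometric pb b1))).
move=> x y; rewrite E; have [->|D0] := eqVneq (A x + A y - K x y) 0.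
  by rewrite mulr0 !invr0 !mulr0.
by rewrite /w; field; rewrite !A1 D0.
Qed.

End PositiveDefiniteKernels.

(** * Unordered sums of nonnegative families *)

Section UnorderedSums.
Variable R : realType.

Definition sum_bounded (I : eqType) (f : I -> R) (C : R) : Prop :=
  forall s, uniq s -> \sum_(i <- s) f i <= C.

(** A supremum of finite sums, meaningful for bounded nonnegative families. *)
Definition usum (I : eqType) (f : I -> R) : R :=
  sup [set \sum_(i <- s) f i | s in [set s : seq I | uniq s]].

Lemma ler_sum_subset (I : eqType) (f : I -> R) (s t : seq I) :
  (forall i, 0 <= f i) -> uniq s -> uniq t -> {subset s <= t} ->
  \sum_(i <- s) f i <= \sum_(i <- t) f i.
Proof.
move=> f0 us ut st; rewrite [leRHS](bigID (mem s)) /= -[leLHS]addr0.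
rewrite lerD ?sumr_ge0 // -[leRHS]big_filter.
rewrite (@perm_big _ _ _ _ s [seq i <- t | mem s i]) //.
apply: uniq_perm => // [|i]; first exact: filter_uniq.
by rewrite mem_filter /=; case: (boolP (i \in s)) => //= /st ->.
Qed.

Section Theory.
Variables (I : eqType) (f : I -> R) (C : R).
Hypotheses (f0 : forall i, 0 <= f i) (fC : sum_bounded f C).

Let has_sup_sums :
  has_sup [set \sum_(i <- s) f i | s in [set s : seq I | uniq s]].
Proof.
split; first by exists (\sum_(i <- [::]) f i), [::].
by exists C => _ [s us <-]; exact: fC.
Qed.

Lemma usum_ge s : uniq s -> \sum_(i <- s) f i <= usum f.
Proof. by move=> us; apply: ub_le_sup; [exact: has_sup_sums.2 | exists s]. Qed.

(** Sums along any exhausting sequence of finite sets converge to the unordered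
    sum, which turns finite identities into identities between unordered sums. *)
Lemma usum_cvg (t : nat -> seq I) : (forall n, uniq (t n)) ->
  (forall s : seq I, \forall n \near \oo, {subset s <= t n}) ->
  (fun n => \sum_(i <- t n) f i) @ \oo --> usum f.
Proof.
move=> ut tex; apply/cvgrPdist_lt => e e0.
have [_ [s us <-] hs] := sup_adherent e0 has_sup_sums.
have := tex s; apply: filterS => n st; rewrite ger0_norm ?subr_ge0 ?usum_ge //.
rewrite ltrBlDl -ltrBlDr; apply: lt_le_trans hs _.
exact: ler_sum_subset.
Qed.

End Theory.

Lemma reindex_usum (I J : eqType) (h : I -> J) (f : J -> R) :
  bijective h -> usum (f \o h) = usum f.
Proof.
move=> [k hK kH]; congr (sup _); apply/seteqP; split=> _ [s /= us <-].
  exists [seq h i | i <- s]; last by rewrite big_map.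
  by rewrite /= map_inj_uniq //; exact: can_inj hK.
exists [seq k i | i <- s]; first by rewrite /= map_inj_uniq //; exact: can_inj kH.
by rewrite big_map; apply: eq_bigr => j _ /=; rewrite kH.
Qed.

Lemma sum_bounded_le (I : eqType) (f g : I -> R) C :
  (forall i, f i <= g i) -> sum_bounded g C -> sum_bounded f C.
Proof. by move=> fg gC s us; apply: le_trans (gC s us); exact: ler_sum. Qed.

Lemma sum_boundedZ (I : eqType) (f : I -> R) c C :
  0 <= c -> sum_bounded f C -> sum_bounded (fun i => c * f i) (c * C).
Proof. by move=> c0 fC s us; rewrite -mulr_sumr ler_wpM2l // fC. Qed.

Lemma sum_bounded_reindex (I J : eqType) (h : I -> J) (f : J -> R) C :
  injective h -> sum_bounded f C -> sum_bounded (f \o h) C.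
Proof. by move=> hI fC s us; have := fC (map h s); rewrite big_map map_inj_uniq // => ->. Qed.

Lemma sum_bounded_ge0 (I : eqType) (f : I -> R) C : sum_bounded f C -> 0 <= C.
Proof. by move=> /(_ [::]); rewrite big_nil; exact. Qed.

Lemma sum_allpairs (I J : eqType) (s : seq I) (t : seq J) (F : I * J -> R) :
  \sum_(p <- [seq (i, j) | i <- s, j <- t]) F p = \sum_(i <- s) \sum_(j <- t) F (i, j).
Proof. by rewrite big_allpairs. Qed.

(** Every finite set of pairs is contained in a rectangle. *)
Lemma sum_bounded_pair (I J : eqType) (F : I * J -> R) C :
  (forall p, 0 <= F p) ->
  (forall s t, uniq s -> uniq t -> \sum_(i <- s) \sum_(j <- t) F (i, j) <= C) ->
  sum_bounded F C.
Proof.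
move=> F0 FC s us; set s1 := undup (map fst s); set s2 := undup (map snd s).
apply: le_trans (FC s1 s2 (undup_uniq _) (undup_uniq _)).
rewrite -sum_allpairs; apply: ler_sum_subset => // [|[i j] ijs].
  by apply: allpairs_uniq; rewrite ?undup_uniq // => -[? ?] [].
by apply/allpairsP; exists (i, j); rewrite !mem_undup (map_f fst ijs) (map_f snd ijs).
Qed.

Lemma sum_bounded_nat (g : nat -> R) C : (forall k, 0 <= g k) ->
  (forall n, \sum_(0 <= k < n) g k <= C) -> sum_bounded g C.
Proof.
move=> g0 gC s us; apply: le_trans (gC (\max_(k <- s) k).+1).
apply: ler_sum_subset => // [|k ks]; first exact: iota_uniq.
by rewrite mem_index_iota /= ltnS; exact: leq_bigmax_seq.
Qed.

Lemma sum_bounded_absz (g : nat -> R) C : (forall k, 0 <= g k) ->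
  sum_bounded g C -> sum_bounded (fun n : int => g `|n|%N) (C + C).
Proof.
move=> g0 gC s us; rewrite (bigID (fun n : int => 0 <= n)) /=.
have abs_le (P : pred int) : {in P &, injective absz} ->
    \sum_(n <- s | P n) g `|n|%N <= C.
  move=> inj; rewrite -big_filter -(big_map absz xpredT g); apply: gC.
  rewrite map_inj_in_uniq ?filter_uniq // => m n.
  by rewrite !mem_filter => /andP[mP _] /andP[nP _]; exact: inj.
apply: lerD; apply: abs_le => m n; rewrite -!topredE /= => m0 n0 mn.
  by rewrite -(gez0_abs m0) -(gez0_abs n0) mn.
by apply: oppr_inj; rewrite -!ltz0_abs ?ltNge // mn.
Qed.

(** Comparison with the telescoping series of [1 / ((k + 1) * (k + 2))]. *)
Lemma sum_bounded_inv_sqr (d : R) : 0 < d ->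
  exists C, sum_bounded (fun n : int => (1 + d * n%:~R ^+ 2)^-1) C.
Proof.
move=> d0; pose D := 6 * (1 + d^-1).
pose g (k : nat) : R := k.+1%:R^-1 - k.+2%:R^-1.
have g0 k : 0 <= g k by rewrite subr_ge0 lef_pV2 ?posrE ?ltr0n // ler_nat.
have gC : sum_bounded g 1.
  apply: sum_bounded_nat => // n; rewrite (telescope_sumr_eq (fun k => - k.+1%:R^-1)) //.
    by rewrite opprK invr1 addrC gerBl invr_ge0.
  by move=> k _; rewrite opprK addrC.
exists (D * (1 + 1)); have D0 : 0 <= D by rewrite mulr_ge0 // addr_ge0 // invr_ge0 ltW.
apply: sum_bounded_le (sum_boundedZ D0 (sum_bounded_absz g0 gC)) => n.
have -> : (n%:~R : R) ^+ 2 = `|n|%N%:R ^+ 2.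
  by rewrite natr_absz intr_norm real_normK ?num_real.
set x : R := `|n|%N%:R; have x0 : 0 <= x by rewrite ler0n.
have -> : g `|n|%N = ((x + 1) * (x + 2))^-1.
  rewrite /g -!natr1 -/x; field; rewrite !gt_eqF // -?addrA ?ltr_wpDl //; lra.
rewrite -[leLHS]mul1r ler_pdivrMr; last by nra.
rewrite mulrAC ler_pdivlMr ?mul1r; last by nra.
have -> : D * (1 + d * x ^+ 2) = 6 * (1 + d^-1 + d * x ^+ 2 + x ^+ 2).
  by rewrite /D; field; rewrite gt_eqF.
have e0 : 0 <= d^-1 by rewrite invr_ge0 ltW.
have dx0 : 0 <= d * x ^+ 2 by rewrite mulr_ge0 ?sqr_ge0 // ltW.
by move: (d^-1) e0 (d * x ^+ 2) dx0 => e e0 y y0; nra.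
Qed.

End UnorderedSums.

(** * Band limited sequences *)

Section BandLimited.
Variable R : realType.
Implicit Types (f g : int -> R) (rho M : R).

Definition laplace f (n : int) : R := 2 * f n - f (n + 1) - f (n - 1).

(** If [f] is the sequence of Fourier coefficients of a measure of mass [M], this
    says that the measure is carried by the arc [2 - 2 * cos t <= rho]. *)
Definition band_limited rho M f : Prop :=
  forall K n, `|iter K laplace f n| <= M * rho ^+ K.

Lemma iter_laplace_lin (I : Type) (s : seq I) (w : I -> R) (F : I -> int -> R) K n :
  iter K laplace (fun n => \sum_(i <- s) w i * F i n) n =
  \sum_(i <- s) w i * iter K laplace (F i) n.
Proof.
elim: K n => //= K IH n; rewrite /laplace !IH mulr_sumr -!sumrB.
by apply: eq_bigr => i _; ring.
Qed.

Lemma iter_laplace_cvg (F : nat -> int -> R) f K n :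
  (forall n, (fun k => F k n) @ \oo --> f n) ->
  (fun k => iter K laplace (F k) n) @ \oo --> iter K laplace f n.
Proof.
move=> Ff; elim: K n => //= K IH n.
by apply: cvgB; [apply: cvgB|]; [apply: cvgMr| |]; exact: IH.
Qed.

Lemma band_limited_cvg rho M (F : nat -> int -> R) f :
  (forall k, band_limited rho M (F k)) ->
  (forall n, (fun k => F k n) @ \oo --> f n) -> band_limited rho M f.
Proof.
move=> FM Ff K n; have /cvg_norm cl := iter_laplace_cvg (K := K) (n := n) Ff.
rewrite -(cvg_lim (@Rhausdorff R) cl).
by apply: limr_le; [exact: cvgP cl | apply: nearW => k; exact: FM].
Qed.

Lemma band_limited_reflect rho M f n :
  band_limited rho M f -> band_limited rho M (fun j => f (n - j)).
Proof.
move=> fM K j; suff -> : iter K laplace (fun j => f (n - j)) j = iter K laplace f (n - j).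
  exact: fM.
elim: K j => // K IH j; rewrite !iterS /laplace !IH.
have -> : n - (j + 1) = n - j - 1 by ring.
have -> : n - (j - 1) = n - j + 1 by ring.
ring.
Qed.

Lemma band_limited_sum (I : Type) (s : seq I) (w : I -> R) (F : I -> int -> R) rho M C :
  0 <= rho -> (forall i, 0 <= w i) -> (forall i, band_limited rho M (F i)) ->
  \sum_(i <- s) w i <= C -> 0 <= M ->
  band_limited rho (C * M) (fun n => \sum_(i <- s) w i * F i n).
Proof.
move=> rho0 w0 FM wC M0 K n; rewrite iter_laplace_lin.
apply: le_trans (ler_norm_sum _ _ _) _.
apply: (@le_trans _ _ (\sum_(i <- s) w i * (M * rho ^+ K))).
  by apply: ler_sum => i _; rewrite normrM ger0_norm // ler_wpM2l // FM.
by rewrite -mulr_suml -mulrA ler_wpM2r // mulr_ge0 // exprn_ge0.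
Qed.

(** Averages of cosines of frequency at most [om]. *)
Inductive trig_mean (om : R) : (int -> R) -> Prop :=
| trig_cos (th : R) : `|th| <= om -> trig_mean om (fun n => cos (th * n%:~R))
| trig_avg f g : trig_mean om f -> trig_mean om g ->
    trig_mean om (fun n => (f n + g n) / 2).

Lemma trig_mean_mulcos om f (th : R) : trig_mean om f ->
  trig_mean (om + `|th|) (fun n => f n * cos (th * n%:~R)).
Proof.
elim=> [a ale|g h _ IHg _ IHh].
  have -> : (fun n : int => cos (a * n%:~R) * cos (th * n%:~R)) =
     fun n : int => (cos ((a + th) * n%:~R) + cos ((a - th) * n%:~R)) / 2.
    by apply/funext => n; rewrite (mulrDl a) mulrBl cosB cosD; field.
  apply: trig_avg; apply: trig_cos.
    by rewrite (le_trans (ler_normD _ _)) // lerD.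
  by rewrite (le_trans (ler_normB _ _)) // lerD.
have -> : (fun n : int => (g n + h n) / 2 * cos (th * n%:~R)) =
   fun n => (g n * cos (th * n%:~R) + h n * cos (th * n%:~R)) / 2.
  by apply/funext => n; field.
exact: trig_avg.
Qed.

(** A cosine is an eigenvector of the discrete Laplacian. *)
Lemma laplace_cos th K n :
  iter K laplace (fun n => cos (th * n%:~R)) n =
  (2 - 2 * cos th) ^+ K * cos (th * n%:~R).
Proof.
elim: K n => [|K IH] n; first by rewrite expr0 mul1r.
rewrite /= /laplace !IH !rmorphB !rmorphD /= !mulrBr !mulrDr !mulr1 cosD cosB exprS.
ring.
Qed.

Lemma cos_ge th : 1 - th ^+ 2 / 2 <= cos th :> R.
Proof.
have sin_norm x : 0 <= x -> `|sin x| <= x :> R.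
  rewrite le_eqVlt => /orP[/eqP <-|x0]; first by rewrite sin0 normr0.
  have [c _] := @MVT_segment R sin cos 0 x (ltW x0) (fun y _ => is_derive_sin y)
     (continuous_subspaceT (@continuous_sin R)).
  rewrite sin0 !subr0 => ->; rewrite normrM (gtr0_norm x0).
  by rewrite ler_piMl ?cos_max // ltW.
set y := `|th| / 2; have y0 : 0 <= y by rewrite divr_ge0.
have -> : cos th = cos (y *+ 2).
  have -> : y *+ 2 = `|th| by rewrite /y -mulr_natr divfK.
  by case: (ger0P th) => // _; rewrite cosN.
have -> : th ^+ 2 = 4 * y ^+ 2.
  by rewrite /y expr_div_n real_normK ?num_real //; field.
have := sin_norm y y0; rewrite ler_norml => /andP[? ?]; have := cos2Dsin2 y; rewrite cos_mulr2n.
nra.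
Qed.

Lemma trig_mean_band_limited om f : trig_mean om f -> band_limited (om ^+ 2) 1 f.
Proof.
elim=> [th th_om|g h _ IHg _ IHh] K n; rewrite mul1r.
  rewrite laplace_cos normrM -[leRHS]mulr1 ler_pM ?cos_max // normrX lerXn2r ?nnegrE //.
    by rewrite exprn_even_ge0.
  have om2 : th ^+ 2 <= om ^+ 2.
    by rewrite -(real_normK (num_real th)) lerXn2r ?nnegrE // (le_trans _ th_om).
  by have := cos_ge th; have := cos_le1 th => ? ?; rewrite ger0_norm; lra.
have := iter_laplace_lin [:: true; false] (fun=> 2^-1) (fun b => if b then g else h) K n.
rewrite !big_cons !big_nil /= !addr0 -mulrDr => E.
have -> : (fun n => (g n + h n) / 2) =
    (fun n0 => \sum_(i <- [:: true; false]) 2^-1 * (if i then g else h) n0).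
  by apply/funext => m; rewrite !big_cons big_nil /= addr0 -mulrDr mulrC.
rewrite E normrM ger0_norm ?invr_ge0 // ler_pdivrMl //.
by have := ler_normD (iter K laplace g n) (iter K laplace h n);
  have := IHg K n; have := IHh K n; rewrite mul1r; lra.
Qed.

End BandLimited.

(** * A summable band limited sequence *)

Section Window.
Variable R : realType.

(** Partial Viete products: their limit is [sin x / x]. *)
Definition cos_prod (k : nat) (x : R) : R := \prod_(j < k) cos (x / 2 ^+ j.+1).

Definition window_approx (k : nat) (n : int) : R := cos_prod k (n%:~R / 4) ^+ 2.

(** The square of [sin (n / 4) / (n / 4)], the Fourier coefficients of a triangular
    bump.  It is used through its approximations only, so that the value of the
    limit of the products is never computed. *)
Definition window (n : int) : R := limn (fun k => window_approx k n).

Lemma cos_prod_sin k x : cos_prod k x * (2 ^+ k * sin (x / 2 ^+ k)) = sin x.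
Proof.
elim: k => [|k IH]; first by rewrite /cos_prod big_ord0 !expr0 divr1 !mul1r.
rewrite -[RHS]IH /cos_prod big_ord_recr /= -mulrA; congr (_ * _).
have -> : x / 2 ^+ k = x / 2 ^+ k.+1 *+ 2.
  by rewrite exprS; field; rewrite expf_neq0.
by rewrite sin_mulr2n exprS; ring.
Qed.

Lemma window_approx_ge0 k n : 0 <= window_approx k n.
Proof. exact: sqr_ge0. Qed.

Lemma window_approx_cvg n : (fun k => window_approx k n) @ \oo --> window n.
Proof.
apply: nonincreasing_is_cvgn; last by exists 0 => _ [k _ <-]; exact: window_approx_ge0.
apply/nonincreasing_seqP => k; rewrite /window_approx /cos_prod big_ord_recr /=.
by rewrite exprMn ler_piMr ?sqr_ge0 // -cos2Dsin2 lerDl sqr_ge0.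
Qed.

Lemma window_ge0 n : 0 <= window n.
Proof.
apply: limr_ge; first exact: window_approx_cvg.
by apply: nearW => k; exact: window_approx_ge0.
Qed.

Lemma window0 : window 0 = 1.
Proof.
apply: (@cvg_lim R) => //.
have -> : (fun k => window_approx k 0) = fun=> 1; last exact: cvg_cst.
apply/funext => k; rewrite /window_approx /cos_prod big1 ?expr1n // => j _.
by rewrite !mul0r cos0.
Qed.

Lemma sin_ge_half (y : R) : 0 <= y <= 1 -> y / 2 <= sin y.
Proof.
case/andP; rewrite le_eqVlt => /orP[/eqP <-|y0 y1]; first by rewrite sin0 mul0r.
have [c /andP[]] := @MVT_segment R sin cos 0 y (ltW y0) (fun z _ => is_derive_sin z)
   (continuous_subspaceT (@continuous_sin R)).
rewrite !bnd_simp sin0 !subr0 => c0 cy ->; rewrite mulrC ler_pM2r //.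
have := cos_ge c; have : c ^+ 2 <= 1 by rewrite expr_le1 // (le_trans cy).
by lra.
Qed.

(** The identity [cos_prod_sin] bounds [cos_prod k x] by [2 / x], since [sin y] is at
    least [y / 2] for small [y]. *)
Lemma window_le n : window n <= 128 * (1 + n%:~R ^+ 2)^-1.
Proof.
have [->|n0] := eqVneq n 0; first by rewrite window0 expr0n addr0 invr1; lra.
pose x : R := `|n%:~R| / 4.
have n1 : 1 <= `|n%:~R| :> R by rewrite -intr_norm (_ : 1 = 1%:~R) // ler_int; lia.
have x0 : 0 < x by rewrite /x; lra.
have [k0 hk0] : exists k, x <= 2 ^+ k.
  exists (Num.trunc x).+1; apply: le_trans (ltW (truncnS_gt _)) _.
  by rewrite -natrX ler_nat ltnW // ltn_expl.
apply: limr_le; first exact: window_approx_cvg.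
exists k0 => // k /= k0k; have {hk0} hk : x <= 2 ^+ k.
  by apply: le_trans hk0 _; rewrite ler_weXn2l // ler1n.
have -> : window_approx k n = cos_prod k x ^+ 2.
  rewrite /window_approx /x; congr (_ ^+ 2); apply: eq_bigr => j _.
  by case: (ger0P (n%:~R : R)) => // _; rewrite !mulNr cosN.
have k2 : 0 < 2 ^+ k :> R by rewrite exprn_gt0.
have /(congr1 (fun z => z ^+ 2)) := cos_prod_sin k x; rewrite exprMn.
have xk : 0 <= x / 2 ^+ k <= 1.
  by rewrite ler_pdivrMr // mul1r hk (ltW (divr_gt0 x0 k2)).
have := sin_ge_half xk; set S := sin (x / _); set P := cos_prod k x => hS.
have {}hS : x / 2 <= 2 ^+ k * S.
  have -> : x / 2 = 2 ^+ k * (x / 2 ^+ k / 2) by field; rewrite gt_eqF.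
  by rewrite ler_pM2l.
have : sin x ^+ 2 <= 1 by rewrite -(cos2Dsin2 x) lerDr sqr_ge0.
have -> : (n%:~R : R) ^+ 2 = 16 * x ^+ 2.
  by rewrite /x expr_div_n real_normK ?num_real //; field.
have x4 : 1 <= 4 * x by rewrite /x; lra.
move: (2 ^+ k * S) hS => y hy; have := sqr_ge0 P; move: (P ^+ 2) => p p0 h1 h2.
have y2 : x ^+ 2 / 4 <= y ^+ 2 by nra.
have px : p * (x ^+ 2 / 4) <= 1 by rewrite (le_trans (ler_wpM2l p0 y2)) // h2.
have x16 : 1 <= 16 * x ^+ 2 by nra.
rewrite ler_pdivlMr; last by nra.
have := ler_wpM2l p0 x16; lra.
Qed.

Lemma window_bounded : exists C, sum_bounded window C.
Proof.
have [C hC] := @sum_bounded_inv_sqr R 1 ltr01; exists (128 * C).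
apply: sum_bounded_le (sum_boundedZ (ler0n _ 128) hC) => n /=.
by rewrite mul1r window_le.
Qed.

Lemma trig_mean_cos_prod om f k : trig_mean om f ->
  trig_mean (om + (1 - 2 ^- k) / 4) (fun n => f n * cos_prod k (n%:~R / 4)).
Proof.
move=> omf; elim: k => [|k IH].
  rewrite expr0 invr1 subrr mul0r addr0.
  by have -> : (fun n => f n * cos_prod 0 (n%:~R / 4)) = f
    by apply/funext => n; rewrite /cos_prod big_ord0 mulr1.
have := trig_mean_mulcos ((4 * 2 ^+ k.+1)^-1) IH.
rewrite ger0_norm ?invr_ge0 ?mulr_ge0 ?exprn_ge0 //.
have -> : om + (1 - 2 ^- k) / 4 + (4 * 2 ^+ k.+1)^-1 = om + (1 - 2 ^- k.+1) / 4.
  by rewrite exprS; field; rewrite expf_neq0.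
congr trig_mean; apply/funext => n; rewrite /cos_prod big_ord_recr /= mulrA.
by congr (_ * cos _); field; rewrite expf_neq0.
Qed.

(** The two factors of [window_approx] have frequencies at most [1 / 4], and this gives
    the frequency [1 / 2] and the eigenvalue bound [(1 / 2) ^ 2]. *)
Lemma window_band_limited : band_limited (4^-1) 1 window.
Proof.
apply: (band_limited_cvg _ window_approx_cvg) => k.
have one : trig_mean 0 (fun n => cos (0 * n%:~R : R)) by apply: trig_cos; rewrite normr0.
have := trig_mean_cos_prod k (trig_mean_cos_prod k one).
have -> : (fun n : int => cos (0 * n%:~R) * cos_prod k (n%:~R / 4) * cos_prod k (n%:~R / 4)) =
   window_approx k.
  by apply/funext => n; rewrite mul0r cos0 mul1r -expr2.
move=> /trig_mean_band_limited H K n; apply: le_trans (H K n) _.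
have k0 : 0 < 2 ^- k :> R by rewrite invr_gt0 exprn_gt0.
have k1 : 2 ^- k <= 1 :> R by rewrite invf_le1 ?exprn_gt0 // exprn_ege1 // ler1n.
rewrite !mul1r lerXn2r ?nnegrE ?sqr_ge0 ?invr_ge0 //.
by move: (2 ^- k) k0 k1 => z z0 z1; nra.
Qed.

End Window.

(** * Smoothing a positive definite function along a cyclic subgroup *)

Section IntegerPowers.
Variables (G : groupType) (a : G).

Definition zpow (n : int) : G :=
  match n with Posz k => (a ^+ k)%g | Negz k => (a ^- k.+1)%g end.

Lemma zpowS n : zpow (n + 1) = (zpow n * a)%g.
Proof.
case: n => [k|[|k]]; first by rewrite /= addn1 expgSr.
  by rewrite /= expg1 mulVg.
have -> : Negz k.+1 + 1 = Negz k by lia.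
by rewrite /= [in RHS]expgS invgM mulgVK.
Qed.

Lemma zpowB1 n : zpow (n - 1) = (zpow n * a^-1)%g.
Proof. by rewrite -[in RHS](subrK 1 n) zpowS mulgK. Qed.

Lemma zpow0 : zpow 0 = 1%g. Proof. by []. Qed.

Lemma zpowD n m : zpow (n + m) = (zpow n * zpow m)%g.
Proof.
elim/int_rect: m => [|k IH|k IH]; first by rewrite addr0 mulg1.
  by rewrite -addn1 PoszD addrA !zpowS IH mulgA.
have -> : - Posz k.+1 = - Posz k - 1 by lia.
by rewrite addrA !zpowB1 IH mulgA.
Qed.

Lemma zpowN n : zpow (- n) = ((zpow n)^-1)%g.
Proof. by apply: (mulgI (zpow n)); rewrite -zpowD subrr mulgV. Qed.

Lemma zpow_nat (k : nat) : zpow k = (a ^+ k)%g.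
Proof. by []. Qed.

End IntegerPowers.

Section Smoothing.
Variables (R : realType) (G : groupType) (phi : G -> R) (a : G) (C : R).
Hypothesis phi_ge0 : forall g, 0 <= phi g.
Hypothesis phi_pd : pos_def (fun g h => phi (h^-1 * g)%g).
Hypothesis phi_sum : sum_bounded (fun n : int => phi (zpow a n)) C.

Local Notation window := (@window R).

Let smooth_term g (p : int * int) : R :=
  window p.1 * window p.2 * phi (zpow a (- p.2) * g * zpow a p.1)%g.

(** If [phi g] is the matrix coefficient of a vector [v0], this is that of the
    vector [\sum_n window n *: a ^+ n v0]. *)
Definition smooth g : R := usum (smooth_term g).

Let smooth_term_ge0 g p : 0 <= smooth_term g p.
Proof. by rewrite !mulr_ge0 ?window_ge0. Qed.

Lemma pos_def_fun_le1 g : phi g <= phi 1%g.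
Proof.
have := pos_def_sqr_le g 1%g phi_pd; rewrite mulVg invg1 !mul1g -expr2.
by rewrite ler_pXn2r ?nnegrE.
Qed.

Let box_sum s t g : uniq s -> uniq t ->
  \sum_(i <- s) \sum_(j <- t) smooth_term g (i, j) =
  \sum_(j <- t) window j * \sum_(i <- s) window i * phi (zpow a (- j) * g * zpow a i)%g.
Proof.
move=> us ut; rewrite exchange_big; apply: eq_bigr => j _; rewrite mulr_sumr.
by apply: eq_bigr => i _; rewrite /smooth_term mulrAC mulrC mulrA.
Qed.

Let smooth_bounded : exists D, forall g, sum_bounded (smooth_term g) D.
Proof.
have [W hW] := window_bounded R; exists (W * (W * phi 1%g)) => g.
have W0 := sum_bounded_ge0 hW.
apply: sum_bounded_pair => // s t us ut; rewrite box_sum //.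
apply: (@le_trans _ _ (\sum_(j <- t) window j * (W * phi 1%g))).
  apply: ler_sum => j _; rewrite ler_wpM2l ?window_ge0 //.
  apply: (@le_trans _ _ (\sum_(i <- s) window i * phi 1%g)).
    by apply: ler_sum => i _; rewrite ler_wpM2l ?window_ge0 ?pos_def_fun_le1.
  by rewrite -mulr_suml ler_wpM2r ?hW.
by rewrite -mulr_suml ler_wpM2r ?hW ?mulr_ge0.
Qed.

Let interval (N : nat) : seq int := [seq k%:Z - N%:Z | k <- iota 0 N.*2.+1].

Let interval_uniq N : uniq (interval N).
Proof. by rewrite map_inj_uniq ?iota_uniq // => k l; lia. Qed.

Let mem_interval N n : (n \in interval N) = (`|n| <= N)%N.
Proof.
apply/mapP/idP => [[k]|nN]; first by rewrite mem_iota => kN ->; lia.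
by exists (absz (n + N%:Z)); [rewrite mem_iota; lia | lia].
Qed.

Let box N : seq (int * int) := [seq (i, j) | i <- interval N, j <- interval N].

Let box_uniq N : uniq (box N).
Proof. by apply: allpairs_uniq => // -[? ?] []. Qed.

Let box_exhausts (s : seq (int * int)) : \forall N \near \oo, {subset s <= box N}.
Proof.
exists (\sum_(p <- s) (`|p.1| + `|p.2|))%N => // N /= sN [i j] ijs.
have := sN; rewrite (big_rem _ ijs) /= => {}sN.
by apply/allpairsP; exists (i, j); rewrite !mem_interval /=; split => //; lia.
Qed.

Let smooth_cvg g : (fun N => \sum_(p <- box N) smooth_term g p) @ \oo --> smooth g.
Proof.
have [D hD] := smooth_bounded.
apply: (usum_cvg (smooth_term_ge0 g) (hD g)); [exact: box_uniq | exact: box_exhausts].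
Qed.

Lemma smooth_ge g : phi g <= smooth g.
Proof.
have [D hD] := smooth_bounded.
have := usum_ge (hD g) (erefl : uniq [:: (0, 0) : int * int]).
by rewrite big_seq1 /smooth_term /= !window0 !mul1r mulg1 -[X in (X * g)%g]invg1 invg1 mul1g.
Qed.

Lemma smooth_ge0 g : 0 <= smooth g.
Proof. exact: le_trans (smooth_ge g). Qed.

(** A finite sum of [smooth_term] is the kernel of [phi] on the points [g * a ^+ i]
    with weights [window i]. *)
Lemma smooth_pos_def : pos_def (fun g h => smooth (h^-1 * g)%g).
Proof.
apply: (@pos_def_cvg _ _ (fun N g h => \sum_(p <- box N) smooth_term (h^-1 * g)%g p));
  last by move=> g h; exact: smooth_cvg.
move=> N.
split=> [g h|s].
  rewrite !sum_allpairs exchange_big; apply: eq_bigr => i _; apply: eq_bigr => j _.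
  rewrite /smooth_term /= !zpowN (mulrC (window j)); congr (_ * _).
  have := phi_pd.1 (g * zpow a j)%g (h * zpow a i)%g; rewrite !invgM !mulgA => ->.
  by [].
have := phi_pd.2 [seq (p.1 * window i, (p.2 * zpow a i)%g) | p <- s, i <- interval N].
congr (0 <= _); rewrite /quadform big_allpairs_dep; apply: eq_bigr => p _.
under eq_bigr do rewrite big_allpairs_dep.
rewrite exchange_big; apply: eq_bigr => q _ /=.
rewrite sum_allpairs mulr_sumr; apply: eq_bigr => i _.
rewrite mulr_sumr; apply: eq_bigr => j _.
by rewrite /smooth_term /= zpowN invgM !mulgA; ring.
Qed.

Lemma smooth_sum : exists D, sum_bounded (fun n : int => smooth (zpow a n)) D.
Proof.
have [W hW] := window_bounded R; exists (W * (W * C)) => J uJ.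
have W0 := sum_bounded_ge0 hW; have C0 := sum_bounded_ge0 phi_sum.
have cv : (fun N => \sum_(n <- J) \sum_(p <- box N) smooth_term (zpow a n) p) @ \oo -->
    \sum_(n <- J) smooth (zpow a n).
  by apply: cvg_big => [|n _]; [exact: add_continuous | exact: smooth_cvg].
rewrite -(cvg_lim (@Rhausdorff R) cv).
apply: limr_le; first exact: cvgP cv.
apply: nearW => N; rewrite exchange_big sum_allpairs exchange_big /=.
apply: (@le_trans _ _ (\sum_(j <- interval N) window j * (W * C))); last first.
  by rewrite -mulr_suml ler_wpM2r ?hW ?mulr_ge0.
apply: ler_sum => j _.
apply: (@le_trans _ _ (window j * \sum_(i <- interval N) window i * C)); last first.
  by rewrite -mulr_suml ler_wpM2l ?window_ge0 // ler_wpM2r ?hW.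
rewrite mulr_sumr; apply: ler_sum => i _.
rewrite /smooth_term /= -mulr_sumr -mulrA mulrCA !ler_wpM2l ?window_ge0 //.
under eq_bigr do rewrite -!zpowD.
apply: (sum_bounded_reindex _ phi_sum) uJ => n m.
by move=> /addIr /addrI.
Qed.

(** Only one of the two window variables is translated by [j]; the other factors
    of the sum are nonnegative weights of bounded total mass. *)
Lemma smooth_band_limited :
  exists M, band_limited 4^-1 M (fun j : int => smooth (zpow a j)).
Proof.
have [W hW] := window_bounded R; exists (W * C * 1).
have W0 := sum_bounded_ge0 hW; have C0 := sum_bounded_ge0 phi_sum.
pose w (p : int * int) := window p.2 * phi (zpow a (p.1 - p.2)).
have w0 p : 0 <= w p by rewrite mulr_ge0 ?window_ge0.
pose h j (p : int * int) : int * int := (p.1 - j, p.2).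
have hK j : bijective (h j).
  by exists (fun p => (p.1 + j, p.2)) => -[i k]; rewrite /h /= ?subrK ?addrK.
have wE j : (fun p => w p * window (p.1 - j)) = smooth_term (zpow a j) \o h j.
  apply/funext => -[i k]; rewrite /smooth_term /w /h /= -!zpowD.
  have -> : - k + j + (i - j) = i - k by ring.
  by rewrite mulrC mulrA.
pose F N j := \sum_(p <- box N) w p * window (p.1 - j).
apply: (@band_limited_cvg _ _ _ F); last first.
  move=> j; rewrite /smooth -(reindex_usum _ (hK j)) -wE.
  have [D hD] := smooth_bounded; apply: (@usum_cvg _ _ _ D).
  - by move=> p; rewrite mulr_ge0 ?window_ge0.
  - by rewrite wE; apply: sum_bounded_reindex (hD _); exact: bij_inj.
  - exact: box_uniq.
  - exact: box_exhausts.
move=> N; apply: band_limited_sum => //.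
  by move=> p; apply: band_limited_reflect; exact: window_band_limited.
rewrite sum_allpairs exchange_big /=.
apply: (@le_trans _ _ (\sum_(j <- interval N) window j * C)); last first.
  by rewrite -mulr_suml ler_wpM2r ?hW.
apply: ler_sum => j _; rewrite /w /= -mulr_sumr ler_wpM2l ?window_ge0 //.
by apply: (sum_bounded_reindex _ phi_sum) => // n m /addIr.
Qed.

End Smoothing.

(** * The Hilbert space of square summable sequences *)

Section ComplexSeries.
Variable R : realType.
Implicit Types (u v : nat -> R[i]) (z w : R[i]).

Definition sqnorm z : R := complex.Re z ^+ 2 + complex.Im z ^+ 2.

Lemma sqnorm_ge0 z : 0 <= sqnorm z.
Proof. by rewrite addr_ge0 ?sqr_ge0. Qed.

Lemma sqnorm_eq0 z : (sqnorm z == 0) = (z == 0).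
Proof.
by rewrite paddr_eq0 ?sqr_ge0 // !sqrf_eq0 eq_complex.
Qed.

Lemma sqnormE z : z * conjc z = (sqnorm z)%:C.
Proof. by case: z => a b; rewrite /sqnorm; simpc; congr (_ +i* _); ring. Qed.

Lemma sqnormM z w : sqnorm (z * w) = sqnorm z * sqnorm w.
Proof. by case: z => a b; case: w => c d; rewrite /sqnorm /=; ring. Qed.

Lemma sqnormD_le z w : sqnorm (z + w) <= 2 * (sqnorm z + sqnorm w).
Proof.
case: z => a b; case: w => c d; rewrite /sqnorm /=.
by have := sqr_ge0 (a - c); have := sqr_ge0 (b - d); nra.
Qed.

Lemma sqnorm_normc z : Normc.normc z ^+ 2 = sqnorm z.
Proof. by case: z => a b; rewrite /= sqr_sqrtr // addr_ge0 ?sqr_ge0. Qed.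

Definition sum_to u z : Prop :=
  series (fun k => complex.Re (u k)) @ \oo --> complex.Re z /\
  series (fun k => complex.Im (u k)) @ \oo --> complex.Im z.

Lemma sum_to_unique u z w : sum_to u z -> sum_to u w -> z = w.
Proof.
case: z w => a b [c d] [h1 h2] [h3 h4].
have /= -> := cvg_unique (@Rhausdorff R) h1 h3.
by have /= -> := cvg_unique (@Rhausdorff R) h2 h4.
Qed.

Lemma sum_to_lin a u v z w : sum_to u z -> sum_to v w ->
  sum_to (fun k => a * u k + v k) (a * z + w).
Proof.
move=> [ur ui] [vr vi]; case: a => a b; case: z ur ui => zr zi /= ur ui.
case: w vr vi => wr wi /= vr vi; split.
  have -> : series (fun k => complex.Re ((a +i* b) * u k + v k)) =
    (fun n => a * series (fun k => complex.Re (u k)) n -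
              b * series (fun k => complex.Im (u k)) n +
              series (fun k => complex.Re (v k)) n).
    apply/funext => n; rewrite /series /= !mulr_sumr -sumrB -big_split.
    by apply: eq_bigr => k _; case: (u k) (v k) => ? ? [].
  by apply: cvgD => //; apply: cvgB; apply: cvgMr.
have -> : series (fun k => complex.Im ((a +i* b) * u k + v k)) =
    (fun n => a * series (fun k => complex.Im (u k)) n +
              b * series (fun k => complex.Re (u k)) n +
              series (fun k => complex.Im (v k)) n).
  apply/funext => n; rewrite /series /= !mulr_sumr -!big_split.
  by apply: eq_bigr => k _; case: (u k) (v k) => ? ? [].
by apply: cvgD => //; apply: cvgD; apply: cvgMr.
Qed.

Lemma sum_to_conj u z : sum_to u z -> sum_to (fun k => conjc (u k)) (conjc z).
Proof.
move=> [ur ui]; split.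
  have -> : (fun k => complex.Re (conjc (u k))) = fun k => complex.Re (u k).
    by apply/funext => k; case: (u k).
  by case: z ur {ui}.
have -> : series (fun k => complex.Im (conjc (u k))) =
  fun n => - series (fun k => complex.Im (u k)) n.
  by apply/funext => n; rewrite /series /= -sumrN; apply: eq_bigr => k _; case: (u k).
by case: z {ur} ui => a b ui; exact: cvgN.
Qed.

Definition sqsummable u : Prop :=
  exists M, forall n, series (fun k => sqnorm (u k)) n <= M.

Lemma series_abs_cvg (f g : nat -> R) M : (forall k, `|f k| <= g k) ->
  (forall n, series g n <= M) -> cvgn (series f).
Proof.
move=> fg gM; apply: normed_cvg; apply: (series_le_cvg _ _ fg) => //.
  by move=> k; exact: le_trans (fg k).
apply: nondecreasing_is_cvgn; last by exists M => _ [n _ <-].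
apply/nondecreasing_seqP => n; rewrite /series /= big_nat_recr //= lerDl.
exact: le_trans (fg n).
Qed.

Definition l2dot u v : R[i] :=
  limn (series (fun k => complex.Re (u k * conjc (v k)))) +i*
  limn (series (fun k => complex.Im (u k * conjc (v k)))).

Lemma sum_to_l2dot u v : sqsummable u -> sqsummable v ->
  sum_to (fun k => u k * conjc (v k)) (l2dot u v).
Proof.
move=> [M uM] [N vN].
have b n : series (fun k => sqnorm (u k) + sqnorm (v k)) n <= M + N.
  by rewrite /series /= big_split lerD // ?uM ?vN.
split; apply: (series_abs_cvg _ b) => k; case: (u k) (v k) => a b' [c d];
  rewrite /sqnorm /= ler_norml; apply/andP;
  have := sqr_ge0 (a - c); have := sqr_ge0 (a + c); have := sqr_ge0 (b' - d);
  have := sqr_ge0 (b' + d); have := sqr_ge0 (a - d); have := sqr_ge0 (a + d);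
  have := sqr_ge0 (b' - c); have := sqr_ge0 (b' + c); split; nra.
Qed.

Lemma sqsummable_lin a u v : sqsummable u -> sqsummable v ->
  sqsummable (a *: u + v).
Proof.
move=> [M uM] [N vN]; exists (2 * (sqnorm a * M + N)) => n.
apply: (@le_trans _ _ (series (fun k => 2 * (sqnorm a * sqnorm (u k) + sqnorm (v k))) n)).
  apply: ler_sum => k _; apply: le_trans (sqnormD_le _ _) _.
  by rewrite -sqnormM.
rewrite /series /= -mulr_sumr big_split /= -mulr_sumr ler_wpM2l //.
by rewrite lerD ?vN // ler_wpM2l ?uM ?sqnorm_ge0.
Qed.

End ComplexSeries.

Section CauchySchwarz.
Variables (C : numClosedFieldType) (U : lmodType C) (form : {dot U for (@Num.conj C)}).

(** Valid for any dot product, hence available before the norm is defined. *)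
Lemma dot_CauchySchwarz u v : `|form u v| ^+ 2 <= form u u * form v v.
Proof.
have [->|v0] := eqVneq v 0.
  by rewrite linear0r normr0 expr0n mulr_ge0 ?dnorm_ge0.
have n0 : 0 < form v v by rewrite (dnorm_gt0 form).
have vu : form v u = Num.conj (form u v).
  by rewrite (@hermitian_subproof _ _ false _ form) expr0 mul1r.
have nr : Num.conj (form v v) = form v v by rewrite (CrealP _) // gtr0_real.
have := dnorm_ge0 form (u - (form u v / form v v) *: v).
have lB x y z : form (x - y) z = form x z - form y z by exact: linearBl.
have rB x y z : form z (x - y) = form z x - form z y by exact: linearBr.
have lZ k x z : form (k *: x) z = k * form x z by exact: linearZl_LR.
have rZ k x z : form z (k *: x) = Num.conj k * form z x by exact: linearZr_LR.
rewrite lB !rB !lZ !rZ vu rmorphM fmorphV /= nr normCK.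
move: (form u u) (form v v) (form u v) (Num.conj _) n0 => U0 n d dc n0.
have -> : U0 - dc / n * d - (d / n * dc - d / n * (dc / n * n)) = (U0 * n - d * dc) / n.
  by field; rewrite gt_eqF.
by rewrite pmulr_lge0 ?invr_gt0 // subr_ge0.
Qed.

End CauchySchwarz.

Section L2.
Variables (R : realType) (P : pred nat).

Definition l2_pred : {pred nat -> R[i]} :=
  fun u => `[< sqsummable u /\ forall m, ~~ P m -> u m = 0 >].

(** Square summable sequences supported in [P].  Restricting the support lets the
    vectors produced by a Cholesky factorization span the whole space. *)
Definition l2 : Type := {u : nat -> R[i] | u \in l2_pred}.

Lemma l2_predP u : reflect (sqsummable u /\ forall m, ~~ P m -> u m = 0) (u \in l2_pred).
Proof. exact: asboolP. Qed.

HB.instance Definition _ := [isSub of l2 for sval].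
HB.instance Definition _ := [Choice of l2 by <:].

Fact l2_submod : submod_closed l2_pred.
Proof.
split; first by apply/l2_predP; split=> //; exists 0 => n;
  rewrite /series /= big1 // => k _; rewrite /sqnorm /= !expr0n addr0.
move=> a u v /l2_predP[u2 uP] /l2_predP[v2 vP]; apply/l2_predP.
by split=> [|m Pm]; [exact: sqsummable_lin | rewrite !fctE uP // vP // scaler0 addr0].
Qed.

HB.instance Definition _ := GRing.isSubmodClosed.Build R[i] (nat -> R[i]) l2_pred l2_submod.
HB.instance Definition _ := [SubChoice_isSubLmodule of l2 by <:].

Lemma l2_sq (x : l2) : sqsummable (val x).
Proof. by case/l2_predP: (valP x). Qed.

Lemma l2_supp (x : l2) m : ~~ P m -> val x m = 0.
Proof. by case/l2_predP: (valP x) => _; apply. Qed.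

Definition l2inner (x y : l2) : R[i] := l2dot (val x) (val y).

Lemma sum_to_l2inner x y : sum_to (fun k => val x k * conjc (val y k)) (l2inner x y).
Proof. by apply: sum_to_l2dot; exact: l2_sq. Qed.

Lemma l2inner_conj x y : l2inner x y = conjc (l2inner y x).
Proof.
apply: (sum_to_unique (sum_to_l2inner x y)).
have := sum_to_conj (sum_to_l2inner y x); congr sum_to; apply/funext => k.
by rewrite rmorphM /= conjcK mulrC.
Qed.

Lemma l2innerPl y a x x' : l2inner (a *: x + x') y = a * l2inner x y + l2inner x' y.
Proof.
apply: (sum_to_unique (sum_to_l2inner _ y)).
have := sum_to_lin a (sum_to_l2inner x y) (sum_to_l2inner x' y).
by congr sum_to; apply/funext => k; rewrite /= !fctE mulrDl mulrA.
Qed.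

Fact l2inner_hermitian x y : l2inner x y = (-1) ^+ false * Num.conj (l2inner y x).
Proof. by rewrite expr0 mul1r l2inner_conj. Qed.

Fact l2inner_bilinear :
  bilinear_for ( *%R ) (@Num.conj R[i] \; *%R) l2inner.
Proof.
split=> [y a x x'|y a x x']; first exact: l2innerPl.
by rewrite (l2inner_conj y (a *: x + x')) (l2inner_conj y x) (l2inner_conj y x')
  l2innerPl rmorphD rmorphM.
Qed.

HB.instance Definition _ := bilinear_isBilinear.Build R[i] l2 l2 R[i]
  *%R (@Num.conj R[i] \; *%R) l2inner l2inner_bilinear.

HB.instance Definition _ := isHermitianSesquilinear.Build R[i] l2 false
  (@Num.conj R[i]) l2inner l2inner_hermitian.

Lemma sum_sqnorm_le (x : l2) n :
  \sum_(0 <= k < n) sqnorm (val x k) <= complex.Re (l2inner x x).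
Proof.
have [hr _] := sum_to_l2inner x x.
have -> : \sum_(0 <= k < n) sqnorm (val x k) =
   series (fun k => complex.Re (val x k * conjc (val x k))) n.
  by apply: eq_bigr => k _; rewrite sqnormE.
rewrite -(cvg_lim (@Rhausdorff R) hr); apply: nondecreasing_cvgn_le; last exact: cvgP hr.
apply/nondecreasing_seqP => m; rewrite /series /= big_nat_recr //= lerDl.
by rewrite sqnormE sqnorm_ge0.
Qed.

Fact l2inner_gt0 (x : l2) : x != 0 -> 0 < l2inner x x.
Proof.
move=> x0; have im0 : complex.Im (l2inner x x) = 0.
  have [_ hi] := sum_to_l2inner x x; apply: (cvg_unique (@Rhausdorff R) hi).
  rewrite (_ : series _ = fun=> 0); first exact: cvg_cst.
  by apply/funext => n; rewrite /series /= big1 // => k _; rewrite sqnormE.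
have [k xk] : exists k, val x k != 0.
  apply/not_existsP => x00; move/eqP: x0; apply; apply: val_inj.
  by apply/funext => k; apply/eqP; move: (x00 k) => /negP; rewrite negbK.
rewrite ltcE im0 eqxx /=; apply: lt_le_trans (sum_sqnorm_le x k.+1).
rewrite big_nat_recr //=; apply: ltr_wpDl.
  by apply: sumr_ge0 => j _; exact: sqnorm_ge0.
by rewrite lt_neqAle sqnorm_ge0 eq_sym sqnorm_eq0 xk.
Qed.

HB.instance Definition _ := isDotProduct.Build R[i] l2 l2inner l2inner_gt0.

Definition l2norm (x : l2) : R[i] := sqrtC (l2inner x x).

Fact l2norm_triangle (x y : l2) : l2norm (x + y) <= l2norm x + l2norm y.
Proof.
have n0 z : 0 <= l2norm z by rewrite sqrtC_ge0 dnorm_ge0.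
rewrite -(@ler_pXn2r _ 2) ?nnegrE ?addr_ge0 // sqrrD !sqrtCK dnormD /=.
rewrite [leRHS]addrAC lerD2l.
have -> : l2inner x y + Num.conj (l2inner x y) = 'Re (l2inner x y) *+ 2.
  by rewrite /Num.Theory.Re unlock -mulr_natr divfK ?pnatr_eq0.
rewrite lerMn2r /=; apply: le_trans (leif_Re_Creal _) _.
rewrite -(@ler_pXn2r _ 2) ?nnegrE ?mulr_ge0 // exprMn !sqrtCK.
exact: (@dot_CauchySchwarz R[i] l2 l2inner).
Qed.

Fact l2normZ a (x : l2) : l2norm (a *: x) = `|a| * l2norm x.
Proof. by rewrite /l2norm dnormZ /= rootCMl ?exprn_ge0 // sqrCK. Qed.

Fact l2norm_eq0 (x : l2) : l2norm x = 0 -> x = 0.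
Proof. by move/eqP; rewrite sqrtC_eq0 dnorm_eq0 => /eqP. Qed.

HB.instance Definition _ := Lmodule_isNormed.Build R[i] l2
  l2norm_triangle l2normZ l2norm_eq0.

Fact l2_normE (x : l2) : `|x| ^+ 2 = l2inner x x.
Proof. by rewrite -[ `|x| ]/(l2norm x) sqrtCK. Qed.

End L2.

(** * Sequential completeness and density *)

Section RealNorm.
Variables (R : realType) (V : normedModType R[i]).
Implicit Types x y : V.

(** The norm of [V] takes its values in [R[i]]; real estimates need its real part. *)
Definition rnorm x : R := complex.Re `|x|.

Lemma rnormE x : `|x| = (rnorm x)%:C.
Proof. by rewrite /rnorm RRe_real // ger0_real. Qed.

Lemma rnorm_ge0 x : 0 <= rnorm x.
Proof. by rewrite -ler0c -rnormE. Qed.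

Lemma rnorm_triangle x y : rnorm (x + y) <= rnorm x + rnorm y.
Proof. by rewrite -lecR rmorphD /= -!rnormE ler_normD. Qed.

Lemma rnorm0 : rnorm (0 : V) = 0.
Proof. by rewrite /rnorm normr0. Qed.

Lemma rnorm_eq0 x : (rnorm x == 0) = (x == 0).
Proof. by rewrite -[RHS]normr_eq0 rnormE eq_complex /= eqxx andbT. Qed.

Lemma rnormN x : rnorm (- x) = rnorm x.
Proof. by rewrite /rnorm normrN. Qed.

Lemma rnormB x y : rnorm (x - y) = rnorm (y - x).
Proof. by rewrite -rnormN opprB. Qed.

Lemma rnormZ a x : rnorm (a *: x) = Normc.normc a * rnorm x.
Proof. by rewrite /rnorm normrZ rnormE; case: a => a b /=; rewrite mul0r subr0. Qed.

Lemma rnorm_distD z x y : rnorm (x - y) <= rnorm (x - z) + rnorm (z - y).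
Proof. by have := rnorm_triangle (x - z) (z - y); rewrite addrA subrK. Qed.

Lemma ball_rnormE x (e : R[i]) y : 0 < e -> ball x e y = (rnorm (x - y) < complex.Re e) :> Prop.
Proof.
move=> e0; rewrite -ball_normE /= rnormE.
have -> : e = (complex.Re e)%:C by rewrite RRe_real // gtr0_real.
by rewrite ltcR.
Qed.

Lemma exists_half_pow (e : R) : 0 < e -> exists p : nat, 2 ^- p < e.
Proof.
move=> e0; have := @cvg_expr R (2^-1); rewrite ger0_norm // => /(_ _)/cvgrPdist_lt.
have h : 2^-1 < 1 :> R by rewrite invf_lt1 // ltr1n.
move=> /(_ h e e0)[p _ /(_ p (leqnn p))] /=; rewrite sub0r normrN ger0_norm ?exprn_ge0 // exprVn.
by exists p.
Qed.

(** Centers of balls of radius [2 ^- p] in a Cauchy filter form a sequence with an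
    explicit rate of convergence, so that completeness may be tested on such
    sequences. *)
Lemma seq_complete :
  (forall u : nat -> V, (forall p q, rnorm (u p - u q) < 2 ^- p + 2 ^- q) ->
     exists l, forall p, rnorm (u p - l) <= 2 * 2 ^- p) ->
  forall F : set_system V, ProperFilter F -> cauchy F -> cvg F.
Proof.
move=> complV F FF /cauchyP Fc.
have h2 p : 0 < (2 ^- p)%:C :> R[i] by rewrite ltcR invr_gt0 exprn_gt0.
pose u p := projT1 (cid (Fc _ (h2 p))).
have uF p : F (ball (u p) (2 ^- p)%:C) by rewrite /u; case: cid.
have [|l ul] := complV u.
  move=> p q; have [y [py qy]] := filter_ex (filterI (uF p) (uF q)).
  rewrite !ball_rnormE //= in py qy.
  by apply: le_lt_trans (rnorm_distD y _ _) _; rewrite (rnormB y) ltrD.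
apply/cvg_ex; exists l; apply/cvg_ballP => e e0.
have [p hp] : exists p : nat, 2 ^- p < complex.Re e / 3.
  by apply: exists_half_pow; rewrite divr_gt0 // -ltcR RRe_real // gtr0_real.
apply: filterS (uF p) => y; rewrite !ball_rnormE //= => py.
apply: le_lt_trans (rnorm_distD (u p) _ _) _.
have := ul p; rewrite rnormB; lra.
Qed.

End RealNorm.

Section L2Hilbert.
Variables (R : realType) (P : pred nat).
Local Notation l2 := (@l2 R P).
Implicit Types x y : l2.

Lemma rnorm_l2 x : rnorm x ^+ 2 = complex.Re (l2inner x x).
Proof. by rewrite -l2_normE rnormE -rmorphXn. Qed.

Lemma rnorm_l2_le x M : 0 <= M ->
  (forall n, \sum_(0 <= k < n) sqnorm (val x k) <= M ^+ 2) -> rnorm x <= M.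
Proof.
move=> M0 xM; rewrite -(@ler_pXn2r _ 2) ?nnegrE ?rnorm_ge0 // rnorm_l2.
have [hr _] := sum_to_l2inner x x; rewrite -(cvg_lim (@Rhausdorff R) hr).
apply: limr_le; first exact: cvgP hr.
apply: nearW => n; apply: le_trans (xM n); apply: ler_sum => k _.
by rewrite sqnormE.
Qed.

Lemma sum_sqnorm_rnorm x n : \sum_(0 <= k < n) sqnorm (val x k) <= rnorm x ^+ 2.
Proof. by rewrite rnorm_l2 sum_sqnorm_le. Qed.

Lemma half_pow_cauchy_cvg (a : nat -> R) :
  (forall p q, `|a p - a q| < 2 ^- p + 2 ^- q) -> cvgn a.
Proof.
move=> ac; apply/cauchy_cvgP/cauchy_exP => e e0.
have [p hp] : exists p : nat, 2 ^- p < e / 2 by apply: exists_half_pow; rewrite divr_gt0.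
exists (a p); exists p => // q /= pq; rewrite -ball_normE /=.
apply: lt_trans (ac p q) _; have : 2 ^- q <= 2 ^- p :> R.
  by rewrite lef_pV2 ?posrE ?exprn_gt0 // ler_weXn2l // ler1n.
lra.
Qed.

Fact l2_complete (F : set_system l2) : ProperFilter F -> cauchy F -> cvg F.
Proof.
apply: seq_complete => u uc.
have sq p q n : \sum_(0 <= k < n) sqnorm (val (u p) k - val (u q) k) <=
    (2 ^- p + 2 ^- q) ^+ 2.
  apply: le_trans (sum_sqnorm_rnorm (u p - u q) n) _.
  by rewrite ler_pXn2r ?nnegrE ?rnorm_ge0 ?addr_ge0 ?invr_ge0 ?exprn_ge0 // ltW.
have coord k p q : sqnorm (val (u p) k - val (u q) k) < (2 ^- p + 2 ^- q) ^+ 2.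
  apply: le_lt_trans (_ : rnorm (u p - u q) ^+ 2 < _).
    apply: le_trans (sum_sqnorm_rnorm (u p - u q) k.+1).
    by rewrite big_nat_recr //= lerDr sumr_ge0 // => j _; exact: sqnorm_ge0.
  by rewrite ltr_pXn2r ?nnegrE ?rnorm_ge0 ?addr_ge0 ?invr_ge0 ?exprn_ge0.
have h0 p q : 0 <= 2 ^- p + 2 ^- q :> R by rewrite addr_ge0 ?invr_ge0 ?exprn_ge0.
have cr k : cvgn (fun p => complex.Re (val (u p) k)).
  apply: half_pow_cauchy_cvg => p q; rewrite -(@ltr_pXn2r _ 2) ?nnegrE // real_normK ?num_real //.
  apply: le_lt_trans (coord k p q); case: (val (u p) k) (val (u q) k) => a b [c d].
  by rewrite /sqnorm /= lerDl sqr_ge0.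
have ci k : cvgn (fun p => complex.Im (val (u p) k)).
  apply: half_pow_cauchy_cvg => p q; rewrite -(@ltr_pXn2r _ 2) ?nnegrE // real_normK ?num_real //.
  apply: le_lt_trans (coord k p q); case: (val (u p) k) (val (u q) k) => a b [c d].
  by rewrite /sqnorm /= lerDr sqr_ge0.
pose f k : R[i] := limn (fun p => complex.Re (val (u p) k)) +i*
                   limn (fun p => complex.Im (val (u p) k)).
have fsq p n : \sum_(0 <= k < n) sqnorm (val (u p) k - f k) <= (2 * 2 ^- p) ^+ 2.
  have cv : (fun q => \sum_(0 <= k < n) sqnorm (val (u p) k - val (u q) k)) @ \oo -->
      \sum_(0 <= k < n) sqnorm (val (u p) k - f k).
    apply: cvg_big => [|k _]; first exact: add_continuous.
    rewrite /sqnorm /f; case: (val (u p) k) => a b /=.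
    have -> : (fun q => complex.Re (a +i* b - val (u q) k) ^+ 2 +
        complex.Im (a +i* b - val (u q) k) ^+ 2) =
      (fun q => (a - complex.Re (val (u q) k)) * (a - complex.Re (val (u q) k)) +
        (b - complex.Im (val (u q) k)) * (b - complex.Im (val (u q) k))).
      by apply/funext => q; case: (val (u q) k) => c d; rewrite /= !expr2.
    rewrite !expr2.
    by apply: cvgD; apply: cvgM; apply: cvgB => //; exact: cvg_cst.
  rewrite -(cvg_lim (@Rhausdorff R) cv); apply: limr_le; first exact: cvgP cv.
  exists p => // q /= pq; apply: le_trans (sq p q n) _.
  rewrite ler_pXn2r ?nnegrE ?mulr_ge0 ?invr_ge0 ?exprn_ge0 //.
  have : 2 ^- q <= 2 ^- p :> R by rewrite lef_pV2 ?posrE ?exprn_gt0 // ler_weXn2l // ler1n.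
  lra.
have fl2 : f \in @l2_pred R P.
  apply/l2_predP; split=> [|m Pm].
    have -> : f = (-1) *: (fun k => val (u 0) k - f k) + val (u 0).
      by apply/funext => k; rewrite !fctE scaleN1r opprB subrK.
    by apply: sqsummable_lin (l2_sq _); exists ((2 * 2 ^- 0) ^+ 2); exact: fsq.
  have z p : val (u p) m = 0 by rewrite l2_supp.
  by rewrite /f; under eq_fun do rewrite z; under [X in _ +i* limn X]eq_fun do rewrite z;
    rewrite !lim_cst.
exists (Sub f fl2) => p; apply: rnorm_l2_le => [|n].
  by rewrite mulr_ge0 // invr_ge0 exprn_ge0.
exact: fsq.
Qed.

HB.instance Definition _ := Uniform_isComplete.Build l2 l2_complete.

(** Finitely supported sequences are dense, with a cutoff that only depends on the
    vector to be approximated. *)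
Lemma l2_tail x e : 0 < e -> exists n, forall y,
  (forall k, (n <= k)%N -> val y k = 0) ->
  \sum_(0 <= k < n) sqnorm (val x k - val y k) <= e ^+ 2 ->
  rnorm (x - y) <= 2 * e.
Proof.
move=> e0; have [hr _] := sum_to_l2inner x x.
have e2 : 0 < e ^+ 2 by rewrite exprn_gt0.
move/cvgrPdist_lt: hr => /(_ _ e2)[n _ /(_ n (leqnn n))] /=.
rewrite ltr_norml => /andP[_ hn]; exists n => y y0 xy.
apply: rnorm_l2_le => [|m]; first by rewrite mulr_ge0 // ltW.
have Sx j : series (fun k => complex.Re (val x k * conjc (val x k))) j =
    \sum_(0 <= k < j) sqnorm (val x k) by apply: eq_bigr => k _; rewrite sqnormE.
rewrite Sx in hn.
have mono : \sum_(0 <= k < m) sqnorm (val (x - y) k) <=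
            \sum_(0 <= k < n + m) sqnorm (val (x - y) k).
  rewrite (@big_cat_nat _ _ _ m _ (n + m)) ?leq_addl //= lerDl sumr_ge0 // => j _.
  exact: sqnorm_ge0.
apply: le_trans mono _.
rewrite (@big_cat_nat _ _ _ n) ?leq_addr //=.
have -> : \sum_(n <= k < n + m) sqnorm (val (x - y) k) = \sum_(n <= k < n + m) sqnorm (val x k).
  by apply: eq_big_nat => k /andP[nk _]; rewrite /= !fctE y0 // subr0.
have := sum_sqnorm_le x (n + m); rewrite (@big_cat_nat _ _ _ n) ?leq_addr //= => hx.
have {}xy : \sum_(0 <= k < n) sqnorm (val (x - y) k) <= e ^+ 2 by exact: xy.
rewrite exprMn; lra.
Qed.

Let trunc (f : nat -> R[i]) (n : nat) : nat -> R[i] :=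
  fun k => if P k && (k < n)%N then f k else 0.

Fact trunc_l2 f n : trunc f n \in @l2_pred R P.
Proof.
apply/l2_predP; split=> [|m Pm]; last by rewrite /trunc (negPf Pm).
exists (\sum_(0 <= k < n) sqnorm (trunc f n k)) => m.
have mono : series (fun k => sqnorm (trunc f n k)) m <=
            \sum_(0 <= k < n + m) sqnorm (trunc f n k).
  rewrite /series /= (@big_cat_nat _ _ _ m _ (n + m)) ?leq_addl //= lerDl sumr_ge0 // => j _.
  exact: sqnorm_ge0.
apply: le_trans mono _; rewrite (@big_cat_nat _ _ _ n) ?leq_addr //= gerDl.
rewrite big_nat big1 // => k /andP[nk _].
by rewrite /trunc ltnNge nk andbF /sqnorm /= expr0n addr0.
Qed.

Definition l2trunc f n : l2 := Sub (trunc f n) (trunc_l2 f n).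

Lemma l2truncE f n k : val (l2trunc f n) k = if P k && (k < n)%N then f k else 0.
Proof. by []. Qed.

Fact l2_separable : exists2 D : set l2, countable D & dense D.
Proof.
pose g (s : seq (rat * rat)) : l2 :=
  l2trunc (fun k => let z := nth (0, 0) s k in ratr z.1 +i* ratr z.2) (size s).
exists (range g); first exact: card_le_trans (card_image_le _ _) (countableP _).
move=> O [x Ox] Oopen; have /nbhs_ballP[e /= e0 xO] : nbhs x O by exact: open_nbhs_nbhs.
pose r := complex.Re e / 4; have r0 : 0 < r by rewrite divr_gt0 // -ltcR RRe_real // gtr0_real.
have [n hn] := l2_tail x r0.
pose d := r ^+ 2 / n.+1%:R; have d0 : 0 < d by rewrite divr_gt0 ?exprn_gt0.
pose c := Num.min 1 (d / 2); have c0 : 0 < c by rewrite lt_min ltr01 divr_gt0.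
have rat_approx (t : R) : exists q : rat, (t - ratr q) ^+ 2 <= c.
  have tc : t < t + c by rewrite ltrDl.
  have [q] := rat_in_itvoo tc; rewrite in_itv /= => /andP[h1 h2]; exists q.
  rewrite -sqrrN opprB; apply: (@le_trans _ _ (ratr q - t)).
    rewrite expr2 ger_pMr ?subr_gt0 // lerBlDl (le_trans (ltW h2)) // lerD2l.
    by rewrite ge_min lexx.
  by rewrite lerBlDl ltW.
pose q t := projT1 (cid (rat_approx t)).
have qP t : (t - ratr (q t)) ^+ 2 <= c by rewrite /q; case: cid.
pose s := [seq (q (complex.Re (val x k)), q (complex.Im (val x k))) | k <- iota 0 n].
have ss : size s = n by rewrite size_map size_iota.
exists (g s); split; last by exists s.
apply: xO; rewrite ball_rnormE //.
apply: (@le_lt_trans _ _ (2 * r)); last by rewrite /r; move: r0; rewrite /r; lra.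
apply: hn => [k nk|]; first by rewrite l2truncE ss ltnNge nk andbF.
apply: (@le_trans _ _ (\sum_(0 <= k < n) d)); last first.
  rewrite sumr_const_nat subn0 -mulr_natr /d mulrAC ler_pdivrMr ?ltr0n //.
  by rewrite ler_wpM2l ?ler_nat ?sqr_ge0.
rewrite big_nat [leRHS]big_nat; apply: ler_sum => k /andP[_ kn].
rewrite l2truncE ss kn andbT; case: ifPn => [_|Pk]; last first.
  by rewrite l2_supp // subr0 /sqnorm /= expr0n addr0 ltW.
rewrite (nth_map 0%N) ?size_iota // nth_iota //= add0n.
have := qP (complex.Re (val x k)); have := qP (complex.Im (val x k)).
rewrite /=; case: (sval x k) => a b; rewrite /sqnorm /=.
have : c <= d / 2 by rewrite ge_min lexx orbT.
lra.
Qed.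

Definition l2_hilbert : hilbert R := Hilbert (@l2_normE R P) l2_separable.

End L2Hilbert.

(** * Closed spans in a Hilbert space *)

Section HilbertBasics.
Variables (R : realType) (H : hilbert R).
Implicit Types x y z : H.
Local Notation inner := (@inner R H).
Local Notation normc := Normc.normc.

Lemma innerDl x y z : inner (x + y) z = inner x z + inner y z.
Proof. exact: linearDl. Qed.
Lemma innerDr x y z : inner z (x + y) = inner z x + inner z y.
Proof. exact: linearDr. Qed.
Lemma innerBl x y z : inner (x - y) z = inner x z - inner y z.
Proof. exact: linearBl. Qed.
Lemma innerBr x y z : inner z (x - y) = inner z x - inner z y.
Proof. exact: linearBr. Qed.
Lemma innerZl a x z : inner (a *: x) z = a * inner x z.
Proof. exact: linearZl_LR. Qed.
Lemma innerZr a x z : inner z (a *: x) = conjc a * inner z x.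
Proof. exact: linearZr_LR. Qed.
Lemma inner0l z : inner 0 z = 0.
Proof. exact: linear0l. Qed.
Lemma inner_suml I (s : seq I) (P : pred I) (F : I -> H) z :
  inner (\sum_(i <- s | P i) F i) z = \sum_(i <- s | P i) inner (F i) z.
Proof. exact: linear_sumlz. Qed.
Lemma inner_sumr I (s : seq I) (P : pred I) (F : I -> H) z :
  inner z (\sum_(i <- s | P i) F i) = \sum_(i <- s | P i) inner z (F i).
Proof. exact: linear_sumr. Qed.
Lemma inner_conj x y : inner x y = conjc (inner y x).
Proof. by rewrite (@hermitian_subproof _ _ false _ inner) expr0 mul1r. Qed.

Lemma rnorm_sqr x : (rnorm x ^+ 2)%:C = inner x x.
Proof. by rewrite rmorphXn /= -rnormE hilbert_normE. Qed.

Lemma Re_inner_sqr x : complex.Re (inner x x) = rnorm x ^+ 2.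
Proof. by rewrite -rnorm_sqr. Qed.

Lemma normc_normE (a : R[i]) : `|a| = (normc a)%:C.
Proof. by case: a. Qed.

Lemma normc_ge0 (a : R[i]) : 0 <= normc a.
Proof. by rewrite -ler0c -normc_normE. Qed.

Lemma inner_le x y : normc (inner x y) <= rnorm x * rnorm y.
Proof.
rewrite -(@ler_pXn2r _ 2) ?nnegrE ?normc_ge0 ?mulr_ge0 ?rnorm_ge0 //.
rewrite -lecR rmorphXn /= -normc_normE exprMn rmorphM /= !rnorm_sqr.
exact: (@dot_CauchySchwarz R[i] H inner).
Qed.

Lemma normc_eq0 (a : R[i]) : (normc a == 0) = (a == 0).
Proof. by apply/eqP/eqP => [/Normc.eq0_normc//|->]; rewrite Normc.normc0. Qed.

Lemma inner_approx x y x' y' e : 0 < e -> e <= 1 ->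
  rnorm (x - x') < e -> rnorm (y - y') < e ->
  normc (inner x y - inner x' y') <= e * (rnorm x + rnorm y + 1).
Proof.
move=> e0 e1 xx yy.
have -> : inner x y - inner x' y' = inner (x - x') y + inner x' (y - y').
  by rewrite innerBl innerBr addrA subrK.
apply: le_trans (le_normcD _ _) _.
have h1 := inner_le (x - x') y; have h2 := inner_le x' (y - y').
have h3 : rnorm x' <= rnorm x + e.
  by have := rnorm_distD x x' 0; rewrite !subr0 (rnormB x') => h; lra.
have := rnorm_ge0 x; have := rnorm_ge0 y; have := rnorm_ge0 x'.
have := rnorm_ge0 (x - x'); have := rnorm_ge0 (y - y').
by move: (rnorm x) (rnorm y) (rnorm x') (rnorm (x - x')) (rnorm (y - y')) h1 h2 h3 xx yy
  => a b c d f; nra.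
Qed.

Lemma eps_eq0 (c : R) (M : R) : 0 <= c ->
  (forall e, 0 < e -> e <= 1 -> c <= e * M) -> c = 0.
Proof.
move=> c0 cM; apply/eqP; rewrite eq_le c0 andbT leNgt; apply/negP => cp.
have M0 : 0 < M by have := cM 1 ltr01 (lexx _); rewrite mul1r => /(lt_le_trans cp).
pose e := Num.min 1 (c / (2 * M)).
have e0 : 0 < e by rewrite lt_min ltr01 divr_gt0 ?mulr_gt0.
have := cM e e0; rewrite ge_min lexx => /(_ isT).
have : e <= c / (2 * M) by rewrite ge_min lexx orbT.
rewrite ler_pdivlMr ?mulr_gt0 //; nra.
Qed.

(** Rather than sets, closed spans are described by approximations by finite
    linear combinations of a family. *)
Definition lincomb (I : Type) (F : I -> H) (s : seq (R[i] * I)) : H :=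
  \sum_(p <- s) p.1 *: F p.2.

Definition cspan (I : Type) (F : I -> H) x : Prop :=
  forall e, 0 < e -> exists s, rnorm (x - lincomb F s) < e.

Lemma lincomb_lin I (F : I -> H) a s t :
  lincomb F ([seq (a * p.1, p.2) | p <- s] ++ t) = a *: lincomb F s + lincomb F t.
Proof.
rewrite /lincomb big_cat big_map /= scaler_sumr; congr (_ + _).
by apply: eq_bigr => p _; rewrite scalerA.
Qed.

Lemma cspan_base I (F : I -> H) i : cspan F (F i).
Proof.
by move=> e e0; exists [:: (1, i)]; rewrite /lincomb big_seq1 scale1r subrr rnorm0.
Qed.

Lemma cspan_lin I (F : I -> H) a x y : cspan F x -> cspan F y -> cspan F (a *: x + y).
Proof.
move=> Fx Fy e e0; have e2 : 0 < e / 2 by rewrite divr_gt0.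
have a0 : 0 < normc a + 1 by rewrite ltr_wpDl ?normc_ge0.
have [s xs] := Fx (e / 2 / (normc a + 1)) (divr_gt0 e2 a0); have [t yt] := Fy _ e2.
exists ([seq (a * p.1, p.2) | p <- s] ++ t); rewrite lincomb_lin.
have -> : a *: x + y - (a *: lincomb F s + lincomb F t) =
   a *: (x - lincomb F s) + (y - lincomb F t) by rewrite scalerBr opprD addrACA.
apply: le_lt_trans (rnorm_triangle _ _) _; rewrite rnormZ.
move: xs; rewrite ltr_pdivlMr // => xs.
have := rnorm_ge0 (x - lincomb F s); move: xs yt.
by rewrite mulrDr mulr1 (mulrC (normc a)) => xs yt x0; lra.
Qed.

Lemma cspan0 I (F : I -> H) : cspan F 0.
Proof. by move=> e e0; exists [::]; rewrite /lincomb big_nil subrr rnorm0. Qed.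

Lemma cspanZ I (F : I -> H) a x : cspan F x -> cspan F (a *: x).
Proof. by move=> Fx; rewrite -[a *: x]addr0; apply: cspan_lin => //; exact: cspan0. Qed.

Lemma cspanD I (F : I -> H) x y : cspan F x -> cspan F y -> cspan F (x + y).
Proof. by move=> Fx Fy; rewrite -[x]scale1r; exact: cspan_lin. Qed.

Lemma cspanB I (F : I -> H) x y : cspan F x -> cspan F y -> cspan F (x - y).
Proof. by move=> Fx Fy; rewrite addrC -scaleN1r; exact: cspan_lin. Qed.

Lemma cspan_sum I J (F : I -> H) (s : seq J) (P : pred J) (f : J -> H) :
  (forall j, P j -> cspan F (f j)) -> cspan F (\sum_(j <- s | P j) f j).
Proof.
by move=> Ff; elim/big_rec: _ => [|j y Pj]; [exact: cspan0 | apply: cspanD; exact: Ff].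
Qed.

Lemma cspan_closed I (F : I -> H) x :
  (forall e, 0 < e -> exists2 y, cspan F y & rnorm (x - y) < e) -> cspan F x.
Proof.
move=> Fx e e0; have e2 : 0 < e / 2 by rewrite divr_gt0.
have [y Fy xy] := Fx _ e2; have [s ys] := Fy _ e2; exists s.
apply: le_lt_trans (rnorm_distD y _ _) _; lra.
Qed.

Lemma cspan_sub I J (F : I -> H) (F' : J -> H) x :
  (forall i, cspan F' (F i)) -> cspan F x -> cspan F' x.
Proof.
move=> FF' Fx; apply: cspan_closed => e /Fx[s xs]; exists (lincomb F s) => //.
by apply: cspan_sum => p _; exact: cspanZ.
Qed.

Lemma cspan_orthogonal I (F : I -> H) x w :
  cspan F x -> (forall i, inner w (F i) = 0) -> inner w x = 0.
Proof.
move=> Fx wF; apply/eqP; rewrite -normc_eq0; apply/eqP.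
apply: (@eps_eq0 _ (rnorm w)) => [|e e0 _]; first exact: normc_ge0.
have [s xs] := Fx e e0.
have -> : inner w x = inner w (x - lincomb F s).
  rewrite innerBr inner_sumr big1 ?subr0 // => p _.
  by rewrite innerZr wF mulr0.
apply: le_trans (inner_le _ _) _; rewrite mulrC ler_wpM2r ?rnorm_ge0 //.
exact: ltW.
Qed.

Lemma inner_eq0 x : inner x x = 0 -> x = 0.
Proof.
by move=> x0; apply/eqP; rewrite -rnorm_eq0 -sqrf_eq0 -Re_inner_sqr x0.
Qed.

End HilbertBasics.

(** * Representations defined on a total family *)

Section TotalFamily.
Variables (R : realType) (H : hilbert R) (G : groupType) (k : G -> H).
Local Notation inner := (@inner R H).
Hypothesis k_inv : forall h g g' : G,
  inner (k (h * g)%g) (k (h * g')%g) = inner (k g) (k g').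
Hypothesis k_total : forall x, cspan k x.
Implicit Types (x y : H) (g h : G).

Let k_sep x y : (forall g, inner x (k g) = inner y (k g)) -> x = y.
Proof.
move=> xy; apply/eqP; rewrite -subr_eq0; apply/eqP/inner_eq0.
apply: cspan_orthogonal (k_total _) _ => g.
by rewrite innerBl xy subrr.
Qed.

Let shift h g := k (h * g)%g.

Let inner_lincomb_shift h s t :
  inner (lincomb (shift h) s) (lincomb (shift h) t) = inner (lincomb k s) (lincomb k t).
Proof.
rewrite !inner_suml; apply: eq_bigr => p _; rewrite !inner_sumr; apply: eq_bigr => q _.
by rewrite !innerZl !innerZr k_inv.
Qed.

Let rnorm_lincomb_shift h s : rnorm (lincomb (shift h) s) = rnorm (lincomb k s).
Proof.
apply/eqP; rewrite -(@eqrXn2 _ 2) ?rnorm_ge0 // -!Re_inner_sqr.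
by rewrite inner_lincomb_shift.
Qed.

Let lincombB (F : G -> H) s t :
  lincomb F s - lincomb F t = lincomb F ([seq (-1 * p.1, p.2) | p <- t] ++ s).
Proof. by rewrite lincomb_lin scaleN1r addrC. Qed.

(** [y] is the image of [x] under the translation by [h]: both are limits of the
    same linear combinations, before and after translation. *)
Let image h x y := forall e, 0 < e -> exists s,
  rnorm (x - lincomb k s) < e /\ rnorm (y - lincomb (shift h) s) < e.

Let image_exists h x : exists y, image h x y.
Proof.
have h2 p : 0 < 2 ^- p :> R by rewrite invr_gt0 exprn_gt0.
pose s p := projT1 (cid (k_total x (h2 p))).
have xs p : rnorm (x - lincomb k (s p)) < 2 ^- p by rewrite /s; case: cid.
pose u p := lincomb (shift h) (s p).
have uc p q : rnorm (u p - u q) < 2 ^- p + 2 ^- q.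
  rewrite /u lincombB rnorm_lincomb_shift -lincombB.
  by apply: le_lt_trans (rnorm_distD x _ _) _; rewrite ltrD // rnormB.
have cu : cvg (u @ \oo).
  apply/cauchy_cvgP/cauchy_exP => e e0.
  have [p hp] : exists p : nat, 2 ^- p < complex.Re e / 2.
    by apply: exists_half_pow; rewrite divr_gt0 // -ltcR RRe_real // gtr0_real.
  exists (u p); exists p => // q /= pq; rewrite ball_rnormE //.
  apply: lt_trans (uc p q) _; have : 2 ^- q <= 2 ^- p :> R.
    by rewrite lef_pV2 ?posrE ?exprn_gt0 // ler_weXn2l // ler1n.
  lra.
exists (lim (u @ \oo)) => e e0.
have e0C : 0 < e%:C :> R[i] by rewrite ltcR.
move/cvg_ballP: cu => /(_ _ e0C)[p _ hp]; have [q hq] := exists_half_pow e0.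
exists (s (maxn p q)); split.
  apply: lt_trans (xs _) _; apply: le_lt_trans hq.
  by rewrite lef_pV2 ?posrE ?exprn_gt0 // ler_weXn2l ?ler1n // leq_maxr.
by have := hp (maxn p q) (leq_maxl _ _); rewrite /= ball_rnormE.
Qed.

Let image_inner h x y x' y' : image h x y -> image h x' y' -> inner y y' = inner x x'.
Proof.
move=> xy xy'; apply/eqP; rewrite -subr_eq0 -normc_eq0; apply/eqP.
apply: (@eps_eq0 _ _ (rnorm y + rnorm y' + 1 + (rnorm x + rnorm x' + 1))).
  exact: normc_ge0.
move=> e e0 e1; have [s [xs ys]] := xy e e0; have [t [xt yt]] := xy' e e0.
have -> : inner y y' - inner x x' =
  (inner y y' - inner (lincomb (shift h) s) (lincomb (shift h) t)) -
  (inner x x' - inner (lincomb k s) (lincomb k t)).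
  by rewrite inner_lincomb_shift opprB addrA subrK.
apply: le_trans (le_normcD _ _) _; rewrite normcN mulrDr lerD //; exact: inner_approx.
Qed.

Let image_base h g : image h (k g) (k (h * g)%g).
Proof.
by move=> e e0; exists [:: (1, g)]; rewrite /lincomb !big_seq1 !scale1r !subrr !rnorm0.
Qed.

Let translate h x : H := projT1 (cid (image_exists h x)).

Let translateP h x : image h x (translate h x).
Proof. by rewrite /translate; case: cid. Qed.

Let translate_inner h x y : inner (translate h x) (translate h y) = inner x y.
Proof. exact: image_inner (translateP h x) (translateP h y). Qed.

Let translateE h x g : inner (translate h x) (k g) = inner x (k (h^-1 * g)%g).
Proof.
by have := image_inner (translateP h x) (image_base h (h^-1 * g)%g); rewrite mulVKg.
Qed.

Let translate_linear h : linear (translate h).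
Proof.
move=> a x y; apply: k_sep => g.
by rewrite innerDl innerZl !translateE innerDl innerZl.
Qed.

HB.instance Definition _ h := GRing.isLinear.Build R[i] H H *:%R (translate h)
  (translate_linear h).

Let translateM g h x : translate (g * h)%g x = translate g (translate h x).
Proof. by apply: k_sep => l; rewrite !translateE invgM mulgA. Qed.

Let translate1 x : translate 1%g x = x.
Proof. by apply: k_sep => g; rewrite translateE invg1 mul1g. Qed.

(** Translations preserve the inner products of the total family, hence extend to
    isometries of the whole space; linearity and multiplicativity hold since vectors
    are determined by their inner products with the family. *)
Lemma total_family_rep :
  exists pi : unitary_rep G H, forall h g, pi h (k g) = k (h * g)%g.
Proof.
have U h : unitary (translate h : {linear H -> H}).
  split; last exact: translate_inner.
  by exists (translate h^-1%g) => x /=; rewrite -translateM ?mulVg ?mulgV translate1.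
exists (@UnitaryRep R G H (fun h => translate h : {linear H -> H}) U translateM) => h g.
apply: k_sep => l; rewrite /= translateE -(k_inv h) mulVKg.
by [].
Qed.

End TotalFamily.

(** * The cyclic representation of a positive definite function *)

Lemma countably_infinite_enum (T : Type) :
  countably_infinite [set: T] -> exists (e : nat -> T) (r : T -> nat), cancel e r /\ cancel r e.
Proof.
by move=> /card_set_bijP[r]; rewrite setTT_bijective => -[e rK eK]; exists e, r.
Qed.

Section CyclicRepresentation.
Variables (R : realType) (G : groupType) (phi : G -> R).
Variables (e : nat -> G) (r : G -> nat).
Hypotheses (eK : cancel e r) (rK : cancel r e).
Hypothesis phi_pd : pos_def (fun g h => phi (h^-1 * g)%g).

Let K i j := phi ((e j)^-1 * e i)%g.
Let K_pd : pos_def K := pos_def_comp e phi_pd.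

(** Pivots that vanish correspond to vectors depending on the previous ones. *)
Let P m := cholesky K m m != 0.
Local Notation H := (l2_hilbert R P).

Let coord (x : l2 R P) m : R[i] := val x m.

(** The rows of the Cholesky factor are vectors with Gram matrix [K]. *)
Let feature i : H := l2trunc P (fun m => (cholesky K m i)%:C) i.+1.

Let featureE i m : coord (feature i) m = (cholesky K m i)%:C.
Proof.
rewrite /coord l2truncE; case: (boolP (P m)) => Pm /=; last first.
  by rewrite cholesky_pivot0 //; apply/eqP; rewrite -[_ == _]negbK.
by case: ltnP => // im; rewrite cholesky_lt.
Qed.

Let l2inner_finite (x y : l2 R P) n : (forall m, (n <= m)%N -> coord x m = 0) ->
  l2inner x y = \sum_(0 <= m < n) coord x m * conjc (coord y m).
Proof.
move=> x0; apply: (sum_to_unique (sum_to_l2inner x y)).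
have E (f : R[i] -> R) : f 0 = 0 -> {morph f : a b / a + b} ->
    series (fun m => f (coord x m * conjc (coord y m))) @ \oo -->
    f (\sum_(0 <= m < n) coord x m * conjc (coord y m)).
  move=> f0 fD; apply: cvg_near_cst; exists n => // N /= nN.
  rewrite (big_morph f fD f0) /series /= (@big_cat_nat _ _ _ n) //= [X in _ + X]big_nat.
  by rewrite [X in _ + X]big1 ?addr0 // => m /andP[nm _]; rewrite x0 // mul0r.
by split; apply: E => // -[a b] [c d].
Qed.

Let feature_inner i j : inner H (feature i) (feature j) = (K i j)%:C.
Proof.
have -> : inner H (feature i) (feature j) = l2inner (feature i : l2 R P) (feature j) by [].
rewrite (@l2inner_finite _ _ i.+1) => [|m im]; last by rewrite featureE cholesky_lt.
rewrite (choleskyE K_pd j (ltnSn i)) big_mkord rmorph_sum /=; apply: eq_bigr => m _.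
by rewrite !featureE conjc_real -rmorphM.
Qed.

Let basis m : H := l2trunc P (fun k => (k == m)%:R) m.+1.

Let basisE m k : coord (basis m) k = if P k && (k == m) then 1 else 0.
Proof.
rewrite /coord l2truncE ltnS; have [->|km] := eqVneq k m; first by rewrite leqnn.
by rewrite andbF; case: ifP.
Qed.

Let coord_comb (s : seq nat) (c : nat -> R[i]) k : uniq s ->
  coord (\sum_(j <- s) c j *: basis j) k = if P k && (k \in s) then c k else 0.
Proof.
move=> us; have cD : {morph coord^~ k : x y / x + y} by [].
rewrite (big_morph (coord^~ k) cD (erefl : coord 0 k = 0)).
have E j : coord (c j *: basis j) k = if P k && (k == j) then c j else 0.
  by have -> : coord (c j *: basis j) k = c j * coord (basis j) k by [];
    rewrite basisE; case: ifP; rewrite ?mulr1 ?mulr0.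
under eq_bigr do rewrite E.
case: (boolP (P k)) => Pk /=; last by rewrite big1.
case: ifPn => ks; last first.
  by rewrite big1_seq // => j /andP[_ js]; case: eqP ks => // ->; rewrite js.
rewrite (bigD1_seq k) //= eqxx big1 ?addr0 // => j /negPf jk.
by rewrite eq_sym jk.
Qed.

(** The Cholesky factor is triangular, so that the canonical basis is obtained from the
    rows by induction, dividing by the pivots that do not vanish. *)
Let basis_span m : cspan feature (basis m).
Proof.
elim/ltn_ind: m => m IH; have [Pm|Pm] := boolP (P m); last first.
  suff -> : basis m = 0 by exact: cspan0.
  apply: val_inj; apply/funext => k; rewrite -[LHS]/(coord _ k) basisE.
  by case: eqP => [->|]; rewrite ?andbF // (negPf Pm).
have -> : basis m = (cholesky K m m)^-1%:C *:
    (feature m - \sum_(j <- iota 0 m) (cholesky K j m)%:C *: basis j).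
  apply: val_inj; apply/funext => k; rewrite -[LHS]/(coord _ k) -[RHS]/(coord _ k).
  set c := _^-1%:C; set w := \sum_(j <- _) _.
  have -> : coord (c *: (feature m - w)) k = c * (coord (feature m) k - coord w k) by [].
  rewrite coord_comb ?iota_uniq // basisE featureE mem_iota add0n leq0n /=.
  have [Pk|Pk] /= := boolP (P k); last first.
    by rewrite cholesky_pivot0 ?subr0 ?mulr0 //; apply/eqP; rewrite -[_ == _]negbK.
  case: ltngtP => km; first by rewrite subrr mulr0.
    by rewrite cholesky_lt // subrr mulr0.
  by rewrite km subr0 /c -rmorphM /= mulVf.
apply: cspanZ; apply: cspanB; first exact: cspan_base.
by rewrite big_seq; apply: cspan_sum => j; rewrite mem_iota add0n => /andP[_ jm];
  apply: cspanZ; exact: IH.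
Qed.

Let feature_total x : cspan feature x.
Proof.
apply: cspan_closed => d d0; have d4 : 0 < d / 4 by rewrite divr_gt0.
have [n hn] := l2_tail (x : l2 R P) d4.
exists (\sum_(m <- iota 0 n) coord x m *: basis m).
  by apply: cspan_sum => m _; apply: cspanZ; exact: basis_span.
apply: le_lt_trans (hn _ _ _) _ => [k nk||]; last by lra.
  by rewrite -[LHS]/(coord _ k) coord_comb ?iota_uniq // mem_iota add0n ltnNge nk andbF.
rewrite big_nat big1 ?sqr_ge0 // => k /andP[_ kn].
rewrite -[X in sqnorm (_ - X)]/(coord _ k) coord_comb ?iota_uniq // mem_iota add0n kn /=.
rewrite andbT; case: ifPn => Pk; last rewrite (l2_supp x Pk);
  by rewrite subrr /sqnorm /= expr0n addr0.
Qed.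

(** The Gelfand-Naimark-Segal construction. *)
Lemma cyclic_representation : exists (H : hilbert R) (pi : unitary_rep G H) (v : H),
  (forall x, cspan (fun g => pi g v) x) /\
  forall g h, inner H (pi g v) (pi h v) = (phi (h^-1 * g)%g)%:C.
Proof.
pose k g := feature (r g).
have kE g h : inner H (k g) (k h) = (phi (h^-1 * g)%g)%:C.
  by rewrite feature_inner /K !rK.
have [||pi piE] := @total_family_rep R H G k.
- by move=> h g g'; rewrite !kE invgM -mulgA mulKg.
- by move=> x; apply: cspan_sub (feature_total x) => i; rewrite -(eK i); exact: cspan_base.
exists H, pi, (k 1%g); split => [x|g h]; last by rewrite !piE !mulg1 kE.
apply: cspan_sub (feature_total x) => i; rewrite -(eK i) -/(k _) -[e i]mulg1 -piE.
exact: (cspan_base (fun g => pi g (k 1%g))).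
Qed.

End CyclicRepresentation.

(** * Almost invariant vectors *)

Section UnitaryBasics.
Variables (R : realType) (G : groupType) (H : hilbert R) (pi : unitary_rep G H).
Implicit Types (x y : H) (g h : G).
Local Notation inner := (@inner R H).

Lemma urep_inner g x y : inner (pi g x) (pi g y) = inner x y.
Proof. by have [_] := urep_unitary pi g; apply. Qed.

Lemma urep1 x : pi 1%g x = x.
Proof.
have [[k kK Kk] _] := urep_unitary pi 1%g.
by apply: (can_inj kK); rewrite -urepM mul1g.
Qed.

Lemma rnorm_urep g x : rnorm (pi g x) = rnorm x.
Proof.
by apply/eqP; rewrite -(@eqrXn2 _ 2) ?rnorm_ge0 // -!Re_inner_sqr urep_inner.
Qed.

Lemma parallelogram x y :
  rnorm (x - y) ^+ 2 + rnorm (x + y) ^+ 2 = 2 * rnorm x ^+ 2 + 2 * rnorm y ^+ 2.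
Proof.
rewrite -!Re_inner_sqr !(innerBl, innerBr, innerDl, innerDr).
move: (inner x x) (inner x y) (inner y x) (inner y y) => [a ?] [b ?] [c ?] [d ?] /=; ring.
Qed.

Definition orbit_sum (Q : seq G) x : H := \sum_(g <- Q) pi g x.

Lemma orbit_sum_sum I (s : seq I) (F : I -> H) Q :
  orbit_sum Q (\sum_(i <- s) F i) = \sum_(i <- s) orbit_sum Q (F i).
Proof.
by rewrite /orbit_sum exchange_big; apply: eq_bigr => g _; rewrite linear_sum.
Qed.

Lemma iter_orbit_sum_sum I (s : seq I) (F : I -> H) Q n :
  iter n (orbit_sum Q) (\sum_(i <- s) F i) = \sum_(i <- s) iter n (orbit_sum Q) (F i).
Proof. by elim: n => //= n ->; exact: orbit_sum_sum. Qed.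

(** Uniform convexity: if the average of finitely many unit vectors has norm close to
    1, any two of them are close to each other, by the parallelogram law. *)
Lemma orbit_sum_almost_invariant Q x d g : rnorm x = 1 -> 0 <= d ->
  d * (size Q).+1%:R <= 2 ->
  (1 - d) * (size Q).+1%:R <= rnorm (orbit_sum (1%g :: Q) x) -> g \in Q ->
  rnorm (pi g x - x) ^+ 2 <= 4 * (d * (size Q).+1%:R).
Proof.
move=> x1 d0 dN hQ gQ; have sz : (size Q).+1 = (size (rem g Q)).+2.
  by rewrite size_rem //; case: (Q) gQ.
have hsum (s : seq G) : rnorm (\sum_(h <- s) pi h x) <= (size s)%:R.
  elim: s => [|h s IH]; first by rewrite big_nil rnorm0.
  rewrite big_cons; apply: le_trans (rnorm_triangle _ _) _.
  by rewrite rnorm_urep x1 /= -natr1 addrC lerD2r.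
move: hQ; rewrite /orbit_sum big_cons (big_rem g) //= urep1 addrA (addrC x) => hQ.
have := le_trans hQ (rnorm_triangle _ _); have := hsum (rem g Q).
have := parallelogram (pi g x) x; rewrite rnorm_urep x1 => hp.
move: dN; rewrite sz -!natr1 => dN h1 h2.
have h3 : 2 - d * ((size (rem g Q))%:R + 1 + 1) <= rnorm (pi g x + x) by lra.
move: hp h3 dN; have := rnorm_ge0 (pi g x + x); have := rnorm_ge0 (pi g x - x).
move: (rnorm (pi g x + x)) (rnorm (pi g x - x)) => A B A0 B0 hp h3 dN.
have : 0 <= d * ((size (rem g Q))%:R + 1 + 1) by rewrite mulr_ge0 ?addr_ge0.
move: (d * _) h3 dN => t; nra.
Qed.

End UnitaryBasics.

(** Exponentials beat polynomials. *)
Lemma expr_quadratic_unbounded (R : realType) (t A B K : R) : 0 < t -> 0 <= A -> 0 <= B ->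
  0 <= K -> exists n : nat, (A + B * n%:R) ^+ 2 * K < (1 + t) ^+ n.
Proof.
move=> t0 A0 B0 K0; pose c := (A + 4 * B) ^+ 2 * K / t ^+ 4.
have c0 : 0 <= c.
  by apply: divr_ge0; [exact: mulr_ge0 (sqr_ge0 _) K0 | exact: exprn_ge0 (ltW t0)].
pose m := (Num.trunc c).+1; have cm : c < m%:R by exact: truncnS_gt.
have m1 : 1 <= m%:R :> R by rewrite ler1n.
have bern j : 1 + j%:R * t <= (1 + t) ^+ j.
  elim: j => [|j IH]; first by rewrite mul0r addr0.
  rewrite exprS -natr1; have : 0 <= j%:R * t by exact: mulr_ge0 (ler0n _ _) (ltW t0).
  move=> jt; have t1 : 0 <= 1 + t by rewrite addr_ge0 // ltW.
  apply: le_trans (ler_wpM2l t1 IH); have := mulr_ge0 jt (ltW t0); lra.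
exists (m * 4)%N; rewrite exprM.
have h1 : m%:R * t <= (1 + t) ^+ m by apply: le_trans (bern m); rewrite lerDr.
have mt0 : 0 <= m%:R * t by rewrite mulr_ge0 // ltW.
apply: lt_le_trans (_ : (m%:R * t) ^+ 4 <= _); last first.
  by rewrite lerXn2r ?nnegrE // (le_trans mt0).
rewrite exprMn natrM.
have h2 : (A + B * (m%:R * 4)) ^+ 2 <= m%:R ^+ 2 * (A + 4 * B) ^+ 2.
  have mA : A <= m%:R * A by rewrite ler_peMl.
  have mB : 0 <= m%:R * B by rewrite mulr_ge0.
  have mAB : A + B * (m%:R * 4) <= m%:R * (A + 4 * B) by lra.
  have p0 : 0 <= A + B * (m%:R * 4) by lra.
  by rewrite -exprMn ler_pXn2r // nnegrE // (le_trans p0).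
apply: le_lt_trans (ler_wpM2r K0 h2) _.
have t4 : 0 < t ^+ 4 by rewrite exprn_gt0.
have -> : m%:R ^+ 2 * (A + 4 * B) ^+ 2 * K = m%:R ^+ 2 * c * t ^+ 4.
  by rewrite /c; field; rewrite gt_eqF.
rewrite ltr_pM2r //; have -> : m%:R ^+ 4 = m%:R ^+ 2 * m%:R ^+ 2 :> R by rewrite -exprD.
rewrite ltr_pM2l ?exprn_gt0 ?(lt_le_trans ltr01) //.
by apply: lt_le_trans cm _; rewrite expr2 ler_peMl.
Qed.

Section AlmostInvariant.
Variables (R : realType) (G : groupType) (H : hilbert R) (pi : unitary_rep G H).
Variables (v : H) (phi : G -> R) (l : G -> R).
Local Notation inner := (@inner R H).
Hypothesis phiE : forall g h, inner (pi g v) (pi h v) = (phi (h^-1 * g)%g)%:C.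
Hypothesis l_ge0 : forall g, 0 <= l g.
Hypothesis lM : forall g h, l (g * h)%g <= l g + l h.
Hypothesis phi_ge : forall g, (1 + l g) ^- 2 <= phi g.

(** The coefficient is the sum of [phi] over all words [q_1 * ... * q_n * h] with letters
    in [Q], which have length at most [c + n * M]. *)
Let coef_ge Q M n h c : (forall g, g \in Q -> l g <= M) -> 0 <= M -> l h <= c ->
  (size Q)%:R ^+ n / (1 + c + n%:R * M) ^+ 2 <=
  complex.Re (inner (iter n (orbit_sum pi Q) (pi h v)) v).
Proof.
move=> QM M0; elim: n h c => [|n IH] h c lc.
  have := phiE h 1%g; rewrite urep1 invg1 mul1g /= => ->.
  rewrite expr0 mul0r addr0 mul1r /=; apply: le_trans (phi_ge h).
  have l0 : 0 < 1 + l h by rewrite ltr_wpDr.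
  rewrite lef_pV2 ?posrE ?exprn_gt0 //; last by apply: lt_le_trans l0 _; rewrite lerD2l.
  by rewrite lerXn2r ?nnegrE ?lerD2l // ltW // (lt_le_trans l0) // lerD2l.
rewrite iterSr [orbit_sum pi Q _]/orbit_sum iter_orbit_sum_sum inner_suml raddf_sum /=.
have c0 : 0 <= c := le_trans (l_ge0 h) lc.
apply: (@le_trans _ _ (\sum_(g <- Q)
    (size Q)%:R ^+ n / (1 + (M + c) + n%:R * M) ^+ 2)); last first.
  rewrite big_seq [leRHS]big_seq; apply: ler_sum => g gQ; rewrite -urepM; apply: IH.
  by apply: le_trans (lM g h) _; rewrite lerD // QM.
rewrite big_const_seq count_predT iter_addr_0 -[leRHS]mulr_natl exprS -mulrA.
have -> : 1 + (M + c) + n%:R * M = 1 + c + n.+1%:R * M by rewrite -natr1; ring.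
by [].
Qed.

(** If no iterate [u n] were almost maximizing, the norms of the [u n] would be at most
    [((1 - d) * N) ^+ n * rnorm v], and this contradicts the polynomial lower bound for
    [<u n, v> / N ^+ n]. *)
Lemma almost_invariant_vector (Q : seq G) e : 0 < e ->
  exists2 x, rnorm x = 1 & forall g, g \in Q -> rnorm (pi g x - x) <= e.
Proof.
move=> e0; pose Q1 := 1%g :: Q; pose N : R := (size Q1)%:R.
have N0 : 0 < N by rewrite ltr0n.
pose d := Num.min (1 / 2) (Num.min (2 / N) (e ^+ 2 / (4 * N))).
have d0 : 0 < d by rewrite !lt_min !divr_gt0 ?mulr_gt0 ?exprn_gt0.
have d1 : d <= 1 / 2 by rewrite ge_min lexx.
have dN : d * N <= 2 by rewrite -ler_pdivlMr // !ge_min lexx orbT.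
have dNe : 4 * (d * N) <= e ^+ 2.
  by rewrite mulrCA -ler_pdivlMr ?mulr_gt0 // !ge_min lexx !orbT.
pose M := \sum_(g <- Q1) l g.
have M0 : 0 <= M by rewrite sumr_ge0.
have QM g : g \in Q1 -> l g <= M.
  by move=> gQ; rewrite /M (big_rem _ gQ) /= lerDl sumr_ge0.
pose u n := iter n (orbit_sum pi Q1) v.
have uge n : N ^+ n / (1 + l 1%g + n%:R * M) ^+ 2 <= rnorm (u n) * rnorm v.
  have := coef_ge n QM M0 (lexx (l 1%g)); rewrite urep1 -/(u n) => h.
  apply: le_trans h _; apply: le_trans (inner_le _ _).
  by apply: le_trans (ler_norm _) _; rewrite -lecR -normc_normE normc_ge_Re.
have a0 n : 0 < 1 + l 1%g + n%:R * M.
  by rewrite ltr_wpDr ?mulr_ge0 // ltr_wpDr.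
have u0 n : 0 < rnorm (u n).
  have : 0 < rnorm (u n) * rnorm v.
    by apply: lt_le_trans (uge n); rewrite divr_gt0 ?exprn_gt0.
  by have := rnorm_ge0 (u n); have := rnorm_ge0 v;
    rewrite le_eqVlt => /orP[/eqP <-|v0]; rewrite ?mulr0 ?ltxx // pmulr_lgt0.
have [n hn] : exists n, (1 - d) * N * rnorm (u n) <= rnorm (u n.+1).
  apply/not_existsP => hn; have {}hn n : rnorm (u n.+1) <= (1 - d) * N * rnorm (u n).
    by rewrite leNgt; apply/negP => /ltW; exact: hn.
  have un n : rnorm (u n) <= ((1 - d) * N) ^+ n * rnorm v.
    elim: n => [|n IH]; first by rewrite mul1r.
    have q0 : 0 <= (1 - d) * N by rewrite mulr_ge0 ?ltW // subr_gt0; lra.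
    by apply: le_trans (hn n) _; rewrite exprS -[leRHS]mulrA ler_wpM2l.
  have l1 : 0 <= 1 + l 1%g by rewrite addr_ge0.
  have [n] := expr_quadratic_unbounded d0 l1 M0 (sqr_ge0 (rnorm v)).
  apply/negP; rewrite -leNgt (mulrC M).
  have := le_trans (uge n) (ler_wpM2r (rnorm_ge0 v) (un n)).
  rewrite ler_pdivrMr ?exprn_gt0 // exprMn => h.
  have {}h : 1 <= (1 - d) ^+ n * ((1 + l 1%g + n%:R * M) ^+ 2 * rnorm v ^+ 2).
    rewrite -(ler_pM2r (exprn_gt0 n N0)) mul1r; apply: le_trans h _.
    by rewrite le_eqVlt; apply/orP; left; apply/eqP; ring.
  have d1n : 0 <= (1 + d) ^+ n by rewrite exprn_ge0 // addr_ge0 // ltW.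
  have := ler_wpM2l d1n h; rewrite mulr1 mulrA -exprMn => {}h; apply: le_trans h _.
  apply: ler_piMl; first by rewrite mulr_ge0 ?sqr_ge0.
  by apply: exprn_ile1; nra.
exists ((rnorm (u n))^-1%:C *: u n).
  by rewrite rnormZ /= expr0n addr0 sqrtr_sqr ger0_norm ?invr_ge0 ?ltW // mulVf ?gt_eqF.
move=> g gQ; rewrite -(@ler_pXn2r _ 2) ?nnegrE ?rnorm_ge0 ?(ltW e0) //.
apply: le_trans dNe.
have un0 : 0 <= (rnorm (u n))^-1 by rewrite invr_ge0 ltW.
apply: orbit_sum_almost_invariant => //; first 1 last.
- exact: ltW.
- have -> : orbit_sum pi (1%g :: Q) ((rnorm (u n))^-1%:C *: u n) = (rnorm (u n))^-1%:C *: u n.+1.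
    rewrite /u iterS -/(u n) /orbit_sum scaler_sumr; apply: eq_bigr => h _.
    by rewrite linearZ.
  rewrite rnormZ /= expr0n addr0 sqrtr_sqr ger0_norm // -(ler_pM2r (u0 n)) [leRHS]mulrAC.
  by rewrite mulVf ?mul1r // gt_eqF.
- by rewrite rnormZ /= expr0n addr0 sqrtr_sqr ger0_norm // mulVf ?gt_eqF.
Qed.

(** The net is indexed by finite sets of group elements and precisions. *)
Lemma weakly_contains_trivial_of_decay : weakly_contains_trivial pi.
Proof.
have h2 p : 0 < 2 ^- p :> R by rewrite invr_gt0 exprn_gt0.
pose x (i : seq G * nat) := s2val (cid2 (almost_invariant_vector i.1 (h2 i.2))).
have x1 i : rnorm (x i) = 1 by rewrite /x; case: cid2.
have xQ i g : g \in i.1 -> rnorm (pi g (x i) - x i) <= 2 ^- i.2.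
  by rewrite /x; case: cid2 => y y1 /= yQ; exact: yQ.
exists (seq G * nat)%type, (fun i j => {subset i.1 <= j.1} /\ (i.2 <= j.2)%N), x; split.
- split; first by constructor; exact: ([::], 0%N).
  + by move=> i; split.
  + by move=> i j k [ij ij'] [jk jk']; split; [move=> g /ij /jk | exact: leq_trans jk'].
  + move=> i j; exists (i.1 ++ j.1, maxn i.2 j.2); split => /=.
    * by move=> g gi; rewrite mem_cat gi.
    * exact: leq_maxl.
    * by move=> g gj; rewrite mem_cat gj orbT.
    * exact: leq_maxr.
- by move=> i; rewrite rnormE x1.
move=> g eps eps0; have [p hp] := exists_half_pow eps0.
exists ([:: g], p) => -[Q q] [/= gQ pq]; rewrite rnormE ltcR.
apply: le_lt_trans (xQ (Q, q) g (gQ g (mem_head _ _))) _.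
by apply: le_lt_trans hp; rewrite lef_pV2 ?posrE ?exprn_gt0 // ler_weXn2l // ler1n.
Qed.

End AlmostInvariant.

(** * Complete Bessel families in an orbit *)

Lemma sum_tail_small (R : realType) (f : nat -> R) (B d : R) : (forall k, 0 <= f k) -> 0 < d ->
  (forall n, \sum_(0 <= k < n) f k <= B) ->
  exists n0, forall n, (n0 <= n)%N -> forall m, \sum_(n <= k < m) f k <= d.
Proof.
move=> f0 d0 fB; have nd : nondecreasing_seq (series f).
  by apply/nondecreasing_seqP => n; rewrite /series /= big_nat_recr //= lerDl.
have cf : cvgn (series f).
  by apply: nondecreasing_is_cvgn => //; exists B => _ [n _ <-]; exact: fB.
have /cvgrPdist_lt/(_ d d0)[n0 _ h] := cf.
exists n0 => n n0n m; have [mn|nm] := leqP m n; first by rewrite big_geq // ltW.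
have := h n n0n; have /(_ m) := nondecreasing_cvgn_le nd cf.
rewrite /series /= (@big_cat_nat _ _ _ n 0 m) //=; last exact: ltnW.
by move=> h1; rewrite ltr_norml => /andP[_]; lra.
Qed.

Section Bessel.
Variables (R : realType) (G : groupType) (H : hilbert R) (pi : unitary_rep G H).
Variables (v : H) (phi : G -> R).
Local Notation inner := (@inner R H).
Hypothesis phi_ge0 : forall g, 0 <= phi g.
Hypothesis phiE : forall g h, inner (pi g v) (pi h v) = (phi (h^-1 * g)%g)%:C.
Implicit Types (s t : seq G) (g h : G) (w : H).

(** [B] bounds the square of the norm of the synthesis operator of [s]. *)
Definition bessel (B : R) s : Prop := forall c : G -> R[i],
  rnorm (\sum_(g <- s) c g *: pi g v) ^+ 2 <= B * \sum_(g <- s) sqnorm (c g).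

Lemma phiV g : phi g^-1%g = phi g.
Proof.
have := inner_conj (pi g v) (pi 1%g v); rewrite !phiE conjc_real invg1 mul1g mulg1.
by move=> /complexI.
Qed.

Lemma Re_inner_le (c d : R[i]) g h :
  complex.Re (inner (c *: pi g v) (d *: pi h v)) <=
  (sqnorm c + sqnorm d) / 2 * phi (h^-1 * g)%g.
Proof.
rewrite innerZl innerZr phiE; case: c => a b; case: d => e f; rewrite /sqnorm /=.
set p := phi _; have -> : a * (e * p - - f * 0) - b * (e * 0 + - f * p) = (a * e + b * f) * p.
  by ring.
rewrite ler_wpM2r ?phi_ge0 //; have := sqr_ge0 (a - e); have := sqr_ge0 (b - f); nra.
Qed.

(** Schur's test. *)
Lemma bessel_row_sums B s :
  (forall g, g \in s -> \sum_(h <- s) phi (h^-1 * g)%g <= B) -> bessel B s.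
Proof.
move=> sB c; rewrite -Re_inner_sqr inner_suml raddf_sum /=.
under eq_bigr do rewrite inner_sumr raddf_sum /=.
apply: (@le_trans _ _ (\sum_(g <- s) \sum_(h <- s)
    (sqnorm (c g) + sqnorm (c h)) / 2 * phi (h^-1 * g)%g)).
  by apply: ler_sum => g _; apply: ler_sum => h _; exact: Re_inner_le.
have -> : \sum_(g <- s) \sum_(h <- s) (sqnorm (c g) + sqnorm (c h)) / 2 * phi (h^-1 * g)%g =
    \sum_(g <- s) sqnorm (c g) * \sum_(h <- s) phi (h^-1 * g)%g.
  have E : \sum_(g <- s) \sum_(h <- s) sqnorm (c h) / 2 * phi (h^-1 * g)%g =
           \sum_(g <- s) \sum_(h <- s) sqnorm (c g) / 2 * phi (h^-1 * g)%g.
    rewrite exchange_big; apply: eq_bigr => g _; apply: eq_bigr => h _.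
    by rewrite -(phiV (g^-1 * h)%g) invgM invgK.
  transitivity (\sum_(g <- s) \sum_(h <- s) sqnorm (c g) / 2 * phi (h^-1 * g)%g +
                \sum_(g <- s) \sum_(h <- s) sqnorm (c h) / 2 * phi (h^-1 * g)%g).
    rewrite -big_split; apply: eq_bigr => g _; rewrite -big_split; apply: eq_bigr => h _ /=.
    by rewrite !mulrDl.
  rewrite E -big_split; apply: eq_bigr => g _ /=; rewrite -big_split mulr_sumr.
  by apply: eq_bigr => h _ /=; field.
rewrite mulr_sumr big_seq [leRHS]big_seq; apply: ler_sum => g gs.
by rewrite mulrC ler_wpM2r ?sqnorm_ge0 ?sB.
Qed.

(** The cross terms are controlled by the Hilbert-Schmidt norm of the cross Gram
    matrix. *)
Lemma bessel_cat B d s t : 0 < d -> bessel B s -> bessel B t ->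
  \sum_(g <- s) \sum_(h <- t) phi (h^-1 * g)%g ^+ 2 <= d ^+ 2 ->
  bessel (B + d) (s ++ t).
Proof.
move=> d0 sB tB std c; rewrite !big_cat /=.
set x := \sum_(g <- s) _; set y := \sum_(g <- t) _.
set S := \sum_(g <- s) _; set T := \sum_(g <- t) _.
have S0 : 0 <= S by apply: sumr_ge0 => g _; exact: sqnorm_ge0.
have T0 : 0 <= T by apply: sumr_ge0 => g _; exact: sqnorm_ge0.
have hx : rnorm x ^+ 2 <= B * S := sB c; have hy : rnorm y ^+ 2 <= B * T := tB c.
have -> : rnorm (x + y) ^+ 2 = rnorm x ^+ 2 + rnorm y ^+ 2 + 2 * complex.Re (inner x y).
  rewrite -!Re_inner_sqr !(innerDl, innerDr) (inner_conj y x).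
  by move: (inner x x) (inner x y) (inner y y) => [a ?] [b ?] [e ?] /=; ring.
suff : 2 * complex.Re (inner x y) <= d * (S + T) by lra.
have [ST0|STn] := eqVneq (S + T) 0.
  have /andP[/eqP S00 /eqP T00] : (S == 0) && (T == 0) by rewrite -paddr_eq0 // ST0.
  move: hx; rewrite S00 mulr0 => hx.
  have /eqP : rnorm x ^+ 2 == 0 by rewrite eq_le hx sqr_ge0.
  move=> /eqP; rewrite sqrf_eq0 rnorm_eq0 => /eqP ->.
  by rewrite inner0l /= T00 addr0 !mulr0.
have STp : 0 < S + T by rewrite lt_neqAle eq_sym STn addr_ge0.
(* the weight in the inequality 2 a b <= la a^2 + b^2 / la that balances both sums *)
pose la := 2 * d / (S + T); have la0 : 0 < la by rewrite divr_gt0 ?mulr_gt0.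
apply: (@le_trans _ _ (la * (S * T) + (\sum_(g <- s) \sum_(h <- t) phi (h^-1 * g)%g ^+ 2) / la)).
  rewrite /x /y inner_suml raddf_sum /= mulr_sumr mulr_suml [la * _]mulrC mulr_suml mulr_suml.
  rewrite -big_split; apply: ler_sum => g _ /=.
  rewrite inner_sumr raddf_sum /= mulr_sumr mulr_suml mulr_sumr mulr_suml -big_split.
  apply: ler_sum => h _ /=; rewrite innerZl innerZr phiE.
  case: (c g) (c h) => a b [e f]; rewrite /sqnorm /=; set p := phi _.
  have -> : 2 * (a * (e * p - - f * 0) - b * (e * 0 + - f * p)) = 2 * (a * e + b * f) * p.
    by ring.
  set q := a * e + b * f.
  have hq : q ^+ 2 <= (a ^+ 2 + b ^+ 2) * (e ^+ 2 + f ^+ 2).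
    by rewrite /q; have := sqr_ge0 (a * f - b * e); nra.
  have : 2 * q * p <= q ^+ 2 * la + p ^+ 2 / la.
    rewrite -subr_ge0; have -> : q ^+ 2 * la + p ^+ 2 / la - 2 * q * p =
      (q * la - p) ^+ 2 / la by field; rewrite gt_eqF.
    by rewrite divr_ge0 ?sqr_ge0 // ltW.
  move=> /le_trans; apply; rewrite lerD2r; exact: ler_wpM2r (ltW la0) _ _ hq.
have h1 : la * (S * T) <= d * (S + T) / 2.
  have -> : la * (S * T) = d * (2 * (S * T)) / (S + T) by rewrite /la; field; rewrite gt_eqF.
  rewrite ler_pdivrMr // -!mulrA ler_wpM2l ?(ltW d0) //.
  by have := sqr_ge0 (S - T); have := sqr_ge0 (S + T); nra.
have h2 : (\sum_(g <- s) \sum_(h <- t) phi (h^-1 * g)%g ^+ 2) / la <= d * (S + T) / 2.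
  rewrite ler_pdivrMr //; apply: le_trans std _.
  by rewrite le_eqVlt; apply/orP; left; apply/eqP; rewrite /la; field; rewrite gt_eqF.
lra.
Qed.

(** The analysis operator is the adjoint of the synthesis operator, hence has the same
    norm. *)
Lemma bessel_dual B s w : 0 <= B -> bessel B s ->
  \sum_(g <- s) sqnorm (inner w (pi g v)) <= B * rnorm w ^+ 2.
Proof.
move=> B0 sB; have := sB (fun g => inner w (pi g v)).
set y := \sum_(g <- s) _; set S := \sum_(g <- s) _ => hy.
have S0 : 0 <= S by apply: sumr_ge0 => g _; exact: sqnorm_ge0.
have wy : inner w y = S%:C.
  rewrite /y inner_sumr /S rmorph_sum; apply: eq_bigr => g _ /=.
  by rewrite innerZr mulrC sqnormE.
have : S ^+ 2 <= rnorm w ^+ 2 * rnorm y ^+ 2.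
  rewrite -exprMn ler_pXn2r ?nnegrE ?mulr_ge0 ?rnorm_ge0 //.
  have := inner_le w y; rewrite wy /= expr0n addr0 sqrtr_sqr.
  by apply: le_trans; exact: ler_norm.
have [-> _|S1] := eqVneq S 0; first by rewrite mulr_ge0 ?sqr_ge0.
have {S1}Sp : 0 < S by rewrite lt_neqAle eq_sym S1.
rewrite expr2 => h; rewrite -(ler_pM2r Sp); apply: le_trans h _.
by rewrite [leRHS]mulrAC [leLHS]mulrC; exact: ler_wpM2r (sqr_ge0 _) _ _ hy.
Qed.

(** ** Orbits of a cyclic subgroup *)

Variables (a : G) (C M rho : R).
Hypothesis a_inj : injective (fun n : nat => (a ^+ n)%g).
Hypothesis phi_sum : sum_bounded (fun n : int => phi (zpow a n)) C.
Hypothesis phi_bl : band_limited rho M (fun n : int => phi (zpow a n)).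
Hypotheses (rho_ge0 : 0 <= rho) (rho_lt1 : rho < 1).

Let C_ge0 : 0 <= C := sum_bounded_ge0 phi_sum.

Lemma bessel_progression g (s : seq nat) : uniq s ->
  bessel C [seq (g * zpow a (Posz n))%g | n <- s].
Proof.
move=> us; apply: bessel_row_sums => _ /mapP[n ns ->]; rewrite big_map.
have := phi_sum (s := [seq n%:Z - m%:Z | m <- s]).
rewrite map_inj_uniq ?us => [/(_ isT)|m m' /addrI /oppr_inj []//].
rewrite big_map; congr (_ <= _); apply: eq_bigr => m _.
by rewrite invgM -mulgA mulKg -zpowN -zpowD addrC.
Qed.

Let difference (x : H) : H := x - pi a x.

(** Applying [1 - a] to a vector multiplies its spectral measure by
    [|1 - z| ^ 2 = 2 - z - z^-1], which is the symbol of the discrete Laplacian. *)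
Lemma inner_iter_difference K (j : int) :
  inner (pi (zpow a j) (iter K difference v)) (iter K difference v) =
  (iter K (@laplace R) (fun n => phi (zpow a n)) j)%:C.
Proof.
elim: K j => [|K IH] j.
  by have := phiE (zpow a j) 1%g; rewrite urep1 invg1 mul1g.
rewrite iterS [in RHS]iterS; set x := iter K difference v in IH *.
have E i k : inner (pi (zpow a i) x) (pi (zpow a k) x) = inner (pi (zpow a (i - k)) x) x.
  by rewrite -[RHS](urep_inner pi (zpow a k)) -urepM -zpowD subrKC.
have ax : pi a x = pi (zpow a 1) x by [].
have -> : inner (pi (zpow a j) (difference x)) (difference x) =
  2 * inner (pi (zpow a j) x) x - inner (pi (zpow a (j + 1)) x) x
  - inner (pi (zpow a (j - 1)) x) x.
  have -> : pi (zpow a j) (difference x) = pi (zpow a j) x - pi (zpow a (j + 1)) x.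
    by rewrite linearB ax -urepM -zpowD.
  rewrite /difference ax innerBl !innerBr !E.
  by rewrite addrK; ring.
rewrite !IH /laplace; apply/eqP; rewrite eq_complex /=; apply/andP; split; apply/eqP.
  by rewrite mulr0 subr0; ring.
by rewrite !(mulr0, mul0r, subr0, addr0, oppr0).
Qed.

Lemma rnorm_iter_difference K : rnorm (iter K difference v) ^+ 2 <= M * rho ^+ K.
Proof.
have := inner_iter_difference K 0; rewrite urep1 -rnorm_sqr => /complexI ->.
by apply: le_trans (ler_norm _) _; exact: phi_bl.
Qed.

Let tail n : nat -> H := fun i => pi (zpow a (n + i)%N) v.

Let tailS n x : cspan (tail n) x -> cspan (tail n.+1) (pi a x).
Proof.
move=> nx e e0; have [s xs] := nx e e0; exists s.
have -> : lincomb (tail n.+1) s = pi a (lincomb (tail n) s).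
  rewrite /lincomb linear_sum; apply: eq_bigr => p _; rewrite linearZ /= /tail -urepM.
  by congr (_ *: pi _ v); rewrite /= addSn expgS.
by rewrite -linearB rnorm_urep.
Qed.

Let cspan_tail_iter n k x : cspan (tail n) x -> cspan (tail (n + k)) (pi (zpow a k) x).
Proof.
move=> nx; elim: k => [|k IH]; first by rewrite addn0 urep1.
rewrite addnS [zpow a k.+1](expgS a) urepM; exact: tailS.
Qed.

(** [v - (1 - a)^K v] is a combination of [a v], ..., [a^K v], and [(1 - a)^K v]
    tends to 0 because the spectrum of [a] on [v] lies in the disc [|1 - z| < 1]. *)
Lemma cspan_tail1 : cspan (tail 1) v.
Proof.
have h K : cspan (tail 0) (iter K difference v) /\ cspan (tail 1) (v - iter K difference v).
  have v0 : cspan (tail 0) v by rewrite -[v](urep1 pi); exact: (cspan_base (tail 0) 0%N).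
  elim: K => [|K [h0 h1]]; first by rewrite subrr; split => //; exact: cspan0.
  rewrite iterS; set x := iter K difference v in h0 h1 *; split.
    apply: cspanB => //; apply: cspan_sub (tailS h0) => i.
    exact: (cspan_base (tail 0) i.+1).
  rewrite /difference opprB addrA addrAC; apply: cspanD => //; exact: tailS.
apply: cspan_closed => e e0; have e2 : 0 < e ^+ 2 by rewrite exprn_gt0.
have M1 : 0 < `|M| + 1 by rewrite ltr_wpDl.
have := @cvg_expr R rho; rewrite ger0_norm // => /(_ rho_lt1)/cvgrPdist_lt.
move=> /(_ _ (divr_gt0 e2 M1)) [K _ /(_ K (leqnn K))] /=.
rewrite sub0r normrN ger0_norm ?exprn_ge0 // ltr_pdivlMr // => hK.
exists (v - iter K difference v); first exact: (h K).2.
rewrite opprB addrC subrK -(@ltr_pXn2r _ 2) ?nnegrE ?rnorm_ge0 ?(ltW e0) //.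
apply: le_lt_trans (rnorm_iter_difference K) _; apply: le_lt_trans hK.
rewrite mulrC ler_wpM2l ?exprn_ge0 //; have := ler_norm M; lra.
Qed.

Lemma cspan_tail n : cspan (tail n) v.
Proof.
elim: n => [|n IH]; first by rewrite -[v](urep1 pi); exact: (cspan_base (tail 0) 0%N).
apply: cspan_sub cspan_tail1 => i; rewrite /tail add1n.
apply: cspan_sub (cspan_tail_iter i.+1 IH) => j.
by rewrite /tail -addSnnS -addnA; exact: (cspan_base (tail n.+1) (i + j)%N).
Qed.

(** The block [t] consists of elements [g * a ^+ n] with [n] large: they suffice to
    approximate [pi g v] by [cspan_tail], and the squares of their inner products
    with the vectors of [s] are terms of convergent series, by Bessel's inequality. *)
Lemma far_block s g e d : 0 < e -> 0 < d -> exists t,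
  [/\ uniq t, (0 < size t)%N, forall h, h \in t -> h \notin s, bessel C t &
      \sum_(g <- s) \sum_(h <- t) phi (h^-1 * g)%g ^+ 2 <= d ^+ 2 /\
      exists r : seq (R[i] * G), {subset [seq p.2 | p <- r] <= t} /\
        rnorm (pi g v - lincomb (fun h => pi h v) r) < e].
Proof.
move=> e0 d0; have d2 : 0 < d ^+ 2 by rewrite exprn_gt0.
pose b n := (g * zpow a (Posz n))%g.
have b_inj : injective b by move=> n m /mulgI /a_inj.
pose f n := \sum_(h <- s) phi ((b n)^-1 * h)%g ^+ 2.
have f0 n : 0 <= f n by apply: sumr_ge0 => h _; rewrite sqr_ge0.
have fB n : \sum_(0 <= k < n) f k <= \sum_(h <- s) C * rnorm (pi h v) ^+ 2.
  rewrite /f exchange_big; apply: ler_sum => h _.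
  apply: le_trans (bessel_dual (pi h v) C_ge0 (bessel_progression g (iota_uniq 0 n))).
  rewrite big_map /index_iota subn0; apply: ler_sum => k _.
  by rewrite phiE /sqnorm /= expr0n addr0.
have [n1 hn1] := sum_tail_small f0 d2 fB.
have [n2 hn2] : exists n2, forall n, (n2 <= n)%N -> b n \notin s.
  elim: s {f f0 fB n1 hn1} => [|h s [n2 hn2]]; first by exists 0%N.
  have [[k kh]|nk] := pselect (exists k, b k = h).
    exists (maxn n2 k.+1) => n; rewrite geq_max => /andP[/hn2 ns kn].
    by rewrite inE negb_or ns andbT -kh; apply/eqP => /b_inj nk; rewrite nk ltnn in kn.
  exists n2 => n /hn2 ns; rewrite inE negb_or ns andbT.
  by apply/eqP => bn; apply: nk; exists n.
pose n0 := maxn n1 n2; have [r hr] := cspan_tail n0 e0.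
pose m := (\max_(p <- r) p.2).+1; pose t := [seq b n | n <- index_iota n0 (n0 + m)].
exists t; split.
- by rewrite map_inj_uniq ?iota_uniq.
- by rewrite size_map size_iota addnC addnK.
- by move=> _ /mapP[n nm ->]; apply: hn2; move: nm; rewrite mem_index_iota => /andP[+ _];
    apply: leq_trans; exact: leq_maxr.
- by apply: bessel_progression; exact: iota_uniq.
split.
  rewrite exchange_big big_map /=; apply: hn1; exact: leq_maxl.
exists [seq (p.1, b (n0 + p.2)%N) | p <- r]; split.
  move=> _ /mapP[_ /mapP[p pr ->] ->] /=; apply: map_f; rewrite mem_index_iota leq_addr /=.
  by rewrite ltn_add2l ltnS; exact: (@leq_bigmax_seq _ _ xpredT (fun p => p.2)).
have -> : lincomb (fun h => pi h v) [seq (p.1, b (n0 + p.2)%N) | p <- r] =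
   pi g (lincomb (tail n0) r).
  by rewrite /lincomb big_map linear_sum; apply: eq_bigr => p _; rewrite linearZ /= -urepM.
by rewrite -linearB rnorm_urep.
Qed.

(** ** Assembling the blocks *)

Variable e : nat -> G.
Hypothesis e_surj : forall g, exists n, e n = g.
Hypothesis v_total : forall x, cspan (fun g => pi g v) x.

Let code k : nat * nat := odflt (0%N, 0%N) (choice.unpickle k).

Let half_pow_gt0 k : 0 < 2 ^- k :> R.
Proof. by rewrite invr_gt0 exprn_gt0. Qed.

(** The [k]-th block approximates the translate of [v] by the element coded by [k],
    with the precision coded by [k]. *)
Let block k s : seq G := projT1 (cid
  (far_block s (e (code k).1) (half_pow_gt0 (code k).2) (half_pow_gt0 k))).

Let blockP k s := projT2 (cid
  (far_block s (e (code k).1) (half_pow_gt0 (code k).2) (half_pow_gt0 k))).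

Fixpoint selection k : seq G :=
  if k is k'.+1 then selection k' ++ block k' (selection k') else [::].

Let selection_sub k m : (k <= m)%N -> {subset selection k <= selection m}.
Proof.
move=> km g gk; rewrite -(subnKC km); elim: (m - k)%N => [|j IH]; first by rewrite addn0.
by rewrite addnS /= mem_cat IH.
Qed.

Let selection_uniq k : uniq (selection k).
Proof.
elim: k => //= k IH; have [u _ d _ _] := blockP k (selection k).
rewrite cat_uniq IH u andbT /=; apply/hasPn => h hb; exact: d.
Qed.

Let selection_size k : (k <= size (selection k))%N.
Proof.
elim: k => //= k IH; have [_ s0 _ _ _] := blockP k (selection k).
by rewrite size_cat -addn1 leq_add.
Qed.

Let selection_bessel k : bessel (C + 2 - 2 * 2 ^- k) (selection k).
Proof.
elim: k => [|k IH] /=.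
  by move=> c; rewrite !big_nil rnorm0 expr0n mulr0.
have [_ _ _ b [hs _]] := blockP k (selection k).
have -> : C + 2 - 2 * 2 ^- k.+1 = C + 2 - 2 * 2 ^- k + 2 ^- k.
  by rewrite exprS invfM; field; rewrite expf_neq0.
apply: bessel_cat => // c; apply: le_trans (b c) _.
apply: ler_wpM2r; first by apply: sumr_ge0 => g _; exact: sqnorm_ge0.
have : 2 ^- k <= 1 :> R by rewrite invf_le1 ?exprn_gt0 // exprn_ege1 // ler1n.
lra.
Qed.

Let S : set G := [set g | exists k, g \in selection k].

Let finite_in_selection (A : set G) : finite_set A -> A `<=` S ->
  exists k, forall g, g \in fset_set A -> g \in selection k.
Proof.
move=> fA AS.
suff : forall s : seq G, (forall g, g \in s -> S g) ->
    exists k, forall g, g \in s -> g \in selection k.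
  by apply=> g; rewrite in_fset_set // inE => /AS.
elim=> [|g s IH] gS; first by exists 0%N.
have [k hk] := IH (fun h hs => gS h (mem_behead (s := g :: s) hs)).
have [m hm] := gS g (mem_head _ _).
exists (maxn k m) => h; rewrite inE => /orP[/eqP ->|/hk].
  by apply: selection_sub hm; exact: leq_maxr.
by apply: selection_sub; exact: leq_maxl.
Qed.

Let S_infinite : ~ finite_set S.
Proof.
move=> fS; have [k hk] := finite_in_selection fS (@subset_refl _ S).
have := uniq_leq_size (selection_uniq (size (selection k)).+1) (s2 := selection k).
move=> H1; have : (size (selection k) < size (selection k))%N; last by rewrite ltnn.
apply: leq_trans (selection_size _) (H1 _) => g gs.
by apply: hk; rewrite in_fset_set // inE; exists (size (selection k)).+1.
Qed.

Let S_separates w : w != 0 -> exists2 g, S g & inner w (pi g v) != 0.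
Proof.
move=> w0; apply: contrapT => hw.
have {}hw g : S g -> inner w (pi g v) = 0.
  by move=> Sg; apply/eqP/negP => /negP h; apply: hw; exists g.
move/eqP: w0; apply; apply: inner_eq0; apply: cspan_orthogonal (v_total w) _ => g.
apply/eqP; rewrite -normc_eq0; apply/eqP.
have [n en] := e_surj g; apply: (@eps_eq0 _ _ (rnorm w)); first exact: normc_ge0.
move=> d d0 _; have [p hp] := exists_half_pow d0.
pose k := choice.pickle (n, p); have ck : code k = (n, p) by rewrite /code choice.pickleK.
have [_ _ _ _ [_ [r [rb hr]]]] := blockP k (selection k).
have w_r : inner w (lincomb (fun h => pi h v) r) = 0.
  rewrite inner_sumr big_seq big1 // => q qr; rewrite innerZr hw ?mulr0 //.
  by exists k.+1; rewrite /= mem_cat; apply/orP; right; apply: rb; exact: map_f.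
have -> : inner w (pi g v) = inner w (pi g v - lincomb (fun h => pi h v) r).
  by rewrite innerBr w_r subr0.
apply: le_trans (inner_le _ _) _; rewrite mulrC ler_wpM2r ?rnorm_ge0 // ltW //.
by apply: lt_trans hp; move: hr; rewrite ck /= en.
Qed.

(** The lower bound only asks that the selected translates separate vectors, and the
    upper bound is the Bessel inequality, with the bound of a single block increased by
    the convergent sum of the bounds for cross terms. *)
Lemma exists_weak_frame :
  exists S : set G, countably_infinite S /\ weak_frame S (fun g => pi g v).
Proof.
exists S; split.
  apply: eq_card_nat S_infinite; apply: sub_countable (_ : S #<= range e)%card _.
    by apply: subset_card_le => g _; have [n en] := e_surj g; exists n.
  exact: card_le_trans (card_image_le _ _) (countableP _).
move=> w w0; apply/andP; split.
  have [g Sg wg] := S_separates w0.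
  apply: (@lt_le_trans _ _ ((Normc.normc (inner w (pi g v)) ^+ 2)%:E)).
    by rewrite lte_fin exprn_even_gt0 // normc_eq0.
  apply: esum_ge; exists [set g]; first by split => // h ->.
  by rewrite fsbig_set1.
apply: (@le_lt_trans _ _ (((C + 2) * rnorm w ^+ 2)%:E)); last exact: ltry.
apply: ge_ereal_sup => _ [A [fA AS] <-].
have [k hk] := finite_in_selection fA AS.
rewrite fsbig_finite // sumEFin lee_fin.
apply: (@le_trans _ _ (\sum_(g <- selection k) sqnorm (inner w (pi g v)))).
  under eq_bigr do rewrite sqnorm_normc.
  by apply: ler_sum_subset => // g; exact: sqnorm_ge0.
have B0 : 2 * 2 ^- k <= 2 :> R.
  have : 2 ^- k <= 1 :> R by rewrite invf_le1 ?exprn_gt0 // exprn_ege1 // ler1n.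
  lra.
have C0 := C_ge0.
apply: le_trans (bessel_dual w _ (@selection_bessel k)) _; first by lra.
rewrite ler_wpM2r ?sqr_ge0 //; have := half_pow_gt0 k; lra.
Qed.

End Bessel.

(** * A criterion for framenability *)

(** Here [l] plays the role of a length function: a positive definite function that
    decays at most quadratically in [l] yields almost invariant vectors, while its
    summability on the powers of [a] yields the weak frame. *)
Theorem framenable_of_pos_def (R : realType) (G : groupType) (phi l : G -> R) (a : G) (C : R) :
  countably_infinite [set: G] ->
  pos_def (fun g h => phi (h^-1 * g)%g) -> (forall g, 0 <= phi g) ->
  (forall g, 0 <= l g) -> (forall g h, l (g * h)%g <= l g + l h) ->
  (forall g, (1 + l g) ^- 2 <= phi g) ->
  injective (fun n : nat => (a ^+ n)%g) ->
  sum_bounded (fun n : int => phi (zpow a n)) C ->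
  framenable R G.
Proof.
move=> /countably_infinite_enum[e [r [eK rK]]] phi_pd phi0 l0 lM lphi ainj phiC.
have [H [pi [v [vtot vE]]]] := cyclic_representation eK rK (smooth_pos_def a phi0 phi_pd).
exists H, pi; split.
  apply: (weakly_contains_trivial_of_decay vE l0 lM) => g.
  exact: le_trans (lphi g) (smooth_ge a phi0 phi_pd g).
have [D hD] := smooth_sum phi0 phi_pd phiC.
have [M hM] := smooth_band_limited phi0 phi_pd phiC.
have rho1 : 4^-1 < 1 :> R by rewrite invf_lt1 // ltr1n.
have e_surj g : exists n, e n = g by exists (r g).
have rho0 : 0 <= 4^-1 :> R by rewrite invr_ge0.
have [S [Sinf Sframe]] :=
  exists_weak_frame (smooth_ge0 a phi0 phi_pd) vE ainj hD hM rho0 rho1 e_surj vtot.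
by exists S, v.
Qed.

(** * The logarithmic kernel of the hyperbolic plane *)

Section Coordinates.
Variable R : realType.
Implicit Types g h : SL2 R.

Definition e00 g : R := val g ord0 ord0.
Definition e01 g : R := val g ord0 ord_max.
Definition e10 g : R := val g ord_max ord0.
Definition e11 g : R := val g ord_max ord_max.

Lemma SL2_det g : e00 g * e11 g - e01 g * e10 g = 1.
Proof.
have l1 : lift ord0 ord0 = ord_max :> 'I_2 by apply: val_inj.
have l0 : lift (lift ord0 ord0) ord0 = ord0 :> 'I_2 by apply: val_inj.
have /eqP := valP g; rewrite (expand_det_row _ ord0) !big_ord_recl big_ord0 addr0.
rewrite /cofactor !det_mx11 !mxE !l0 !l1 /= expr0 expr1 mul1r mulN1r mulrN => <-.
by [].
Qed.

Let mulE g h i j : val (g * h)%g i j =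
  val g i ord0 * val h ord0 j + val g i ord_max * val h ord_max j.
Proof.
rewrite [val _]/= mxE !big_ord_recl big_ord0 addr0.
by congr (_ + val g _ _ * val h _ _); apply: val_inj.
Qed.

Lemma e00M g h : e00 (g * h)%g = e00 g * e00 h + e01 g * e10 h. Proof. exact: mulE. Qed.
Lemma e01M g h : e01 (g * h)%g = e00 g * e01 h + e01 g * e11 h. Proof. exact: mulE. Qed.
Lemma e10M g h : e10 (g * h)%g = e10 g * e00 h + e11 g * e10 h. Proof. exact: mulE. Qed.
Lemma e11M g h : e11 (g * h)%g = e10 g * e01 h + e11 g * e11 h. Proof. exact: mulE. Qed.

Lemma ord2_cases (k : 'I_2) : k = ord0 \/ k = ord_max.
Proof. by case: k => -[|[|//]] ?; [left|right]; apply: val_inj. Qed.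

Lemma SL2_ext g h : e00 g = e00 h -> e01 g = e01 h -> e10 g = e10 h -> e11 g = e11 h -> g = h.
Proof.
move=> h00 h01 h10 h11; apply: val_inj; apply/matrixP => i j.
by case: (ord2_cases i) => ->; case: (ord2_cases j) => ->.
Qed.

Lemma e00_1 : e00 1%g = 1. Proof. by rewrite /e00 mxE. Qed.
Lemma e01_1 : e01 1%g = 0. Proof. by rewrite /e01 mxE. Qed.
Lemma e10_1 : e10 1%g = 0. Proof. by rewrite /e10 mxE. Qed.
Lemma e11_1 : e11 1%g = 1. Proof. by rewrite /e11 mxE. Qed.

Let adjugate g : e00 g^-1%g = e11 g /\ e01 g^-1%g = - e01 g /\
  e10 g^-1%g = - e10 g /\ e11 g^-1%g = e00 g.
Proof.
have := mulVg g; have := SL2_det g.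
move=> d /[dup] /(congr1 e00); rewrite e00M e00_1 => h0 /[dup] /(congr1 e01).
rewrite e01M e01_1 => h1 /[dup] /(congr1 e10); rewrite e10M e10_1 => h2 /(congr1 e11).
rewrite e11M e11_1 => h3; move: d h0 h1 h2 h3.
set p := e00 g; set q := e01 g; set r := e10 g; set s := e11 g.
set x := e00 _; set y := e01 _; set z := e10 _; set w := e11 _ => D h0 h1 h2 h3.
split; [|split; [|split]].
- rewrite -[LHS]mulr1 -D (_ : _ * _ = s * (x * p + y * r) - r * (x * q + y * s)); last by ring.
  by rewrite h0 h1; ring.
- rewrite -[LHS]mulr1 -D (_ : _ * _ = p * (x * q + y * s) - q * (x * p + y * r)); last by ring.
  by rewrite h0 h1; ring.
- rewrite -[LHS]mulr1 -D (_ : _ * _ = s * (z * p + w * r) - r * (z * q + w * s)); last by ring.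
  by rewrite h2 h3; ring.
rewrite -[LHS]mulr1 -D (_ : _ * _ = p * (z * q + w * s) - q * (z * p + w * r)); last by ring.
by rewrite h2 h3; ring.
Qed.

Lemma e00V g : e00 g^-1%g = e11 g. Proof. exact: (adjugate g).1. Qed.
Lemma e01V g : e01 g^-1%g = - e01 g. Proof. exact: (adjugate g).2.1. Qed.
Lemma e10V g : e10 g^-1%g = - e10 g. Proof. exact: (adjugate g).2.2.1. Qed.
Lemma e11V g : e11 g^-1%g = e00 g. Proof. exact: (adjugate g).2.2.2. Qed.

Definition SL2_trace g : R := e00 g + e11 g.

(** Half the square of the Hilbert-Schmidt norm: this is the hyperbolic cosine of
    the distance by which [g] moves the base point of the hyperbolic plane. *)
Definition SL2_cosh g : R := (e00 g ^+ 2 + e01 g ^+ 2 + e10 g ^+ 2 + e11 g ^+ 2) / 2.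

Lemma SL2_cosh_ge1 g : 1 <= SL2_cosh g.
Proof.
rewrite /SL2_cosh; have := SL2_det g; move: (e00 g) (e01 g) (e10 g) (e11 g) => p q r s.
have := sqr_ge0 (p - s); have := sqr_ge0 (q + r); nra.
Qed.

Lemma SL2_cosh_gt0 g : 0 < SL2_cosh g.
Proof. exact: lt_le_trans (SL2_cosh_ge1 g). Qed.

Lemma SL2_coshV g : SL2_cosh g^-1%g = SL2_cosh g.
Proof. by rewrite /SL2_cosh e00V e01V e10V e11V; field. Qed.

Lemma SL2_coshM g h : SL2_cosh (g * h)%g <= 2 * SL2_cosh g * SL2_cosh h.
Proof.
rewrite /SL2_cosh e00M e01M e10M e11M.
move: (e00 g) (e01 g) (e10 g) (e11 g) (e00 h) (e01 h) (e10 h) (e11 h).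
move=> p q r s a b c d.
have := sqr_ge0 (p * c - q * a); have := sqr_ge0 (p * d - q * b).
have := sqr_ge0 (r * c - s * a); have := sqr_ge0 (r * d - s * b).
lra.
Qed.

(** The Lorentz product of the points of the hyperboloid attached to [g] and [h],
    which are the symmetric matrices [g * g^T] and [h * h^T]. *)
Lemma SL2_cosh_lorentz g h :
  SL2_cosh (h^-1 * g)%g = SL2_cosh g * SL2_cosh h -
   ((e00 g ^+ 2 + e01 g ^+ 2 - e10 g ^+ 2 - e11 g ^+ 2) / 2 *
    ((e00 h ^+ 2 + e01 h ^+ 2 - e10 h ^+ 2 - e11 h ^+ 2) / 2) +
    (e00 g * e10 g + e01 g * e11 g) * (e00 h * e10 h + e01 h * e11 h)).
Proof. by rewrite /SL2_cosh e00M e01M e10M e11M e00V e01V e10V e11V; field. Qed.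

End Coordinates.

Section LogKernel.
Variable R : realType.

(** The error term of the logarithmic series has a closed form derivative, so that the mean
    value theorem bounds it without any differentiation of series. *)
Lemma is_derive_log_partial n (y : R) : y < 1 ->
  is_derive y 1 (fun y => \sum_(k < n) y ^+ k.+1 / k.+1%:R + ln (1 - y)) (- y ^+ n / (1 - y)).
Proof.
move=> y1; have y10 : 0 < 1 - y by rewrite subr_gt0.
elim: n => [|n IH].
  have -> : (fun y : R => \sum_(k < 0) y ^+ k.+1 / k.+1%:R + ln (1 - y)) = fun y => ln (1 - y).
    by apply/funext => z; rewrite big_ord0 add0r.
  have h : is_derive (1 - y) 1 (@ln R) (1 - y)^-1 by exact: is_derive1_ln.
  have h2 : is_derive y 1 (fun z : R => 1 - z) (- 1).
    by rewrite -[- 1]add0r; apply: is_deriveB.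
  have := @is_derive1_comp R (@ln R) (fun z => 1 - z) y _ _ h h2.
  by rewrite expr0 mulrC.
have -> : (fun y : R => \sum_(k < n.+1) y ^+ k.+1 / k.+1%:R + ln (1 - y)) =
   (fun y => y ^+ n.+1 / n.+1%:R) \+ (fun y : R => \sum_(k < n) y ^+ k.+1 / k.+1%:R + ln (1 - y)).
  by apply/funext => z /=; rewrite big_ord_recr /= addrAC addrC addrA.
have -> : - y ^+ n.+1 / (1 - y) = y ^+ n + - y ^+ n / (1 - y).
  by rewrite exprS; field; rewrite gt_eqF.
apply: is_deriveD.
have := is_deriveZ (n.+1%:R^-1 : R) (is_deriveX n.+1 (is_derive_id y (1 : R))).
have -> : n.+1%:R^-1 \*: id ^+ n.+1 = (fun y : R => y ^+ n.+1 / n.+1%:R).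
  by apply/funext => z; rewrite /= !fctE mulrC.
have -> // : n.+1%:R^-1 *: (n.+1%:R * y ^+ n *: 1) = y ^+ n :> R.
by rewrite /GRing.scale /= mulr1 mulKf.
Qed.

Lemma cvg_log_series (s : R) : `|s| < 1 ->
  (fun n => \sum_(k < n) s ^+ k.+1 / k.+1%:R) @ \oo --> - ln (1 - s).
Proof.
move=> s1; pose F n y := \sum_(k < n) y ^+ k.+1 / k.+1%:R + ln (1 - y) : R.
have F0 n : F n 0 = 0.
  by rewrite /F subr0 ln1 addr0 big1 // => k _; rewrite expr0n mul0r.
have s2 : 0 < 1 - `|s| by rewrite subr_gt0.
have Fs n : `|F n s| <= `|s| ^+ n / (1 - `|s|).
  have lt1 y : `|y| <= `|s| -> y < 1.
    by move=> ys; apply: le_lt_trans (ler_norm y) (le_lt_trans ys s1).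
  have D (y : R) : `|y| <= `|s| -> is_derive y 1 (F n) (- y ^+ n / (1 - y)).
    by move=> /lt1; exact: is_derive_log_partial.
  have bound c : `|c| <= `|s| -> `|- c ^+ n / (1 - c)| <= `|s| ^+ n / (1 - `|s|).
    move=> cs; have c1 := lt1 c cs; rewrite normrM normrN normrX normfV.
    rewrite (gtr0_norm (_ : 0 < 1 - c)) ?subr_gt0 // ler_pM ?exprn_ge0 ?invr_ge0 ?subr_ge0 ?(ltW c1) //.
      by rewrite lerXn2r ?nnegrE.
    rewrite lef_pV2 ?posrE ?subr_gt0 // lerD2l lerN2.
    by apply: le_trans (ler_norm c) cs.
  have [c cs E] : exists2 c, `|c| <= `|s| & F n s = - c ^+ n / (1 - c) * s.
    have [s0|s0] := leP 0 s.
      have [||c] := @MVT_segment R (F n) (fun y => - y ^+ n / (1 - y)) 0 s s0.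
      - move=> y; rewrite in_itv /= => /andP[y0 ys]; apply: D.
        by rewrite !ger0_norm // ltW.
      - apply: derivable_within_continuous => y; rewrite in_itv /= => /andP[y0 ys].
        by apply: ex_derive; apply: D; rewrite !ger0_norm.
      rewrite in_itv /= F0 !subr0 => /andP[c0 cs] E; exists c => //.
      by rewrite !ger0_norm.
    have [||c] := @MVT_segment R (F n) (fun y => - y ^+ n / (1 - y)) s 0 (ltW s0).
    - move=> y; rewrite in_itv /= => /andP[y0 ys]; apply: D.
      by rewrite !ltr0_norm // lerN2 ltW.
    - apply: derivable_within_continuous => y; rewrite in_itv /= => /andP[y0 ys].
      by apply: ex_derive; apply: D; rewrite (ltr0_norm s0) (ler0_norm ys) lerN2.
    rewrite in_itv /= F0 !sub0r => /andP[c0 cs] E; exists c.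
      by rewrite (ltr0_norm s0) (ler0_norm cs) lerN2.
    by apply: oppr_inj; rewrite E mulrN.
  rewrite E normrM -[leRHS]mulr1 ler_pM // ?bound //; exact: ltW.
have -> : (fun n => \sum_(k < n) s ^+ k.+1 / k.+1%:R) = (fun n => F n s - ln (1 - s)).
  by apply/funext => n; rewrite /F addrK.
rewrite -[X in _ --> X]add0r; apply: cvgB; last exact: cvg_cst.
apply/cvgrPdist_le => e e0; have := @cvg_expr R `|s|; rewrite normr_id => /(_ s1)/cvgrPdist_le.
move=> /(_ _ (mulr_gt0 e0 s2))[N _ hN]; exists N => // n nN.
rewrite sub0r normrN; apply: le_trans (Fs n) _; rewrite ler_pdivrMr //.
by have := hN n nN; rewrite /= sub0r normrN normrX normr_id.
Qed.

Let x1 (g : SL2 R) : R := (e00 g ^+ 2 + e01 g ^+ 2 - e10 g ^+ 2 - e11 g ^+ 2) / 2.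
Let x2 (g : SL2 R) : R := e00 g * e10 g + e01 g * e11 g.

(** Klein model coordinates: [1 - klein g h] is the kernel [SL2_cosh (h^-1 * g)] up
    to a factor depending on [g] alone and a factor depending on [h] alone. *)
Let klein (g h : SL2 R) : R := (x1 g * x1 h + x2 g * x2 h) / (SL2_cosh g * SL2_cosh h).

Let klein_pd : pos_def klein.
Proof.
apply: pos_def_ext (pos_defD (pos_def_rank1 (fun g => x1 g / SL2_cosh g))
                             (pos_def_rank1 (fun g => x2 g / SL2_cosh g))) => g h.
rewrite /klein; field; rewrite !gt_eqF ?SL2_cosh_gt0 //.
Qed.

Let kleinE g h : 1 - klein g h = SL2_cosh (h^-1 * g)%g / (SL2_cosh g * SL2_cosh h).
Proof.
rewrite SL2_cosh_lorentz /klein /x1 /x2; field.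
by rewrite !gt_eqF ?SL2_cosh_gt0.
Qed.

Let klein_lt1 g h : `|klein g h| < 1.
Proof.
have lt g' h' : klein g' h' < 1.
  rewrite -subr_gt0 kleinE; apply: divr_gt0; first exact: SL2_cosh_gt0.
  by rewrite mulr_gt0 // SL2_cosh_gt0.
rewrite -(@ltr_pXn2r _ 2) ?nnegrE // expr1n real_normK ?num_real //.
apply: le_lt_trans (pos_def_sqr_le g h klein_pd) _.
by rewrite -[ltRHS]mulr1 ltr_pM ?lt ?(pos_def_diag _ klein_pd).
Qed.

Let log_klein_pd : pos_def (fun g h => - ln (1 - klein g h)).
Proof.
apply: (@pos_def_cvg _ _ (fun n g h => \sum_(k < n) klein g h ^+ k.+1 / k.+1%:R)).
  move=> n; apply: (@pos_def_sum _ _ n (fun k g h => klein g h ^+ k.+1 / k.+1%:R)) => k.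
  have k0 : 0 <= k.+1%:R^-1 :> R by rewrite invr_ge0.
  by apply: pos_def_ext (pos_defZ k0 (pos_defX k.+1 klein_pd)) => g h; rewrite mulrC.
by move=> g h; apply: cvg_log_series; exact: klein_lt1.
Qed.

(** [log_klein_pd] makes the logarithm of the hyperbolic cosine of the distance
    conditionally negative definite: up to a function of [g] and a function of [h] it is
    [ln (1 - klein g h)], and [- ln (1 - x)] is a power series with nonnegative
    coefficients. *)
Lemma pos_def_log_cosh :
  pos_def (fun g h : SL2 R => (1 + ln (SL2_cosh (h^-1 * g)%g))^-1).
Proof.
have lc0 (g : SL2 R) : 0 <= ln (SL2_cosh g) by exact/ln_ge0/SL2_cosh_ge1.
have c0 (g : SL2 R) : 0 < SL2_cosh g by exact: SL2_cosh_gt0.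
have E g h : 1 / 2 + ln (SL2_cosh g) + (1 / 2 + ln (SL2_cosh h)) - - ln (1 - klein g h) =
   1 + ln (SL2_cosh (h^-1 * g)%g).
  rewrite kleinE ln_div ?posrE ?c0 ?(mulr_gt0 (c0 g) (c0 h)) //.
  rewrite lnM ?posrE ?c0 //.
  by move: (ln (SL2_cosh g)) (ln (SL2_cosh h)) (ln _) => u v w; field.
have := @pos_def_inv R _ (fun g => 1 / 2 + ln (SL2_cosh g)) _ log_klein_pd.
move=> H; apply: pos_def_ext (H _ _).
- by move=> g h /=; rewrite E.
- by move=> g; have := lc0 g; lra.
move=> g; rewrite -subr_gt0 E mulVg.
by have := lc0 1%g; lra.
Qed.

End LogKernel.

(** * Subgroups with a hyperbolic element *)

Section Hyperbolic.
Variable R : realType.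
Implicit Types g h a : SL2 R.

Lemma SL2_cayley_hamilton a g :
  SL2_trace (a * (a * g))%g = SL2_trace a * SL2_trace (a * g)%g - SL2_trace g.
Proof.
rewrite /SL2_trace !(e00M, e01M, e10M, e11M).
have := SL2_det a; move: (e00 a) (e01 a) (e10 a) (e11 a) (e00 g) (e01 g) (e10 g) (e11 g).
move=> p q r s x y z w D.
rewrite -[x + w in RHS]mul1r -D; ring.
Qed.

(** Both sides satisfy the recursion given by the Cayley-Hamilton theorem. *)
Lemma SL2_trace_pow a lam n : lam != 0 -> SL2_trace a = lam + lam^-1 ->
  SL2_trace (a ^+ n)%g = lam ^+ n + lam ^- n.
Proof.
move=> l0 ta; have tr1 : SL2_trace (1%g : SL2 R) = 1 + 1 by rewrite /SL2_trace e00_1 e11_1.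
suff [] : SL2_trace (a ^+ n)%g = lam ^+ n + lam ^- n /\
          SL2_trace (a * a ^+ n)%g = lam ^+ n.+1 + lam ^- n.+1 by [].
elim: n => [|n [IH0 IH1]]; first by rewrite expg0 mulg1 tr1 ta expr0 invr1 expr1.
rewrite expgS; split=> //.
rewrite SL2_cayley_hamilton IH1 IH0 ta !exprS; field.
by rewrite l0 expf_neq0.
Qed.

Lemma SL2_cosh_ge_trace g : SL2_trace g ^+ 2 / 4 <= SL2_cosh g.
Proof.
rewrite /SL2_trace /SL2_cosh; move: (e00 g) (e01 g) (e10 g) (e11 g) => p q r s.
by have := sqr_ge0 (p - s); have := sqr_ge0 q; have := sqr_ge0 r; nra.
Qed.

(** A hyperbolic element translates along a geodesic, by a distance which is twice the
    logarithm of its largest eigenvalue. *)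
Lemma hyperbolic_growth a : 2 < SL2_trace a ->
  exists2 mu : R, 0 < mu & forall n : nat, 2 < SL2_trace (a ^+ n.+1)%g /\
    n%:R * mu <= 1 + ln (SL2_cosh (a ^+ n)%g).
Proof.
move=> ta; set t := SL2_trace a; pose s := Num.sqrt (t ^+ 2 - 4).
have t4 : 0 < t ^+ 2 - 4 by move: ta; rewrite -/t; nra.
have s0 : 0 < s by rewrite sqrtr_gt0.
have s2 : s ^+ 2 = t ^+ 2 - 4 by rewrite sqr_sqrtr // ltW.
pose lam := (t + s) / 2; have l1 : 1 < lam by move: ta; rewrite -/t /lam; lra.
have l0 : 0 < lam by apply: lt_trans l1.
have tE : t = lam + lam^-1.
  have -> : lam^-1 = (t - s) / 2.
    apply: (mulfI (lt0r_neq0 l0)); rewrite divff ?gt_eqF // /lam.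
    rewrite (_ : (t + s) / 2 * _ = (t ^+ 2 - s ^+ 2) / 4); last by field.
    by rewrite s2; field.
  by rewrite /lam; field.
exists (ln lam); first exact: ln_gt0.
move=> n; have ln0 m : 0 < lam ^+ m by exact: exprn_gt0.
split.
  rewrite (SL2_trace_pow _ (lt0r_neq0 l0) tE).
  have h : lam ^+ n.+1 * lam ^- n.+1 = 1 by rewrite divff // gt_eqF.
  have h1 : 1 < lam ^+ n.+1 by rewrite exprn_egt1.
  have : 0 < lam ^- n.+1 by rewrite invr_gt0.
  move: h h1; move: (lam ^+ _) (lam ^- _) => x y; nra.
have c0 : 0 <= ln (SL2_cosh (a ^+ n)%g) by apply/ln_ge0/SL2_cosh_ge1.
have l2 : ln 2 <= 1 :> R by apply: (@le_ln1Dx R 1); lra.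
(* the claim is the average of the next bound and of [0 <= ln (SL2_cosh (a ^+ n))] *)
have : 2 * (n%:R * ln lam - ln 2) <= ln (SL2_cosh (a ^+ n)%g).
  have -> : 2 * (n%:R * ln lam - ln 2) = ln ((lam ^+ n / 2) ^+ 2).
    by rewrite lnXn ?divr_gt0 // ln_div ?posrE // lnXn // -[RHS]mulr_natl -[ln lam *+ n]mulr_natl.
  rewrite ler_ln ?posrE ?(exprn_gt0 2 (divr_gt0 (ln0 n) (ltr0n R 2))) ?SL2_cosh_gt0 //.
  apply: le_trans (SL2_cosh_ge_trace _); rewrite (SL2_trace_pow _ (lt0r_neq0 l0) tE).
  have : 0 < lam ^- n by rewrite invr_gt0.
  have := ln0 n; move: (lam ^+ _) (lam ^- _) => x y; nra.
lra.
Qed.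

End Hyperbolic.

Lemma val_pow (R : realType) (L : groupClosed (SL2 R)) (a : subgroup_type L) n :
  val (a ^+ n)%g = (val a ^+ n)%g.
Proof. by elim: n => [//|n IH]; rewrite !expgS -IH. Qed.

(** The square of [pos_def_log_cosh] decays like [1 / n ^ 2] on the powers of [a], and the
    length function [ln (2 * SL2_cosh g)] is subadditive by [SL2_coshM]. *)
Lemma framenable_hyperbolic (R : realType) (L : groupClosed (SL2 R)) (a : subgroup_type L) :
  countably_infinite [set: subgroup_type L] -> 2 < SL2_trace (val a) ->
  framenable R (subgroup_type L).
Proof.
move=> cL /hyperbolic_growth[mu mu0 ha].
pose lc (g : subgroup_type L) : R := ln (SL2_cosh (val g)).
have lc0 (g : subgroup_type L) : 0 <= lc g by apply/ln_ge0/SL2_cosh_ge1.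
have [C hC] := sum_bounded_inv_sqr (exprn_gt0 2 mu0).
apply: (@framenable_of_pos_def R (subgroup_type L) (fun g => (1 + lc g) ^- 2)
  (fun g => ln 2 + lc g) a (2 * C)) => //.
- have := pos_defX 2 (pos_def_comp (fun g : subgroup_type L => val g) (@pos_def_log_cosh R)).
  by apply: pos_def_ext => g h; rewrite exprVn.
- by move=> g; rewrite invr_ge0 exprn_ge0 // addr_ge0.
- by move=> g; rewrite addr_ge0 // ln_ge0 // ler1n.
- move=> g h; rewrite -[leRHS]addrA lerD2l addrCA addrA.
  have g0 := SL2_cosh_gt0 (val g); have h0 := SL2_cosh_gt0 (val h).
  have gh0 := mulr_gt0 (mulr_gt0 (ltr0n R 2) g0) h0.
  rewrite -!lnM ?posrE ?(mulr_gt0 (ltr0n R 2) g0) ?ltr0n //.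
  by rewrite ler_ln ?posrE ?gh0 ?SL2_cosh_gt0 //; exact: SL2_coshM.
- move=> g; rewrite lef_pV2 ?posrE ?exprn_gt0 ?ltr_wpDr ?addr_ge0 ?lc0 ?ln_ge0 ?ler1n //.
  have : 0 <= ln 2 :> R by rewrite ln_ge0 // ler1n.
  by have := lc0 g; move: (lc g) (ln _) => x y; nra.
- suff le m n : (m <= n)%N -> (a ^+ m)%g = (a ^+ n)%g -> m = n.
    by move=> m n E; have [/le|/ltnW/le] := leqP m n => [|h]; [exact|apply/esym/h].
  move=> /subnKC <-; case: (n - m)%N => [|k]; first by rewrite addn0.
  rewrite expgnDr -{1}[(a ^+ m)%g]mulg1 => /mulgI/(congr1 val); rewrite val_pow => E.
  by have := (ha k).1; rewrite -E /SL2_trace e00_1 e11_1 ltxx.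
apply: sum_bounded_le (sum_boundedZ (ltW (ltr0n R 2)) hC) => n.
have -> : lc (zpow a n) = ln (SL2_cosh (val a ^+ `|n|)%g).
  rewrite -val_pow -zpow_nat; have [n0|n0] := leP 0 n; first by rewrite gez0_abs.
  rewrite ltz0_abs // zpowN /lc.
  by rewrite [val _^-1%g](_ : _ = (val (zpow a n))^-1%g) ?SL2_coshV.
have c0 : 0 <= ln (SL2_cosh (val a ^+ `|n|)%g) by apply/ln_ge0/SL2_cosh_ge1.
have := (ha `|n|%N).2; move: (ln _) c0 => x x0 hx.
have -> : n%:~R ^+ 2 = `|n|%:R ^+ 2 :> R.
  by rewrite natr_absz intr_norm real_normK ?num_real.
rewrite -[2]invrK -invfM lef_pV2 ?posrE.
- have : 0 <= `|n|%:R * mu by rewrite mulr_ge0 // ltW.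
  rewrite (_ : mu ^+ 2 * _ = (`|n|%:R * mu) ^+ 2); last by ring.
  by move: hx; move: (_ * mu) => u; nra.
- by rewrite exprn_gt0 // ltr_wpDr.
by rewrite mulr_gt0 // ?invr_gt0 // ltr_wpDr // mulr_ge0 // ?sqr_ge0.
Qed.

(** * Subgroups without hyperbolic elements *)

(** The Cauchy kernel of the real line, pulled back along the character [y], has the
    required decay. *)
Lemma framenable_of_hom (R : realType) (G : groupType) (y : G -> R) (a : G) :
  countably_infinite [set: G] -> {morph y : g h / (g * h)%g >-> g + h} -> y a != 0 ->
  framenable R G.
Proof.
move=> cG yM ya; have y1 : y 1%g = 0 by apply: (@addrI _ (y 1%g)); rewrite -yM mulg1 addr0.
have yV g : y g^-1%g = - y g by apply: (@addrI _ (y g)); rewrite -yM mulgV y1 subrr.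
have yX n : y (a ^+ n)%g = n%:R * y a.
  by elim: n => [|n IH]; rewrite ?expg0 ?mul0r // expgS yM IH -addn1 natrD mulrDl mul1r addrC.
have yZ n : y (zpow a n) = n%:~R * y a.
  case: (intP n) => [|k|k]; first by rewrite zpow0 y1 mul0r.
    by rewrite zpow_nat yX.
  by rewrite zpowN yV zpow_nat yX mulrNz mulNr.
have y2 : 0 < y a ^+ 2 by rewrite exprn_even_gt0.
have [C hC] := sum_bounded_inv_sqr y2.
have p0 (x : R) : 0 < 1 + x ^+ 2 by rewrite ltr_wpDr // sqr_ge0.
apply: (@framenable_of_pos_def R G (fun g => (1 + y g ^+ 2)^-1) (fun g => `|y g|) a C) => //.
- have K := pos_defZ (ler0n R 2) (pos_def_rank1 y).
  apply: pos_def_ext (@pos_def_inv R G (fun g => 1 / 2 + y g ^+ 2) _ K _ _).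
  + by move=> g h /=; congr (_^-1); rewrite yM yV; field.
  + by move=> g; have := sqr_ge0 (y g); lra.
  + by move=> g /=; rewrite -expr2; lra.
- by move=> g; rewrite invr_ge0 ltW.
- by move=> g h; rewrite yM ler_normD.
- move=> g; rewrite lef_pV2 ?posrE ?exprn_gt0 ?p0 ?ltr_wpDr //.
  by rewrite -[y g ^+ 2]real_normK ?num_real //; have := normr_ge0 (y g); nra.
- move=> m n /(congr1 y); rewrite !yX => /(mulIf ya) /eqP; rewrite eqr_nat => /eqP.
  exact.
by apply: sum_bounded_le hC => n; rewrite yZ exprMn mulrC.
Qed.

Lemma sqr_le0_eq0 (R : realDomainType) (x : R) : x ^+ 2 <= 0 -> x = 0.
Proof. by move=> x0; apply/eqP; rewrite -sqrf_eq0 eq_le x0 sqr_ge0. Qed.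

Section NoHyperbolic.
Variable R : realType.
Variable L : groupClosed (SL2 R).
Hypothesis noHyp : forall x, x \in L -> SL2_trace x ^+ 2 <= 4.

(** Fricke's identity for the trace of a commutator, as a sum of two terms: the first one
    vanishes if [g] is parabolic, and the second one is the square of the trace of
    [(g - SL2_trace g / 2) * h]. *)
Lemma SL2_trace_commutator (g h : SL2 R) : SL2_trace (g * h * (g^-1 * h^-1))%g - 2 =
  (1 - SL2_trace g ^+ 2 / 4) * (SL2_trace h ^+ 2 - 4) +
  (SL2_trace (g * h)%g - SL2_trace g * SL2_trace h / 2) ^+ 2.
Proof.
have homogeneous : SL2_trace (g * h * (g^-1 * h^-1))%g =
    (e00 h * e11 h - e01 h * e10 h) * SL2_trace g ^+ 2 +
    (e00 g * e11 g - e01 g * e10 g) * SL2_trace h ^+ 2 + SL2_trace (g * h)%g ^+ 2 -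
    SL2_trace g * SL2_trace h * SL2_trace (g * h)%g -
    2 * (e00 g * e11 g - e01 g * e10 g) * (e00 h * e11 h - e01 h * e10 h).
  rewrite /SL2_trace !(e00M, e01M, e10M, e11M) !(e00V, e01V, e10V, e11V); ring.
by rewrite homogeneous !SL2_det; field.
Qed.

Lemma SL2_trace_le2 x : x \in L -> SL2_trace x <= 2.
Proof. by move/noHyp; nra. Qed.

Section Parabolic.
Variable g : SL2 R.
Hypotheses (gL : g \in L) (g4 : SL2_trace g ^+ 2 = 4).
Hypothesis g_nonscalar : ~ (e00 g = e11 g /\ e01 g = 0 /\ e10 g = 0).

Let a := (e00 g - e11 g) / 2.
Let D := 2 * a ^+ 2 + e01 g ^+ 2 + e10 g ^+ 2.
Let X (h : SL2 R) := (a * (e00 h - e11 h) + e01 g * e01 h + e10 g * e10 h) / D.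
Let chi (h : SL2 R) := SL2_trace h / 2.

Let a2 : a ^+ 2 + e01 g * e10 g = 0.
Proof. by have := g4; have := SL2_det g; rewrite /SL2_trace /a; nra. Qed.

Let D0 : 0 < D.
Proof.
have [//|D0] := ltP 0 D; exfalso; apply: g_nonscalar.
have := sqr_ge0 a; have := sqr_ge0 (e01 g); have := sqr_ge0 (e10 g) => h1 h2 h3.
have /eqP : a ^+ 2 = 0 by move: D0; rewrite /D; lra.
have /eqP : e01 g ^+ 2 = 0 by move: D0; rewrite /D; lra.
have /eqP : e10 g ^+ 2 = 0 by move: D0; rewrite /D; lra.
rewrite !sqrf_eq0 => /eqP-> /eqP-> /eqP; rewrite /a => a0; split=> //; lra.
Qed.

(** The trace of the commutator of [g] and [h] is at most 2, so that the trace free part of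
    [h] is orthogonal to that of [g] for the trace form; the latter is isotropic,
    and the former is not hyperbolic, hence they are proportional. *)
Let unipotent (h : SL2 R) : h \in L ->
  [/\ e00 h = chi h + X h * a, e01 h = X h * e01 g, e10 h = X h * e10 g &
      e11 h = chi h - X h * a].
Proof.
move=> hL; pose A := (e00 h - e11 h) / 2.
have tr0 : 2 * (a * A) + e01 g * e10 h + e10 g * e01 h = 0.
  have := SL2_trace_le2 (gpredM _ _ (gpredM _ _ gL hL) (gpredM _ _ (gpredVr _ gL) (gpredVr _ hL))).
  have := SL2_trace_commutator g h; rewrite g4 divff ?pnatr_eq0 // subrr mul0r add0r => E le2.
  have : (SL2_trace (g * h)%g - SL2_trace g * SL2_trace h / 2) ^+ 2 <= 0 by lra.
  by move/sqr_le0_eq0 <-; rewrite /SL2_trace e00M e11M /a /A; field.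
have A2 : A ^+ 2 + e01 h * e10 h <= 0.
  by have := noHyp hL; have := SL2_det h; rewrite /SL2_trace /A; nra.
have XE x : A = x * a -> e01 h = x * e01 g -> e10 h = x * e10 g -> X h = x.
  rewrite /X (_ : e00 h - e11 h = 2 * A); last by rewrite /A; field.
  move=> -> -> ->; apply: (mulIf (lt0r_neq0 D0)); rewrite divfK ?lt0r_neq0 //.
  by rewrite /D; ring.
suff [x [hA h1 h2]] : exists x, [/\ A = x * a, e01 h = x * e01 g & e10 h = x * e10 g].
  have -> := XE x hA h1 h2; rewrite -hA -h1 -h2 /chi /SL2_trace /A.
  by split=> //; field.
have [q0|q0] := eqVneq (e01 g) 0.
  have a0 : a = 0 by apply/eqP; rewrite -sqrf_eq0 -a2 q0 mul0r addr0.
  have r0 : e10 g != 0.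
    apply/eqP => r0; apply: g_nonscalar; split=> //.
    by move: a0; rewrite /a; lra.
  have h0 : e01 h = 0.
    move: tr0; rewrite a0 q0 !mul0r mulr0 !add0r => /eqP; rewrite mulf_eq0 (negPf r0) /=.
    by move/eqP.
  exists (e10 h / e10 g); rewrite a0 q0 h0 !mulr0 divfK //; split=> //.
  by move: A2; rewrite h0 mul0r addr0 => /sqr_le0_eq0.
have qA : e01 g * A = a * e01 h.
  apply/eqP; rewrite -subr_eq0; apply/eqP/sqr_le0_eq0.
  have -> : (e01 g * A - a * e01 h) ^+ 2 = e01 g ^+ 2 * (A ^+ 2 + e01 h * e10 h) +
     e01 h ^+ 2 * (a ^+ 2 + e01 g * e10 g) -
     e01 g * e01 h * (2 * (a * A) + e01 g * e10 h + e10 g * e01 h) by ring.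
  by rewrite a2 tr0 !mulr0 subr0 addr0 mulr_ge0_le0 // sqr_ge0.
exists (e01 h / e01 g); split; last 2 first.
- by rewrite divfK.
- apply: (mulfI q0); rewrite mulrA [_ * (_ / _)]mulrC divfK //.
  apply: (mulfI q0); have E : e01 g * e10 h = - 2 * (a * A) - e10 g * e01 h by move: tr0; lra.
  rewrite E mulrBr (_ : e01 g * _ = - 2 * a * (e01 g * A)); last by ring.
  rewrite qA (_ : - 2 * a * _ = - 2 * a ^+ 2 * e01 h); last by ring.
  by rewrite (_ : a ^+ 2 = - (e01 g * e10 g)); [ring|move: a2; lra].
by apply: (mulfI q0); rewrite qA; field.
Qed.

Let chi2 (h : SL2 R) : h \in L -> chi h ^+ 2 = 1.
Proof.
move=> hL; rewrite -(SL2_det h); have [h0 h1 h2 h3] := unipotent hL.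
rewrite [in RHS]h0 [in RHS]h1 [in RHS]h2 [in RHS]h3.
rewrite [RHS](_ : _ = chi h ^+ 2 - X h ^+ 2 * (a ^+ 2 + e01 g * e10 g)); last by ring.
by rewrite a2 mulr0 subr0.
Qed.

(** The real character is the coordinate along the one-parameter unipotent group
    through [g], once [h] is divided by its sign [chi h]. *)
Lemma framenable_parabolic : countably_infinite [set: subgroup_type L] ->
  framenable R (subgroup_type L).
Proof.
move=> cL; pose y (h : subgroup_type L) := chi (val h) * X (val h).
pose gl : subgroup_type L := Sub g gL.
have chig : chi g ^+ 2 = 1 := chi2 gL.
apply: (@framenable_of_hom R _ y gl) => //.
  move=> h k; rewrite /y [val (h * k)%g](_ : _ = (val h * val k)%g) //.
  have hL := valP h; have kL := valP k.
  move: (val h) (val k) hL kL => {}h {}k hL kL.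
  have [h0 h1 h2 h3] := unipotent hL; have [k0 k1 k2 k3] := unipotent kL.
  have -> : chi (h * k)%g = chi h * chi k + X h * X k * (a ^+ 2 + e01 g * e10 g).
    by rewrite {1}/chi /SL2_trace e00M e11M h0 h1 h2 h3 k0 k1 k2 k3; field.
  have -> : X (h * k)%g = chi h * X k + X h * chi k.
    rewrite {1}/X e00M e01M e10M e11M h0 h1 h2 h3 k0 k1 k2 k3 /D; field.
    exact: lt0r_neq0 D0.
  rewrite a2 mulr0 addr0.
  rewrite (_ : _ * _ = chi h ^+ 2 * (chi k * X k) + chi k ^+ 2 * (chi h * X h)); last by ring.
  by rewrite !chi2 // !mul1r addrC.
rewrite /y /= mulf_neq0 //; first by rewrite -sqrf_eq0 chig oner_neq0.
have -> : X g = 1; last exact: oner_neq0.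
by rewrite /X -[RHS](divff (lt0r_neq0 D0)) /D /a; congr (_ / _); field.
Qed.

End Parabolic.

Section Elliptic.
Variable g : SL2 R.
Hypotheses (gL : g \in L) (g4 : SL2_trace g ^+ 2 < 4).

Let a := (e00 g - e11 g) / 2.
Let delta := - (a ^+ 2 + e01 g * e10 g).

Let delta0 : 0 < delta.
Proof. by have := g4; have := SL2_det g; rewrite /SL2_trace /delta /a; nra. Qed.

Let q0 : e01 g != 0.
Proof.
by apply/eqP => q; have := delta0; rewrite /delta q mul0r; have := sqr_ge0 a; lra.
Qed.

(** The fixed points of [g] and of its conjugate [k = h * g * h^-1] in the hyperbolic
    plane coincide, since otherwise [g * k^-1] would be hyperbolic. *)
Lemma elliptic_commute (h : SL2 R) : h \in L -> (h * g)%g = (g * h)%g.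
Proof.
move=> hL; pose k := (h * g * h^-1)%g.
have kL : k \in L := gpredM _ _ (gpredM _ _ hL gL) (gpredVr _ hL).
suff : k = g by move=> /(congr1 (fun x => (x * h)%g)); rewrite /k mulgVK.
pose b := (e00 k - e11 k) / 2.
have trk : e00 k + e11 k = e00 g + e11 g.
  have := SL2_det h; rewrite /k !(e00M, e01M, e10M, e11M) !(e00V, e01V, e10V, e11V) => d.
  rewrite -[RHS]mul1r -d; ring.
have dk : b ^+ 2 + e01 k * e10 k = - delta.
  have := SL2_det k; have := SL2_det g; rewrite /delta /b /a.
  move=> d1 d2; rewrite opprK.
  have -> : ((e00 k - e11 k) / 2) ^+ 2 + e01 k * e10 k =
     ((e00 k + e11 k) / 2) ^+ 2 - (e00 k * e11 k - e01 k * e10 k) by field.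
  by rewrite d2 trk -[X in _ - X]d1; field.
have pos : 0 < e01 g * e01 k.
  have -> : e01 g * e01 k = (e01 g * e00 h - a * e01 h) ^+ 2 + delta * e01 h ^+ 2.
    by rewrite /k !(e00M, e01M, e10M, e11M) !(e00V, e01V, e10V, e11V) /delta /a; field.
  have [h0|h0] := eqVneq (e01 h) 0.
    rewrite h0 mulr0 subr0 expr0n mulr0 addr0 exprn_even_gt0 //= mulf_neq0 //.
    by apply/eqP => h00; have := SL2_det h; rewrite h0 h00 !mul0r subr0 => /eqP; rewrite eq_sym oner_eq0.
  by rewrite ltr_wpDl ?sqr_ge0 // mulr_gt0 // exprn_even_gt0.
have le2 : - (2 * a * b + e01 g * e10 k + e10 g * e01 k) <= 2 * delta.
  have := SL2_trace_le2 (gpredM _ _ gL (gpredVr _ kL)).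
  rewrite /SL2_trace e00M e11M e00V e01V e10V e11V.
  have := SL2_det g; have := SL2_det k; move: trk; rewrite /a /b /delta /a.
  nra.
have : delta * (e01 g - e01 k) ^+ 2 + (e01 g * b - e01 k * a) ^+ 2 <= 0.
  have -> : delta * (e01 g - e01 k) ^+ 2 + (e01 g * b - e01 k * a) ^+ 2 =
    e01 g * e01 k * (- (2 * a * b + e01 g * e10 k + e10 g * e01 k) - 2 * delta) +
    e01 g ^+ 2 * (b ^+ 2 + e01 k * e10 k + delta) by rewrite /delta; ring.
  by rewrite dk addNr mulr0 addr0 pmulr_rle0 // subr_le0.
have s1 := sqr_ge0 (e01 g * b - e01 k * a).
have s2 : 0 <= delta * (e01 g - e01 k) ^+ 2 by rewrite mulr_ge0 ?sqr_ge0 // ltW.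
move=> le0.
have : delta * (e01 g - e01 k) ^+ 2 <= 0 by lra.
rewrite pmulr_rle0 // => /sqr_le0_eq0/eqP; rewrite subr_eq0 => /eqP ek.
have : (e01 g * b - e01 k * a) ^+ 2 <= 0 by lra.
move=> /sqr_le0_eq0/eqP; rewrite -ek -mulrBr mulf_eq0 (negPf q0) subr_eq0 => /eqP ba.
have e10k : e10 k = e10 g.
  apply: (mulfI q0); apply: (@addrI _ (b ^+ 2)).
  by rewrite {1}ek dk ba /delta opprK.
by apply: SL2_ext => //; move: ba trk; rewrite /a /b; lra.
Qed.

(** The centralizer of [g] is a compact group of rotations [al + be * (g - SL2_trace g / 2)],
    with [al] and [be] on an ellipse. *)
Lemma elliptic_bounded : exists M, forall h, h \in L ->
  [/\ `|e00 h| <= M, `|e01 h| <= M, `|e10 h| <= M & `|e11 h| <= M].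
Proof.
pose S := a ^+ 2 + e01 g ^+ 2 + e10 g ^+ 2.
have S0 : 0 <= S by rewrite !addr_ge0 ?sqr_ge0.
exists (2 + 2 * (S / delta)) => h hL; have C := elliptic_commute hL.
pose al := SL2_trace h / 2; pose be := e01 h / e01 g.
have h01 : e01 h = be * e01 g by rewrite divfK.
have h10 : e10 h = be * e10 g.
  apply: (mulfI q0); rewrite mulrA [e01 g * be]mulrC -h01.
  by have := congr1 (@e00 R) C; rewrite !e00M; lra.
have hA : (e00 h - e11 h) / 2 = be * a.
  apply: (mulfI q0); rewrite [RHS]mulrA [e01 g * be]mulrC -h01.
  by have := congr1 (@e01 R) C; rewrite !e01M /a; lra.
have h00 : e00 h = al + be * a by rewrite -hA /al /SL2_trace; field.
have h11 : e11 h = al - be * a by rewrite -hA /al /SL2_trace; field.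
have circle : al ^+ 2 + delta * be ^+ 2 = 1.
  by rewrite -(SL2_det h) h00 h01 h10 h11 /delta; ring.
have al1 : al ^+ 2 <= 1.
  by rewrite -circle lerDl mulr_ge0 ?sqr_ge0 // ltW.
have be1 : be ^+ 2 * S <= S / delta.
  rewrite mulrC ler_wpM2l // -[leRHS]mul1r ler_pdivlMr // mulrC -circle lerDr; exact: sqr_ge0.
have norm_le x : x ^+ 2 <= 2 * (1 + S / delta) -> `|x| <= 2 + 2 * (S / delta).
  have := real_normK (num_real x); have := normr_ge0 x.
  have : 0 <= S / delta by rewrite divr_ge0 // ltW.
  move: `|x| (S / delta) => y z; nra.
have sq (x : R) : x ^+ 2 <= S -> (be * x) ^+ 2 <= S / delta.
  by move=> xS; apply: le_trans be1; rewrite exprMn ler_wpM2l ?sqr_ge0.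
have [sa [s1 s2]] : a ^+ 2 <= S /\ e01 g ^+ 2 <= S /\ e10 g ^+ 2 <= S.
  by rewrite /S; have := sqr_ge0 a; have := sqr_ge0 (e01 g); have := sqr_ge0 (e10 g); split; [|split]; lra.
have z0 : 0 <= S / delta by rewrite divr_ge0 // ltW.
split; apply: norm_le; rewrite ?h00 ?h01 ?h10 ?h11.
- by move: (sq _ sa) al1; have := sqr_ge0 (al - be * a); move: (be * a) => u; lra.
- by move: (sq _ s1); lra.
- by move: (sq _ s2); lra.
by move: (sq _ sa) al1; have := sqr_ge0 (al + be * a); move: (be * a) => u; lra.
Qed.

End Elliptic.
End NoHyperbolic.

(** * Bounded discrete subgroups *)

Section Discrete.
Variable R : realType.
Variable L : groupClosed (SL2 R).

Lemma isolated_entries : discrete_subgroup L ->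
  exists2 eps : R, 0 < eps & forall x, x \in L ->
  `|e00 x - 1| < eps -> `|e01 x| < eps -> `|e10 x| < eps -> `|e11 x - 1| < eps ->
  x = 1%g.
Proof.
move=> /(_ 1%g gpred1)[_ [V V1 VL]].
have : nbhs (1%g : initial_topology (val : SL2 R -> 'M[R]_2)) V by exact: V1.
rewrite nbhsE => -[B [[W oW <-] B1] BV].
have : nbhs (val (1%g : SL2 R)) W by apply: open_nbhs_nbhs; split.
rewrite -nbhs_ballE => -[eps /= eps0 epsW]; exists eps => // x xL h0 h1 h2 h3.
suff : (V `&` [set` L]) x by rewrite VL.
split=> //; apply: BV => /=; apply: epsW; split=> // i j; rewrite /ball /= distrC.
case: (ord2_cases i) => ->; case: (ord2_cases j) => ->; rewrite ?mxE /= ?subr0 //.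
Qed.

Let close (x y delta : R) : 0 < delta ->
  0 <= x -> 0 <= y -> Num.trunc (x / delta) = Num.trunc (y / delta) -> `|x - y| < delta.
Proof.
move=> d0 x0 y0 E.
have /truncn_itv/andP := divr_ge0 x0 (ltW d0); have /truncn_itv/andP := divr_ge0 y0 (ltW d0).
rewrite -E !ler_pdivlMr // !ltr_pdivrMr // -addn1 natrD mulrDl mul1r.
by move: (_ * delta) => u [] ? ? [] ? ?; rewrite ltr_norml; apply/andP; split; lra.
Qed.

(** By the pigeonhole principle two of infinitely many bounded elements have all
    their entries close to each other, so that their quotient is close to [1]. *)
Lemma discrete_bounded_finite (M : R) : discrete_subgroup L ->
  (forall x, x \in L -> [/\ `|e00 x| <= M, `|e01 x| <= M, `|e10 x| <= M & `|e11 x| <= M]) ->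
  ~ countably_infinite [set: subgroup_type L].
Proof.
move=> /isolated_entries[eps eps0 iso] LM /countably_infinite_enum[e [r [eK _]]].
have M1 : 1 <= M by have [+ _ _ _] := LM _ (gpred1 : 1%g \in L); rewrite e00_1 normr1.
have M0 : 0 < M by apply: lt_le_trans M1.
pose delta := eps / (2 * M); have d0 : 0 < delta by rewrite divr_gt0 // mulr_gt0.
pose cell (u : R) := Num.trunc ((u + M) / delta).
pose m := Num.trunc (2 * M / delta).
have cell_lt u : `|u| <= M -> (cell u < m.+1)%N.
  move=> uM; rewrite ltnS; apply: le_truncn; rewrite ler_pM2r ?invr_gt0 //.
  by have := ler_norm u; lra.
have cell_inj u v : `|u| <= M -> `|v| <= M ->
    inord (cell u) = inord (cell v) :> 'I_m.+1 -> `|v - u| < delta.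
  move=> uM vM /(congr1 (@nat_of_ord _)); rewrite !inordK ?cell_lt // => E.
  rewrite distrC (_ : u - v = (u + M) - (v + M)); last by ring.
  move: uM vM; rewrite !ler_norml => /andP[u0 _] /andP[v0 _].
  by apply: close => //; lra.
pose f (x : subgroup_type L) : 'I_m.+1 * 'I_m.+1 * ('I_m.+1 * 'I_m.+1) :=
  (inord (cell (e00 (val x))), inord (cell (e01 (val x))),
  (inord (cell (e10 (val x))), inord (cell (e11 (val x))))).
have fI : injective f.
  move=> x y [E0 E1 E2 E3]; apply: val_inj.
  have [x0 x1 x2 x3] := LM _ (valP x); have [y0 y1 y2 y3] := LM _ (valP y).
  have {}E0 := cell_inj _ _ x0 y0 E0; have {}E1 := cell_inj _ _ x1 y1 E1.
  have {}E2 := cell_inj _ _ x2 y2 E2; have {}E3 := cell_inj _ _ x3 y3 E3.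
  have small u v s t : `|u| <= M -> `|v| <= M -> `|s| < delta -> `|t| < delta ->
      `|u * s - v * t| < eps.
    move=> uM vM sd td; apply: le_lt_trans (ler_normB _ _) _; rewrite !normrM.
    have -> : eps = M * delta + M * delta by rewrite /delta; field; rewrite gt_eqF.
    have lt a b : `|a| <= M -> `|b| < delta -> `|a| * `|b| < M * delta.
      move=> aM bd; apply: (@le_lt_trans _ _ (M * `|b|)); first by rewrite ler_wpM2r.
      by rewrite ltr_pM2l.
    by rewrite ltrD ?lt.
  have dx := SL2_det (val x).
  apply/esym/(mulgI (val x)^-1%g); rewrite mulVg; apply: iso.
  - exact: (gpredM _ _ (gpredVr _ (valP x)) (valP y)).
  - rewrite e00M e00V e01V -dx (_ : _ - _ = e11 (val x) * (e00 (val y) - e00 (val x)) -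
      e01 (val x) * (e10 (val y) - e10 (val x))); last by ring.
    exact: small.
  - rewrite e01M e00V e01V (_ : _ + _ = e11 (val x) * (e01 (val y) - e01 (val x)) -
      e01 (val x) * (e11 (val y) - e11 (val x))); last by ring.
    exact: small.
  - rewrite e10M e10V e11V (_ : _ + _ = e00 (val x) * (e10 (val y) - e10 (val x)) -
      e10 (val x) * (e00 (val y) - e00 (val x))); last by ring.
    exact: small.
  rewrite e11M e10V e11V -dx (_ : _ - _ = e00 (val x) * (e11 (val y) - e11 (val x)) -
      e10 (val x) * (e01 (val y) - e01 (val x))); last by ring.
  exact: small.
pose F : finType := ('I_m.+1 * 'I_m.+1 * ('I_m.+1 * 'I_m.+1))%type.
have : injective (fun i : 'I_#|F|.+1 => f (e i)).
  by move=> i j /fI /(can_inj eK) ij; apply: val_inj.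
by move=> /leq_card; rewrite card_ord ltnn.
Qed.

End Discrete.

Theorem corollary3p16 (R : realType) (L : groupClosed (SL2 R))
    (L_countable : countably_infinite [set: subgroup_type L])
    (L_lattice : lattice L) :
  framenable R (subgroup_type L).
Proof.
have [Hyp|noHyp] := pselect (exists2 x, x \in L & 4 < SL2_trace x ^+ 2).
  have [x xL x4] := Hyp.
  (* the trace of the square is positive, whatever the sign of that of [x] *)
  apply: (@framenable_hyperbolic R L (Sub (x * x)%g (gpredM _ _ xL xL))) => //=.
  have tr1 : SL2_trace (1%g : SL2 R) = 2 by rewrite /SL2_trace e00_1 e11_1.
  by have := SL2_cayley_hamilton x 1%g; rewrite !mulg1 tr1; lra.
have {}noHyp x : x \in L -> SL2_trace x ^+ 2 <= 4.
  by move=> xL; rewrite leNgt; apply/negP => x4; apply: noHyp; exists x.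
have [[g [gL g4 gs]]|noPar] := pselect (exists g : SL2 R, [/\ g \in L, SL2_trace g ^+ 2 = 4 &
    ~ (e00 g = e11 g /\ e01 g = 0 /\ e10 g = 0)]).
  exact: (framenable_parabolic noHyp gL g4 gs).
have [M LM] : exists M, forall x, x \in L ->
    [/\ `|e00 x| <= M, `|e01 x| <= M, `|e10 x| <= M & `|e11 x| <= M].
  have [[g gL g4]|noEll] := pselect (exists2 g, g \in L & SL2_trace g ^+ 2 < 4).
    exact: (elliptic_bounded noHyp gL g4).
  exists 1 => x xL; have x4 : SL2_trace x ^+ 2 = 4.
    by apply/eqP; rewrite eq_le noHyp //= leNgt; apply/negP => x4; apply: noEll; exists x.
  have [[h0 [h1 h2]]|xs] := pselect (e00 x = e11 x /\ e01 x = 0 /\ e10 x = 0); last first.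
    by exfalso; apply: noPar; exists x.
  have : e11 x ^+ 2 = 1 by have := SL2_det x; rewrite h0 h1 mul0r subr0.
  rewrite h0 h1 h2 normr0 ler01 => /eqP; rewrite sqrf_eq1 => /orP[]/eqP->.
    by rewrite normr1 lexx.
  by rewrite normrN normr1 lexx.
by have := discrete_bounded_finite L_lattice.1 LM.
Qed.
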